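(* Let $n\geq 2$ and let $f\in R=\mathbb{C}[x_1,\dots,x_n]$ be homogeneous of degree $d$, with $\dim\operatorname{Sing} f^{-1}(0)\leq 1$ and $f$ not a polynomial of $n-1$ variables. Then for all $k\in\mathbb{Z}$ $$\mu'_k=\mu_k+\mu_{nd-k}-\gamma_k-\tau_Z,\qquad \mu''_k=\tau_Z-\mu_{nd-k}+\gamma_k.$$
   Context: $R=\mathbb{C}[x_1,\dots,x_n]$ is graded by $\deg x_i=1$. $\Omega^j$ is the graded free $R$-module of algebraic differential $j$-forms on $\mathbb{C}^n$, with $\deg x_i=\deg dx_i=1$. $\operatorname{Sing} f^{-1}(0)\subset\mathbb{C}^n$ is the common zero set of the partial derivatives of $f$. ''$f$ is not a polynomial of $n-1$ variables'' means that no linear change of coordinates makes $f$ depend on only $n-1$ variables. $M:=\Omega^n/df\wedge\Omega^{n-1}$, graded so that $M_k$ consists of classes of $n$-forms of degree $k$. With $\mathfrak{m}=(x_1,\dots,x_n)$, $M':=\{a\in M\mid \mathfrak{m}^ja=0 \text{ for } j\gg 0\}$ and $M'':=M/M'$. Set $\mu_k:=\dim_{\mathbb{C}}M_k$, $\mu'_k:=\dim_{\mathbb{C}}M'_k$, $\mu''_k:=\dim_{\mathbb{C}}M''_k$. The integers $\gamma_k$ are defined by $\sum_k\gamma_kt^k=(t^d-t)^n/(t-1)^n$. $Z:=\{f=0\}\subset Y:=\mathbb{P}^{n-1}$, $\Sigma:=\operatorname{Sing}Z$ is the (finite) image in $\mathbb{P}^{n-1}$ of $\operatorname{Sing}f^{-1}(0)\setminus\{0\}$,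 and $\tau_Z:=\sum_{z\in\Sigma}\dim_{\mathbb{C}}\mathcal{O}_{Y,z}/(h_z,\partial h_z)$, where $h_z$ is a local defining equation of $Z$ at $z$ ($h_z$ being $f$ divided by the $d$-th power of a linear form not vanishing at $z$) and $(\partial h_z)$ is the ideal generated by its partial derivatives. *)

(* Defs.v *)
(* The ground field K below is meant to be C, that is, R[i] for R : realType. *)
From HB Require Import structures.
From mathcomp Require Import all_boot all_order all_algebra.
From mathcomp Require Import boolp classical_sets fsbigop reals.
From mathcomp Require Import complex mpoly.

Set Implicit Arguments.
Unset Strict Implicit.
Unset Printing Implicit Defensive.

Import GRing.Theory.

Local Open Scope ring_scope.
Local Open Scope classical_set_scope.

Section Dimension.
Context {K : fieldType} {E : lmodType K}.

(* The classes of the b i form a K-basis of V / (V `&` W). *)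
Definition basis_mod (V W : set E) (r : nat) (b : 'I_r -> E) : Prop :=
  [/\ forall i, V (b i),
      forall u, V u -> exists c : 'I_r -> K, W (u - \sum_i c i *: b i)
    & forall c : 'I_r -> K, W (\sum_i c i *: b i) -> forall i, c i = 0].

(* dim_K V / (V `&` W) for linear subspaces V and W; 0 if it is infinite. *)
Definition dim_quot (V W : set E) : nat :=
  xget 0%N [set r | exists b : 'I_r -> E, basis_mod V W b].

End Dimension.

Section Ideals.
Context {A : comNzRingType}.

(* The ideal of the subring O of A generated by S. *)
Definition ideal (O S : set A) : set A :=
  [set x | exists2 s : seq (A * A),
     forall p, p \in s -> O p.1 /\ S p.2 & x = \sum_(p <- s) p.1 * p.2].

Definition ideal_exp (I : set A) (j : nat) : set A :=
  iter j (fun J => ideal setT [set x * y | x in I & y in J]) setT.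

End Ideals.

Section AlgebraicSets.
Context {K : fieldType} {n : nat}.

Definition zeros (I : set {mpoly K[n]}) : set 'rV[K]_n :=
  [set v | forall p, I p -> p.@[v ord0] = 0].

Definition zariski_closed (X : set 'rV[K]_n) : Prop := exists I, X = zeros I.

Definition irreducible_closed (X : set 'rV[K]_n) : Prop :=
  [/\ zariski_closed X, X !=set0 &
      forall A B, zariski_closed A -> zariski_closed B ->
        X `<=` A `|` B -> X `<=` A \/ X `<=` B].

(* Krull dimension, for X Zariski closed: every strictly increasing chain
   Z 0, ..., Z m of irreducible closed subsets of X has m <= r. *)
Definition dim_le (X : set 'rV[K]_n) (r : nat) : Prop :=
  forall (m : nat) (Z : nat -> set 'rV[K]_n),
    (forall i, (i <= m)%N -> irreducible_closed (Z i) /\ Z i `<=` X) ->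
    (forall i, (i < m)%N -> Z i `<` Z i.+1) ->
    (m <= r)%N.

Definition sing (f : {mpoly K[n]}) : set 'rV[K]_n :=
  zeros (range (fun i : 'I_n => f^`M(i))).

(* f (A x) *)
Definition linear_change (A : 'M[K]_n) (f : {mpoly K[n]}) : {mpoly K[n]} :=
  f \mPo [tuple \sum_(j < n) A i j *: 'X_j | i < n].

Definition polynomial_of_fewer_variables (f : {mpoly K[n]}) : Prop :=
  exists2 A : 'M[K]_n, A \in unitmx &
    exists i : 'I_n, forall m, m \in msupp (linear_change A f) -> m i = 0%N.

End AlgebraicSets.

(* The algebra of differential forms on K^n; w stands for the sum over S of
   w S dx_S, where dx_S is the wedge product of the dx_i, i in S, taken in
   increasing order. *)
Notation form K n := {ffun {set 'I_n} -> {mpoly K[n]}}.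

Section Forms.
Context {K : fieldType} {n : nat}.

(* The sign s such that dx_A /\ dx_B = s dx_(A :|: B) for A, B disjoint. *)
Definition shuffle_sign (A B : {set 'I_n}) : {mpoly K[n]} :=
  (-1) ^+ (\sum_(a in A) \sum_(b in B) (b < a))%N.

Definition wedge (u w : form K n) : form K n :=
  [ffun S : {set 'I_n} => \sum_(A : {set 'I_n} | A \subset S)
     shuffle_sign A (S :\: A)%SET * u A * w (S :\: A)%SET].

Definition mulform (g : {mpoly K[n]}) (w : form K n) : form K n :=
  [ffun S => g * w S].

Definition dform (f : {mpoly K[n]}) : form K n :=
  [ffun S => \sum_(i < n | S == [set i]%SET) f^`M(i)].

Definition Omega (j : nat) : set (form K n) :=
  [set w | forall S : {set 'I_n}, w S != 0 -> #|S| = j].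

(* The degree k part of Omega j, with deg x_i = deg dx_i = 1. *)
Definition Omega_deg (j : nat) (k : int) : set (form K n) :=
  Omega j `&` [set w | forall (S : {set 'I_n}) m,
                         m \in msupp (w S) -> (mdeg m + #|S|)%:Z = k].

Definition maxideal : set {mpoly K[n]} :=
  ideal setT (range (fun i : 'I_n => 'X_i)).

(* The submodule of Omega n by which M is the quotient. *)
Definition M_rel (f : {mpoly K[n]}) : set (form K n) :=
  [set wedge (dform f) eta | eta in Omega n.-1].

(* The forms in Omega n whose class in M belongs to M'. *)
Definition M'_forms (f : {mpoly K[n]}) : set (form K n) :=
  Omega n `&` [set w | exists j0 : nat, forall j, (j0 <= j)%N ->
    forall g, ideal_exp maxideal j g -> M_rel f (mulform g w)].

Definition mu (f : {mpoly K[n]}) (k : int) : nat :=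
  dim_quot (Omega_deg n k) (M_rel f).

Definition mu' (f : {mpoly K[n]}) (k : int) : nat :=
  dim_quot (Omega_deg n k `&` M'_forms f) (M_rel f).

(* M'' = M / M' is the quotient of Omega n by M'_forms f. *)
Definition mu'' (f : {mpoly K[n]}) (k : int) : nat :=
  dim_quot (Omega_deg n k) (M'_forms f).

End Forms.

(* The coefficient of t^k in (t^d - t)^n / (t - 1)^n; the division is exact,
   with monic divisor. *)
Definition gamma (n d : nat) (k : int) : int :=
  if k is Posz m
  then ((('X^d - 'X) ^+ n %/ ('X - 1) ^+ n : {poly int}))`_m
  else 0.

Section RationalFunctions.
Context {K : fieldType} {m : nat}.
Local Notation F := {fraction {mpoly K[m]}}.
Local Notation "p %:F" := (FracField.tofrac p) : ring_scope.

Definition frac_scale (c : K) (x : F) : F := (c%:MP)%:F * x.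

Fact frac_scaleA a b x : frac_scale a (frac_scale b x) = frac_scale (a * b) x.
Proof. by rewrite /frac_scale mulrA -tofracM -mpolyCM. Qed.

Fact frac_scale1 : left_id 1 frac_scale.
Proof. by move=> x; rewrite /frac_scale mpolyC1 tofrac1 mul1r. Qed.

Fact frac_scaleDr : right_distributive frac_scale +%R.
Proof. by move=> a x y; rewrite /frac_scale mulrDr. Qed.

Fact frac_scaleDl x : {morph frac_scale^~ x : a b / a + b}.
Proof. by move=> a b; rewrite /frac_scale mpolyCD tofracD mulrDl. Qed.

HB.instance Definition _ := GRing.Zmodule_isLmodule.Build K F
  frac_scaleA frac_scale1 frac_scaleDr frac_scaleDl.

(* The local ring of the affine space K^m at a. *)
Definition local_ring (a : 'rV[K]_m) : set F :=
  [set x | exists p q : {mpoly K[m]}, q.@[a ord0] != 0 /\ x = p%:F / q%:F].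

Definition tjurina (h : {mpoly K[m]}) (a : 'rV[K]_m) : nat :=
  dim_quot (local_ring a)
    (ideal (local_ring a) (h%:F |` range (fun j : 'I_m => (h^`M(j))%:F))).

End RationalFunctions.

Section Hypersurface.
Context {K : fieldType} {n : nat}.

(* f / x_i ^ d, for f homogeneous of degree d, as a polynomial in the
   coordinates x_j / x_i, j != i, of the affine chart x_i != 0 of P^(n-1). *)
Definition dehomog (i : 'I_n) (f : {mpoly K[n]}) : {mpoly K[n.-1]} :=
  f \mPo [tuple if unlift i j is Some l then 'X_l else 1 | j < n].

Definition chart_coord (i : 'I_n) (v : 'rV[K]_n) : 'rV[K]_n.-1 :=
  \row_j (v ord0 (lift i j) / v ord0 i).

(* dim O_{Y,z} / (h_z, d h_z) at the point z of P^(n-1) represented by v; it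
   depends neither on the chart containing z nor on v. *)
Definition tjurina_at (f : {mpoly K[n]}) (v : 'rV[K]_n) : nat :=
  if [pick i | v ord0 i != 0] is Some i
  then tjurina (dehomog i f) (chart_coord i v) else 0%N.

(* Points of P^(n-1) are the one-dimensional subspaces of K^n. *)
Definition Sigma (f : {mpoly K[n]}) : set {vspace 'rV[K]_n} :=
  [set <[v]>%VS | v in sing f `\ 0].

Definition tau (f : {mpoly K[n]}) : nat :=
  (\sum_(z \in Sigma f) tjurina_at f (vpick z))%N.

End Hypersurface.

(* Main.v *)
Require Import Defs.
From HB Require Import structures.
From mathcomp Require Import all_boot all_order all_algebra.
From mathcomp Require Import boolp classical_sets cardinality fsbigop reals finmap.
From mathcomp Require Import complex mpoly zify ring.

Set Implicit Arguments.
Unset Strict Implicit.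
Unset Printing Implicit Defensive.

Import Order.TTheory GRing.Theory Num.Theory.

Local Open Scope ring_scope.
Local Open Scope classical_set_scope.

(** The proof is commutative algebra in the graded polynomial ring [S], where [J] is
    the ideal of the [n] partial derivatives of [f], of degree [e = d - 1]. Top forms
    are identified with their coefficient, so that [M] is [S / J] up to a shift of
    degrees by [n], and [M''] is the quotient of [S] by the saturation of [J].

    The hypothesis on the dimension gives a linear form [l] such that [J + (l)]
    contains a power of the maximal ideal ([exists_parameter]). By Noether's
    normalization [J] is generated by forms [h_1, ..., h_n] of degree [e] such that
    already [I + (l)], for [I = (h_1, ..., h_(n-1))], contains such a power. Then [I] is
    a complete intersection of dimension one.

    Its truncations [S / (I + (l ^+ N))] are Gorenstein algebras ([frob], [curve_frob]).
    This is proved by exchange: one starts from powers of coordinates, where the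
    dualizing functional is a coefficient, and replaces one coordinate at a time by
    a form [h_i] ([exchange_frob], [mixed_frob]). If [x ^+ k = a h] modulo the other
    generators, then multiplication by [a] turns the functional for [x ^+ k] into one
    for [h]. The regularity needed on the way follows from the existence of the
    functionals for all exponents of [x]. The same exchange gives the Hilbert
    function of [S / I] ([mixed_hilb], [curve_hilb]), hence the numbers [gamma]:
    [gamma_k] is the value at [k - n], or by symmetry at [nd - k - n], of the
    coefficients of [(1 + t + ... + t^(e-1))^n].

    Multiplication by [h_n] on [S / (I + (l ^+ N))] has a kernel and a cokernel which are
    dual to each other. For [N] large the kernel in a fixed degree is governed by the
    Hilbert functions of [S / I] and [S / J], and the cokernel in the dual degree by
    those of [S / J] in large degree and of the saturation. This is [duality], and it
    is the formula for [mu''] as soon as the dimension of [S / J] in large degree is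
    known to be the total Tjurina number. The formula for [mu'] follows by
    subtraction ([mu_split]).

    That dimension is computed in [hilb_tau]. In large degree [S / J] is the
    product of its localizations at the points of the singular locus, by the
    Nullstellensatz and Chinese remainders ([hilb_meet], [hilb_lines]), and each
    localization is the Tjurina algebra in an affine chart, by Euler's relation
    ([dehomog_ideal], [tjurina_hilb]). *)

(** * Dimensions of quotients of subspaces *)

Section LinearAlgebra.
Context {K : fieldType}.
Implicit Types E : lmodType K.

Definition subsp E (W : set E) : Prop :=
  W 0 /\ forall (a : K) u v, W u -> W v -> W (a *: u + v).

Section OneSpace.
Context {E : lmodType K}.
Implicit Types V W U : set E.

Lemma subspD W u v : subsp W -> W u -> W v -> W (u + v).
Proof. by move=> [_ h] hu hv; rewrite -[u]scale1r; apply: h. Qed.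

Lemma subspZ W a u : subsp W -> W u -> W (a *: u).
Proof. by move=> [h0 h] hu; rewrite -[_ *: _]addr0; apply: h. Qed.

Lemma subspN W u : subsp W -> W u -> W (- u).
Proof. by move=> hW hu; rewrite -scaleN1r; apply: subspZ. Qed.

Lemma subspB W u v : subsp W -> W u -> W v -> W (u - v).
Proof. by move=> hW hu hv; apply: subspD => //; apply: subspN. Qed.

Lemma subsp_sum W (I : Type) (r : seq I) (P : pred I) (F : I -> E) : subsp W ->
  (forall i, P i -> W (F i)) -> W (\sum_(i <- r | P i) F i).
Proof.
move=> hW hF; elim/big_ind: _ => //; first by case: hW.
by move=> u v; apply: subspD.
Qed.

Lemma subspI V W : subsp V -> subsp W -> subsp (V `&` W).
Proof.
move=> [v0 hv] [w0 hw]; split=> // a x y [? ?] [? ?].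
by split; [apply: hv|apply: hw].
Qed.

Lemma lincomb_mulmx r r' (b : 'I_r' -> E) (C : 'M[K]_(r, r')) (x : 'rV[K]_r) :
  \sum_i x ord0 i *: (\sum_j C i j *: b j) = \sum_j (x *m C) ord0 j *: b j.
Proof.
under eq_bigr do rewrite scaler_sumr.
rewrite exchange_big /=; apply: eq_bigr => j _.
rewrite mxE scaler_suml; apply: eq_bigr => i _.
by rewrite scalerA.
Qed.

Lemma dependent_mod W r r' (b : 'I_r' -> E) (y : 'I_r -> E) : subsp W ->
  (forall i, exists c : 'I_r' -> K, W (y i - \sum_j c j *: b j)) ->
  (r' < r)%N ->
  exists2 x : 'I_r -> K, exists i, x i != 0 & W (\sum_i x i *: y i).
Proof.
move=> hW /choice [c hc] lt.
pose C := \matrix_(i, j) c i j.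
have : kermx C != 0.
  rewrite kermx_eq0 /row_free; apply/eqP => h.
  by move: (rank_leq_col C); rewrite h leqNgt lt.
case/rowV0Pn => x /sub_kermxP xC x0.
exists (x ord0); first by case/rV0Pn: x0 => i hi; exists i.
suff -> : \sum_i x ord0 i *: y i =
    \sum_i x ord0 i *: (y i - \sum_j c i j *: b j).
  by apply: subsp_sum => // i _; apply: subspZ.
under [RHS]eq_bigr do rewrite scalerBr.
rewrite sumrB -[LHS]subr0; congr (_ - _).
rewrite -[LHS](_ : \sum_j (x *m C) ord0 j *: b j = 0).
  rewrite -lincomb_mulmx; apply: eq_bigr => i _; congr (_ *: _).
  by apply: eq_bigr => j _; rewrite mxE.
by rewrite xC big1 // => j _; rewrite mxE scale0r.
Qed.

Lemma indep_le_span V W r r' (b : 'I_r -> E) (b' : 'I_r' -> E) : subsp W ->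
  (forall i, V (b i)) ->
  (forall c : 'I_r -> K, W (\sum_i c i *: b i) -> forall i, c i = 0) ->
  (forall u, V u -> exists c : 'I_r' -> K, W (u - \sum_i c i *: b' i)) ->
  (r <= r')%N.
Proof.
move=> hW bV bfree span; rewrite leqNgt; apply/negP => lt.
have [x [i xi] hx] := dependent_mod hW (fun i => span _ (bV i)) lt.
by move: xi; rewrite (bfree x hx) eqxx.
Qed.

Lemma basis_mod_uniq V W r r' (b : 'I_r -> E) (b' : 'I_r' -> E) : subsp W ->
  basis_mod V W b -> basis_mod V W b' -> r = r'.
Proof.
move=> hW [h1 h2 h3] [h1' h2' h3']; apply/eqP; rewrite eqn_leq.
by rewrite (indep_le_span hW h1 h3 h2') (indep_le_span hW h1' h3' h2).
Qed.

Lemma dim_quotE V W r (b : 'I_r -> E) : subsp W ->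
  basis_mod V W b -> dim_quot V W = r.
Proof.
move=> hW hb; rewrite /dim_quot; case: xgetP => [r' _ [b' hb']|h].
  exact: (basis_mod_uniq hW hb' hb).
by case: (h r); exists b.
Qed.

Definition fin_quot V W : Prop := exists r (b : 'I_r -> E), basis_mod V W b.

Lemma fin_quotP V W : subsp W -> fin_quot V W ->
  exists b : 'I_(dim_quot V W) -> E, basis_mod V W b.
Proof.
by move=> hW [r [b hb]]; rewrite (dim_quotE hW hb); exists b.
Qed.

Lemma basis_exists V W r' (b' : 'I_r' -> E) : subsp W ->
  (forall u, V u -> exists c : 'I_r' -> K, W (u - \sum_i c i *: b' i)) ->
  fin_quot V W.
Proof.
move=> hW span.
pose P r := `[< exists2 b : 'I_r -> E, forall i, V (b i) &
  forall c : 'I_r -> K, W (\sum_i c i *: b i) -> forall i, c i = 0 >].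
have P0 : exists r, P r.
  exists 0%N; apply/asboolP; exists (fun=> 0); last by move=> c _ [].
  by case.
have Pmax r : P r -> (r <= r')%N.
  by move=> /asboolP [b bV bfree]; apply: (indep_le_span hW bV bfree span).
have [r /asboolP [b bV bfree] rmax] := ex_maxnP P0 Pmax.
exists r, b; split=> // u Vu.
apply: contrapT => hu.
have : P r.+1.
  apply/asboolP.
  exists (fun i => if unlift ord0 i is Some j then b j else u).
    by move=> i; case: unliftP.
  move=> c; rewrite big_ord_recl unlift_none.
  under eq_bigr do rewrite liftK.
  move=> hc; have c0 : c ord0 = 0.
    apply: contrapT => /eqP c0; apply: hu.
    exists (fun j => - (c ord0)^-1 * c (lift ord0 j)).
    have := subspZ (c ord0)^-1 hW hc.
    rewrite scalerDr scalerA mulVf // scale1r scaler_sumr.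
    congr (W (_ + _)); rewrite -sumrN; apply: eq_bigr => j _.
    by rewrite scalerA mulNr scaleNr opprK.
  move: hc; rewrite c0 scale0r add0r => hc i.
  by case: (unliftP ord0 i) => [j ->|->//]; apply: (bfree (fun j => c (lift ord0 j)) hc).
by move/rmax; rewrite ltnn.
Qed.

Lemma fin_quot_sub V V' W W' : subsp W -> subsp W' -> V' `<=` V -> W `<=` W' ->
  fin_quot V W -> fin_quot V' W'.
Proof.
move=> hW hW' sV sW [r [b [_ h _]]]; apply: (@basis_exists _ _ _ b) => // u /sV /h [c hc].
by exists c; apply: sW.
Qed.

(** Concatenating a basis of [V / U] with one of [U / W] gives a basis of
    [V / W]: the dimension count behind every exact sequence below. *)
Lemma dim_quot_add V U W : subsp V -> subsp U -> subsp W ->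
  U `<=` V -> W `&` V `<=` U -> fin_quot V W ->
  dim_quot V W = (dim_quot V U + dim_quot U W)%N.
Proof.
move=> hV hU hW UV WU fVW.
have hWV : subsp (W `&` V) by apply: subspI.
have fVU : fin_quot V U.
  case: fVW => r [b [h1 h2 h3]]; apply: (@basis_exists _ _ _ b) => // u Vu.
  have [c hc] := h2 u Vu; exists c; apply: WU; split=> //.
  by apply: subspB => //; apply: subsp_sum => // i _; apply: subspZ.
have fUW : fin_quot U W by apply: (fin_quot_sub hW hW UV _ fVW).
have [b [h1 h2 h3]] := fin_quotP hU fVU.
have [b' [h1' h2' h3']] := fin_quotP hW fUW.
apply: (@dim_quotE _ _ _ (fun i => match fintype.split i with inl j => b j | inr j => b' j end)) => //.
split=> [i|u Vu|c].
- by case: (fintype.split i) => j //; apply: UV.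
- have [c hc] := h2 u Vu; have [c' hc'] := h2' _ hc.
  exists (fun i => match fintype.split i with inl j => c j | inr j => c' j end).
  move: hc'; congr (W _); rewrite big_split_ord /= opprD addrA.
  by congr (_ - _ - _); apply: eq_bigr => i _;
    rewrite ?(fintype.unsplitK (inl i)) ?(fintype.unsplitK (inr i)).
- rewrite big_split_ord /=.
  under eq_bigr do rewrite (fintype.unsplitK (inl _)).
  under [X in W (_ + X)]eq_bigr do rewrite (fintype.unsplitK (inr _)).
  move=> hc.
  have c1 i : c (lshift _ i) = 0.
    apply: (h3 (fun i => c (lshift _ i))).
    rewrite -[X in U X](addrK (\sum_(i < dim_quot U W) c (rshift _ i) *: b' i)).
    have U2 : U (\sum_(i < dim_quot U W) c (rshift _ i) *: b' i).
      by apply: subsp_sum => // j _; apply: subspZ.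
    apply: subspB => //; apply: WU; split=> //; apply: subspD => //; last exact: UV.
    by apply: subsp_sum => // j _; apply: subspZ.
  have c2 : forall i, c (rshift _ i) = 0.
    apply: (h3' (fun i => c (rshift _ i))).
    move: hc; rewrite big1 ?add0r // => i _; by rewrite c1 scale0r.
  by move=> i; rewrite -(fintype.splitK i); case: (fintype.split i) => j /=; rewrite ?c1 ?c2.
Qed.

End OneSpace.

Lemma basis_mod_map (E E' : lmodType K) (V W : set E) (V' W' : set E')
    (phi : E -> E') r (b : 'I_r -> E) :
  linear phi -> subsp V -> subsp W' ->
  (forall u, V u -> V' (phi u)) ->
  (forall u, V u -> W' (phi u) <-> W u) ->
  (forall u', V' u' -> exists2 u, V u & W' (u' - phi u)) ->
  basis_mod V W b -> basis_mod V' W' (phi \o b).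
Proof.
move=> lin hV hW' h1 h2 h3 [b1 b2 b3].
have phi0 : phi 0 = 0 by have := lin (-1) 0 0; rewrite scaler0 add0r scaleN1r addNr.
have phis (c : 'I_r -> K) : phi (\sum_i c i *: b i) = \sum_i c i *: (phi \o b) i.
  by apply: (big_rec2 (fun u v => phi u = v)) => // i u v _ <-; rewrite lin.
have Vs (c : 'I_r -> K) : V (\sum_i c i *: b i).
  by apply: subsp_sum => // i _; apply: subspZ.
split=> [i|u' hu'|c].
- exact: h1.
- have [u Vu hu] := h3 u' hu'; have [c hc] := b2 u Vu; exists c.
  rewrite -phis -(subrKA (phi u)); apply: subspD => //.
  have -> : phi u - phi (\sum_i c i *: b i) = phi (u - \sum_i c i *: b i).
    by have := lin (-1) (\sum_i c i *: b i) u; rewrite !scaleN1r ![- _ + _]addrC.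
  by apply/h2 => //; apply: subspB.
- by rewrite -phis => /(h2 _ (Vs c)); apply: b3.
Qed.

(** The form in which isomorphisms of quotients are used: [phi] need only be
    injective modulo [W] and surjective modulo [W']. *)
Lemma dim_quot_map (E E' : lmodType K) (V W : set E) (V' W' : set E')
    (phi : E -> E') :
  linear phi -> subsp V -> subsp W -> subsp W' ->
  (forall u, V u -> V' (phi u)) ->
  (forall u, V u -> W' (phi u) <-> W u) ->
  (forall u', V' u' -> exists2 u, V u & W' (u' - phi u)) ->
  fin_quot V W -> dim_quot V' W' = dim_quot V W.
Proof.
move=> lin hV hW hW' h1 h2 h3 /(fin_quotP hW) [b hb].
exact: dim_quotE (basis_mod_map lin hV hW' h1 h2 h3 hb).
Qed.

End LinearAlgebra.

(** * Ideals, gradings and Hilbert functions *)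

Definition is_ideal (A : comNzRingType) (I : set A) : Prop :=
  [/\ I 0, forall p q, I p -> I q -> I (p + q) & forall a p, I p -> I (a * p)].

Section Ideal.
Context {A : comNzRingType} {I : set A} (hI : is_ideal I).
Lemma id0 : I 0. Proof. by case: hI. Qed.
Lemma idD p q : I p -> I q -> I (p + q). Proof. by case: hI => _ h _; apply: h. Qed.
Lemma idM a p : I p -> I (a * p). Proof. by case: hI => _ _; apply. Qed.
Lemma idMr a p : I p -> I (p * a). Proof. by rewrite mulrC; apply: idM. Qed.
Lemma idN p : I p -> I (- p). Proof. by rewrite -mulN1r; apply: idM. Qed.
Lemma idB p q : I p -> I q -> I (p - q). Proof. by move=> ? ?; apply: idD => //; apply: idN. Qed.
Lemma id_sum (T : Type) (r : seq T) (P : pred T) (F : T -> A) :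
  (forall i, P i -> I (F i)) -> I (\sum_(i <- r | P i) F i).
Proof. by move=> h; elim/big_ind: _ => //; [apply: id0|apply: idD]. Qed.
Lemma idBl p q : I (p - q) -> I q -> I p.
Proof. by move=> h1 h2; rewrite -(subrK q p); apply: idD. Qed.
Lemma id1 a : I 1 -> I a. Proof. by move=> h; rewrite -[a]mulr1; apply: idM. Qed.
End Ideal.

(** Defined by its universal property, so that inclusions of ideals are checked on
    generators. *)
Definition gen (A : comNzRingType) (X : set A) : set A :=
  [set p | forall I, is_ideal I -> X `<=` I -> I p].

Lemma gen_ideal (A : comNzRingType) (X : set A) : is_ideal (gen X).
Proof.
split=> [I hI _|p q hp hq I hI sI|a p hp I hI sI]; first exact: id0.
  by apply: idD => //; [apply: hp|apply: hq].
by apply: idM => //; apply: hp.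
Qed.

Lemma sub_gen (A : comNzRingType) (X : set A) : X `<=` gen X.
Proof. by move=> p hp I _; apply. Qed.

Lemma gen_sub (A : comNzRingType) (X I : set A) : is_ideal I -> X `<=` I -> gen X `<=` I.
Proof. by move=> hI sI p; apply. Qed.

Definition adj (A : comNzRingType) (I : set A) (g : A) : set A :=
  [set p | exists a, I (p - a * g)].

Section Adj.
Context {A : comNzRingType} {I : set A} (hI : is_ideal I).
Lemma adj_ideal g : is_ideal (adj I g).
Proof.
split=> [|p q [a ha] [b hb]|a p [b hb]].
- by exists 0; rewrite mul0r subr0; apply: id0.
- by exists (a + b); rewrite mulrDl opprD addrACA; apply: idD.
- by exists (a * b); rewrite -mulrA -mulrBr; apply: idM.
Qed.
Lemma sub_adj g : I `<=` adj I g.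
Proof. by move=> p hp; exists 0; rewrite mul0r subr0. Qed.
Lemma mem_adj g : adj I g g.
Proof. by exists 1; rewrite mul1r subrr; apply: id0. Qed.
Lemma adj_sub I' g : is_ideal I' -> I `<=` I' -> I' g -> adj I g `<=` I'.
Proof. by move=> h s hg p [a /s ha]; apply: (idBl h ha); apply: idM. Qed.
End Adj.

Definition colon (A : comNzRingType) (I : set A) (g : A) : set A := [set p | I (g * p)].

Lemma colon_ideal (A : comNzRingType) (I : set A) g : is_ideal I -> is_ideal (colon I g).
Proof.
move=> hI; split=> [|p q hp hq|a p hp]; rewrite /colon /=.
- by rewrite mulr0; apply: id0.
- by rewrite mulrDr; apply: idD.
- by rewrite mulrCA; apply: idM.
Qed.

Section Graded.
Context {K : fieldType} {n : nat}.
Local Notation S := {mpoly K[n]}.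
Implicit Types (p q g : S) (k e : int).

(** Degrees are integers so that shifts by negative degrees, which occur in all
    the duality statements, need no case distinction. *)
Definition hc k p : S := if k is Posz j then pihomog mdeg j p else 0.

Lemma mcoeff_hc k p m : (hc k p)@_m = if (mdeg m)%:Z == k then p@_m else 0.
Proof.
case: k => [j|j] /=; last by rewrite mcoeff0.
rewrite eqz_nat; case: eqP => [<-|/eqP ne].
  have lt : (mdeg m < maxn (msize p) (mdeg m).+1)%N by rewrite leq_max ltnSn orbT.
  have -> : p@_m = \sum_(i < maxn (msize p) (mdeg m).+1) (pihomog mdeg i p)@_m.
    by rewrite -(raddf_sum (mcoeff m)) -pihomog_partitionE // leq_maxl.
  rewrite [RHS](bigD1 (Ordinal lt)) //= [X in _ = _ + X]big1 ?addr0 // => i ne.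
  apply: (dhomog_nemf_coeff (pihomogP _ _ _)); move: ne.
  by rewrite eq_sym; apply: contraNneq => h; apply/eqP/val_inj.
by apply: (dhomog_nemf_coeff (pihomogP _ _ _)).
Qed.

Lemma hc_is_linear k : linear (hc k).
Proof.
move=> a p q; apply/mpolyP => m.
rewrite mcoeffD mcoeffZ !mcoeff_hc mcoeffD mcoeffZ.
by case: ifP; rewrite ?mulr0 ?addr0.
Qed.

HB.instance Definition _ k :=
  GRing.isLinear.Build K S S _ (hc k) (hc_is_linear k).

(** Stated as a fixed point of the projection [hc k] rather than by a
    quantification over monomials, so that linearity applies at once. *)
Definition Hd k : set S := [set p | hc k p = p].

Lemma HdP k p : Hd k p <-> forall m, p@_m != 0 -> (mdeg m)%:Z = k.
Proof.
split=> [<- m|h]; first by rewrite mcoeff_hc; case: ifP => [/eqP //|_]; rewrite eqxx.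
apply/mpolyP => m; rewrite mcoeff_hc; case: eqP => // ne.
by apply/esym/eqP; apply: contrapT => /negP /h.
Qed.

Lemma hc_id k p : Hd k p -> hc k p = p. Proof. by []. Qed.

Lemma Hd_hc k p : Hd k (hc k p).
Proof. by apply/HdP => m; rewrite mcoeff_hc; case: ifP => [/eqP //|_]; rewrite eqxx. Qed.

Lemma hc_ne k l p : Hd k p -> k != l -> hc l p = 0.
Proof.
move=> /HdP hp ne; apply/mpolyP => m; rewrite mcoeff_hc mcoeff0; case: eqP => // e.
by apply/eqP; apply: contraNT ne => /hp; rewrite e => ->.
Qed.

Lemma subsp_Hd k : subsp (Hd k).
Proof.
by split=> [|a p q hp hq]; rewrite /Hd /= ?raddf0 // linearP /= hp hq.
Qed.

Lemma Hd_homog (d : nat) p : Hd d p <-> p \is d.-homog.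
Proof.
split=> [/HdP h|/dhomogP h]; last by apply/HdP => m; rewrite -mcoeff_msupp => /h ->.
by apply/dhomogP => m; rewrite mcoeff_msupp => /h [].
Qed.

Lemma Hd_neg k p : k < 0 -> Hd k p -> p = 0.
Proof.
move=> k0 /HdP h; apply/mpolyP => m; rewrite mcoeff0; apply/eqP; apply: contraT => /h e.
by move: k0; rewrite -e.
Qed.

Lemma hc_neg k p : k < 0 -> hc k p = 0.
Proof. by case: k. Qed.

Lemma HdX m : Hd (mdeg m) 'X_[m].
Proof. by apply/Hd_homog; rewrite dhomogX. Qed.

Lemma HdXi i : Hd 1 'X_i.
Proof. by have := @HdX U_(i)%MM; rewrite mdeg1. Qed.

Lemma HdC (a : K) : Hd 0 a%:MP.
Proof. by apply/HdP => m; rewrite mcoeffC; case: (eqVneq m 0%MM) => [-> _|_]; rewrite ?mdeg0 // mulr0 eqxx. Qed.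

Lemma Hd1 : Hd 0 1. Proof. by rewrite -mpolyC1; apply: HdC. Qed.

Lemma Hd0 k : Hd k 0. Proof. by case: (subsp_Hd k). Qed.

Lemma HdM k l p q : Hd k p -> Hd l q -> Hd (k + l) (p * q).
Proof.
case: k => k; last by move=> /(@Hd_neg (Negz k) _ isT) -> // _; rewrite mul0r; apply: Hd0.
case: l => l; last by move=> _ /(@Hd_neg (Negz l) _ isT) ->; rewrite mulr0; apply: Hd0.
by move=> /Hd_homog hp /Hd_homog hq; apply/Hd_homog/dhomogM.
Qed.

Lemma HdXn k p j : Hd k p -> Hd (k * j%:Z) (p ^+ j).
Proof.
move=> hp; elim: j => [|j IH]; first by rewrite mulr0 expr0; apply: Hd1.
by rewrite exprS intS mulrDr mulr1; apply: HdM.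
Qed.

Lemma hc_partition p N : (msize p <= N)%N -> p = \sum_(j < N) hc j p.
Proof. by move=> h; rewrite {1}(pihomog_partitionE h). Qed.

Lemma hcM e g k p : Hd e g -> hc k (g * p) = g * hc (k - e) p.
Proof.
move=> hg; rewrite [in LHS](hc_partition (leqnn (msize p))) mulr_sumr raddf_sum /=.
under eq_bigr => j _.
  rewrite (_ : hc k _ = g * hc (k - e) (hc j p)); first over.
  have h := HdM hg (@Hd_hc j p).
  have [E|ne] := eqVneq (e + j%:Z) k.
    by rewrite -E (hc_id h) [e + _]addrC addrK (hc_id (@Hd_hc j p)).
  rewrite (hc_ne h ne) (hc_ne (@Hd_hc j p)) ?mulr0 //.
  by apply: contraNneq ne => ->; rewrite addrC subrK.
by rewrite -mulr_sumr -raddf_sum -(hc_partition (leqnn _)).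
Qed.

Lemma hc_hc k l p : hc k (hc l p) = if k == l then hc k p else 0.
Proof.
case: eqP => [->|/eqP ne]; first by rewrite hc_id //; apply: Hd_hc.
by rewrite (hc_ne (@Hd_hc _ _)) // eq_sym.
Qed.

Lemma id_subsp (I : set S) : is_ideal I -> subsp I.
Proof.
move=> hI; split; first exact: id0.
by move=> a u v hu hv; apply: idD => //; rewrite -mul_mpolyC; apply: idM.
Qed.

Definition hom_ideal (I : set S) : Prop :=
  is_ideal I /\ forall k p, I p -> I (hc k p).

Lemma hom_idealP I p : hom_ideal I -> (forall k, I (hc k p)) -> I p.
Proof.
move=> [hI _] h; rewrite (hc_partition (leqnn (msize p))).
by apply: id_sum => // j _; apply: h.
Qed.

(** The elements all of whose homogeneous components lie in [gen X] form an
    ideal that contains [X]. *)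
Lemma hom_gen (X : set S) : (forall p, X p -> exists k, Hd k p) -> hom_ideal (gen X).
Proof.
move=> hX; split=> [|k p hp]; first exact: gen_ideal.
suff: [set q | forall k, gen X (hc k q)] p by apply.
apply: hp.
- split=> [l|q r hq hr l|a q hq l].
  + by rewrite raddf0; apply/id0/gen_ideal.
  + by rewrite raddfD; apply: idD (gen_ideal _) _ _ _ _ => //; [apply: hq|apply: hr].
  + rewrite (hc_partition (leqnn (msize q))) mulr_sumr raddf_sum /=.
    apply: id_sum (gen_ideal _) _ _ _ _ _ => j _.
    by rewrite [a * _]mulrC (hcM _ _ (@Hd_hc j q)); apply: idMr (gen_ideal _) _ _ _.
- move=> q hq l; have [k' hk] := hX q hq.
  have [<-|ne] := eqVneq k' l; first by rewrite hc_id //; apply: sub_gen.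
  by rewrite (hc_ne hk ne); apply/id0/gen_ideal.
Qed.

Lemma hom_adj I e g : hom_ideal I -> Hd e g -> hom_ideal (adj I g).
Proof.
move=> [hI hh] hg; split=> [|k p [a ha]]; first exact: adj_ideal.
exists (hc (k - e) a); rewrite mulrC -(hcM _ _ hg) -raddfB; apply: hh.
by rewrite mulrC.
Qed.

Lemma hom_colon I e g : hom_ideal I -> Hd e g -> hom_ideal (colon I g).
Proof.
move=> [hI hh] hg; split=> [|k p hp]; first exact: colon_ideal.
rewrite /colon /= -[k](addrK e) -hcM //.
exact: hh.
Qed.

Definition hilb (I : set S) (k : int) : nat := dim_quot (Hd k) I.

Lemma fin_Hd (I : set S) k : subsp I -> fin_quot (Hd k) I.
Proof.
move=> hI; case: k => [k|k]; last first.
  apply: (@basis_exists _ _ _ _ 0 (fun=> 0)) => // u /(@Hd_neg (Negz k) _ isT) ->.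
  by exists (fun=> 0); rewrite big_ord0 subr0; case: hI.
pose T : finType := 'X_{1..n < k.+1}.
pose v (i : 'I_#|T|) : 'X_{1..n < k.+1} := enum_val i.
apply: (@basis_exists _ _ _ _ #|T| (fun i => 'X_[v i])) => // u hu.
exists (fun i => u@_(v i)).
have su : (msize u <= k.+1)%N.
  rewrite msizeE; apply/bigmax_leqP_seq => m; by rewrite mcoeff_msupp => /((HdP _ _).1 hu) [->].
rewrite [X in X - _](mpolywE su).
rewrite (reindex (@enum_val _ predT)) /=; last by apply: onW_bij; apply: enum_val_bij.
by rewrite subrr; case: hI.
Qed.

Lemma hilb_neg (I : set S) k : subsp I -> k < 0 -> hilb I k = 0%N.
Proof.
move=> hI k0; apply: (@dim_quotE _ _ _ _ 0 (fun=> 0)) => //; split=> [[]//|u /(Hd_neg k0) ->|c _ []//].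
by exists (fun=> 0); rewrite big_ord0 subr0; case: hI.
Qed.

Lemma hilb_le (I I' : set S) k : subsp I -> subsp I' ->
  (forall p, Hd k p -> I p -> I' p) -> (hilb I' k <= hilb I k)%N.
Proof.
move=> hI hI' s.
have [b [h1 h2 h3]] := fin_quotP hI (fin_Hd k hI).
have [b' [h1' h2' h3']] := fin_quotP hI' (fin_Hd k hI').
apply: (indep_le_span hI' h1' h3' (b' := b)) => u hu.
have [c hc] := h2 u hu; exists c; apply: s => //.
apply: (subspB (subsp_Hd k)) => //.
apply: subsp_sum => [|i _]; first exact: subsp_Hd.
by apply: subspZ; first exact: subsp_Hd.
Qed.

Lemma hilb_eq (I I' : set S) k : subsp I -> subsp I' ->
  (forall p, Hd k p -> I p <-> I' p) -> hilb I' k = hilb I k.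
Proof.
move=> hI hI' s; apply/eqP; rewrite eqn_leq; apply/andP.
by split; apply: hilb_le => // p hp /(s p hp).
Qed.

Lemma hilb_eq0 (I : set S) k : subsp I -> (forall p, Hd k p -> I p) -> hilb I k = 0%N.
Proof.
move=> hI h; apply: (@dim_quotE _ _ _ _ 0 (fun=> 0)) => //; split=> [[]//|u /h hu|c _ []//].
by exists (fun=> 0); rewrite big_ord0 subr0.
Qed.

Lemma hilb_gt0 (I : set S) k p : subsp I -> Hd k p -> ~ I p -> (0 < hilb I k)%N.
Proof.
move=> hI hp np; rewrite lt0n; apply/negP => /eqP h0.
have [b [_ h2 _]] := fin_quotP hI (fin_Hd k hI).
have [c] := h2 p hp; move: b c {h2}; rewrite -/(hilb I k) h0 => b c.
by rewrite big_ord0 subr0.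
Qed.

(** An inclusion of ideals with the same Hilbert function in degree [k] is an
    equality there. *)
Lemma hilb_sub_eq (I I' : set S) k : subsp I -> subsp I' -> I `<=` I' ->
  hilb I k = hilb I' k -> forall p, Hd k p -> I' p -> I p.
Proof.
move=> hI hI' s e.
have hD : subsp (Hd k `&` I') by apply: subspI => //; apply: subsp_Hd.
have hDk : Hd k `&` I' `<=` Hd k by move=> q [].
have hID : I `&` Hd k `<=` Hd k `&` I' by move=> q [/s ? ?].
have := dim_quot_add (subsp_Hd k) hD hI hDk hID (fin_Hd k hI).
have -> : dim_quot (Hd k) (Hd k `&` I') = hilb I' k.
  by apply: hilb_eq => // p hp; split=> // -[].
rewrite -/(hilb I k) e => h p hp Ip.
have {h} : dim_quot (Hd k `&` I') I = 0%N.
  by apply/eqP; rewrite -(eqn_add2l (hilb I' k)) addn0 -h.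
have fin : fin_quot (Hd k `&` I') I by apply: (fin_quot_sub hI hI hDk _ (fin_Hd k hI)).
have [b [_ h2 _]] := fin_quotP hI fin.
move=> h0; have [c] := h2 p (conj hp Ip); move: b c {h2}; rewrite h0 => b c.
by rewrite big_ord0 subr0.
Qed.

(** Exactness of [0 -> S/(I : g) (-e) -> S/I -> S/(I + g) -> 0], where the first
    map is the multiplication by [g]. All Hilbert functions are computed from it. *)
Theorem hilb_exact I e g k : hom_ideal I -> Hd e g ->
  hilb I k = (hilb (adj I g) k + hilb (colon I g) (k - e))%N.
Proof.
move=> hI hg; have iI := hI.1; have sI := id_subsp iI.
have hA := hom_adj hI hg.
have sA := id_subsp hA.1.
have sC := id_subsp (colon_ideal g iI).
have sU : subsp (Hd k `&` adj I g) by apply: subspI => //; apply: subsp_Hd.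
have h1 : Hd k `&` adj I g `<=` Hd k by move=> p [].
have h2 : I `&` Hd k `<=` Hd k `&` adj I g by move=> p [? ?]; split=> //; apply: sub_adj.
rewrite /hilb (dim_quot_add (subsp_Hd k) sU sI h1 h2 (fin_Hd k sI)).
congr (_ + _)%N.
  apply: hilb_eq => // p hp; by split=> // -[].
apply: (@dim_quot_map _ _ _ _ _ _ _ (fun p => g * p)) => //.
- by move=> a u v; rewrite mulrDr scalerAr.
- exact: subsp_Hd.
- move=> u hu; split; last by exists u; rewrite mulrC subrr; apply: id0.
  by rewrite -[k](subrKC e); apply: HdM.
- move=> u [hu [a ha]]; exists (hc (k - e) a); first exact: Hd_hc.
  rewrite -hcM // -[u](hc_id hu) -raddfB mulrC; exact: hI.2.
- exact: fin_Hd.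
Qed.

End Graded.

Arguments hc : simpl never.

(** * Ideals with a dualizing functional *)

Section Frobenius.
Context {K : fieldType} {n : nat}.
Local Notation S := {mpoly K[n]}.
Implicit Types (p q g : S) (k : int).

(** [S / I] is a graded Gorenstein algebra of socle degree [s]: [I] is the
    annihilator of a linear form concentrated in degree [s] (the inverse system
    of Macaulay). This one property carries both the duality and, when it holds
    for the ideals [I + (x ^+ N)] with all [N], the regularity of [x] modulo [I]. *)
Definition frob (I : set S) (s : int) : Prop :=
  exists phi : S -> K,
    [/\ scalar phi, forall k p, Hd k p -> k != s -> phi p = 0,
        forall p, I p <-> forall q, phi (p * q) = 0 & ~ I 1].

Section Functional.
Context {phi : S -> K} {s : int} (lin : scalar phi)
  (deg : forall k p, Hd k p -> k != s -> phi p = 0).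

Lemma funD p q : phi (p + q) = phi p + phi q.
Proof. by rewrite -[p]scale1r lin mul1r scale1r. Qed.

Lemma fun0 : phi 0 = 0.
Proof. by apply: (addrI (phi 0)); rewrite -funD !addr0. Qed.

Lemma funZ a p : phi (a *: p) = a * phi p.
Proof. by rewrite -[_ *: _]addr0 lin fun0 addr0. Qed.

Lemma fun_sum (T : Type) (r : seq T) (P : pred T) (F : T -> S) :
  phi (\sum_(i <- r | P i) F i) = \sum_(i <- r | P i) phi (F i).
Proof. exact: (big_morph phi funD fun0). Qed.

Lemma fun_hc p : phi (hc s p) = phi p.
Proof.
rewrite -[in RHS](subrK (hc s p) p) funD.
rewrite (hc_partition (leqnn (msize (p - hc s p)))) fun_sum big1 ?add0r // => j _.
have [e|ne] := eqVneq (j%:Z) s; last exact: deg (@Hd_hc _ _ _ _) ne.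
by rewrite e raddfB /= hc_hc eqxx subrr fun0.
Qed.
End Functional.

(** The pairing [phi (p * q)] between degrees [j] and [s - j] has no left
    kernel modulo [I], since [phi] sees the degree [s] only. *)
Lemma hilb_frob_le I s j : is_ideal I -> frob I s -> (hilb I j <= hilb I (s - j))%N.
Proof.
move=> hI [phi [lin deg ann _]]; have sI := id_subsp hI.
have [b [b1 b2 b3]] := fin_quotP sI (fin_Hd j sI).
have [b' [b1' b2' b3']] := fin_quotP sI (fin_Hd (s - j) sI).
rewrite leqNgt; apply/negP => lt.
pose P : 'M[K]_(hilb I j, hilb I (s - j)) := \matrix_(i, l) phi (b i * b' l).
have : kermx P != 0.
  rewrite kermx_eq0 /row_free; apply/eqP => h.
  by move: (rank_leq_col P); rewrite h leqNgt lt.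
case/rowV0Pn => x /sub_kermxP xP x0; case/rV0Pn: x0 => i /negP; apply; apply/eqP.
apply: (b3 (fun i => x ord0 i)); apply/ann => q.
set u := \sum_i _.
have hu : Hd j u.
  by apply: subsp_sum => [|l _]; [exact: subsp_Hd|apply: (subspZ _ (subsp_Hd j))].
rewrite -(fun_hc lin deg) (hcM _ _ hu).
have [c hcb] := b2' _ (@Hd_hc _ _ (s - j) q).
rewrite -[hc _ q](subrK (\sum_i c i *: b' i)) mulrDr (funD lin).
have -> : phi (u * (hc (s - j) q - \sum_i c i *: b' i)) = 0.
  by rewrite mulrC -[_ * u]mulr1; have := (ann (_ * u)).1 (idMr hI u hcb) 1.
rewrite add0r mulr_sumr (fun_sum lin) big1 // => l _.
rewrite -scalerAr (funZ lin) mulr_suml (fun_sum lin).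
have := congr1 (fun A : 'rV_(hilb I (s - j)) => A ord0 l) xP.
rewrite !mxE => h; rewrite -[X in _ * X](_ : 0 = _) ?mulr0 // -[LHS]h.
by apply: eq_bigr => i' _; rewrite mxE -scalerAl (funZ lin).
Qed.

Theorem hilb_frob I s j : is_ideal I -> frob I s -> hilb I j = hilb I (s - j).
Proof.
move=> hI hF; apply/eqP; rewrite eqn_leq hilb_frob_le //=.
by rewrite -{2}(subKr s j) hilb_frob_le.
Qed.

(** Here [S / I] is one-dimensional with parameter [x], and all its
    truncations [S / (I + (x ^+ N))] are Gorenstein. The section shows that [x] is
    regular modulo [I], and that [x] can be exchanged for any other parameter
    [h] without losing the Gorenstein property. It replaces the theory of
    regular sequences and of Cohen-Macaulay rings. *)
Section Exchange.
Context {I : set S} {x : S} {s : int}.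
Hypotheses (hI : hom_ideal I) (hx : Hd 1 x)
  (hF : forall N : nat, (0 < N)%N -> frob (adj I (x ^+ N)) (s + N%:Z - 1)).
Local Notation A N := (adj I (x ^+ N)).
Let iI := hI.1.
Let iA N : is_ideal (A N). Proof. exact: adj_ideal. Qed.

Let HdxN (N : nat) : Hd N (x ^+ N).
Proof. by have := HdXn N hx; rewrite mul1r. Qed.

Lemma adj_low (N : nat) k p : Hd k p -> k < N%:Z -> A N p -> I p.
Proof.
move=> hp lt [a ha].
have := hI.2 k _ ha; rewrite raddfB /= (hc_id hp) mulrC (hcM _ _ (HdxN N)).
by rewrite hc_neg ?mulr0 ?subr0 // subr_lt0.
Qed.

(** If [x ^+ N] were in [I], the truncations would all coincide from some
    point on, whereas their socle degrees are pairwise different. *)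
Lemma exchange_notin N : ~ I (x ^+ N).
Proof.
move=> h; have {}h : I (x ^+ N.+1) by rewrite exprS; apply: idM.
have [phi' [lin' deg' ann' _]] := hF (ltn0Sn N).
have [phi [lin deg ann n1]] := hF (ltn0Sn N.+1).
apply: n1; apply/ann => q; rewrite mul1r -(fun_hc lin deg).
set z := hc _ q; have hz : Hd (s + N.+2%:Z - 1) z by apply: Hd_hc.
suff zI : A N.+2 z by rewrite -[z]mulr1; apply: (ann _).1.
suff [a ha] : A N.+1 z by apply: sub_adj => //; apply: (idBl iI ha); apply: idM.
apply/ann' => w; rewrite -(fun_hc lin' deg') (hcM _ _ hz) hc_neg ?mulr0 ?(fun0 lin') //.
by lia.
Qed.

(** The functional [z |-> phi_(N+1) (x * z)] kills [I + (x ^+ N)] and has the same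
    degree as [phi_N], hence it is a multiple of [phi_N] because the socle of
    [S / (I + (x ^+ N))] is a line. The multiple is not zero because [x] is not
    in [I + (x ^+ N.+1)]. So both have the same annihilator. *)
Lemma exchange_colon (N : nat) p : (0 < N)%N -> A N.+1 (x * p) -> A N p.
Proof.
move=> N0 hp.
have [phi' [lin' deg' ann' n1']] := hF N0.
have [phi [lin deg ann n1]] := hF (ltn0Sn N).
pose psi z := phi (x * z).
have psi_hc z : psi z = psi (hc (s + N%:Z - 1) z).
  rewrite /psi -[LHS](fun_hc lin deg) (hcM _ _ hx).
  by congr (phi (x * hc _ z)); lia.
have psiD z w : psi (z + w) = psi z + psi w by rewrite /psi mulrDr (funD lin).
have psiZ a z : psi (a *: z) = a * psi z by rewrite /psi -scalerAr (funZ lin).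
have psiI z : A N z -> psi z = 0.
  move=> [a ha]; rewrite /psi -[x * z]mulr1; apply: ((ann _).1); exists a.
  by rewrite exprS mulrCA -mulrBr; apply: idM.
(* An element of the socle degree on which phi' does not vanish. *)
have [z0 hz0 nz0] : exists2 z0, Hd (s + N%:Z - 1) z0 & phi' z0 != 0.
  apply: contrapT => h; apply: n1'; apply/ann' => q; rewrite mul1r -(fun_hc lin' deg').
  apply/eqP; apply: contrapT => /negP nz; apply: h; exists (hc (s + N%:Z - 1) q) => //.
  exact: Hd_hc.
have psiE z : psi z = psi z0 / phi' z0 * phi' z.
  rewrite psi_hc -(fun_hc lin' deg' z); set w := hc _ z.
  have hw : Hd (s + N%:Z - 1) w by apply: Hd_hc.
  pose v := w - (phi' w / phi' z0) *: z0.
  have hv : Hd (s + N%:Z - 1) v.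
    by apply: subspB => //; [exact: subsp_Hd|apply: subspZ => //; exact: subsp_Hd].
  have v0 : phi' v = 0.
    by rewrite /v (funD lin') -scaleNr (funZ lin') mulNr mulfVK // subrr.
  have vA : A N v.
    apply/ann' => q; rewrite -(fun_hc lin' deg') (hcM _ _ hv) subrr.
    have -> : hc 0 q = (mcoeff 0%MM q)%:MP.
      apply/mpolyP => m; rewrite mcoeff_hc mcoeffC eqz_nat mdeg_eq0.
      by case: (eqVneq m 0%MM) => [->|_]; rewrite ?mulr1 ?mulr0.
    by rewrite mulrC mul_mpolyC (funZ lin') v0 mulr0.
  have := psiI v vA; rewrite /v psiD -scaleNr psiZ => /eqP.
  rewrite mulNr subr_eq0 => /eqP ->.
  by rewrite mulrAC [phi' w * _]mulrC mulrAC.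
have c0 : psi z0 / phi' z0 != 0.
  apply/eqP => c0; apply: (@exchange_notin 1); rewrite expr1.
  apply: (@adj_low N.+1 1) => //; apply/ann => q.
  by rewrite -[LHS]/(psi q) psiE c0 mul0r.
apply/ann' => q; apply: (mulfI c0); rewrite mulr0 -psiE /psi mulrA.
exact: ((ann _).1 hp).
Qed.

(** In degree [k], membership in [I] and in [I + (x ^+ k.+1)] agree, and
    [exchange_colon] divides by [x] there. *)
Lemma exchange_reg p : I (x * p) -> I p.
Proof.
move=> hp; apply: (hom_idealP hI) => k.
have {hp} : I (x * hc k p).
  by rewrite -[k](addrK 1) -hcM //; apply: hI.2.
case: k => k; last by rewrite /= => _; apply: id0.
move=> h; apply: (@adj_low k.+1 k); [exact: Hd_hc|lia|].
by apply: exchange_colon => //; apply: sub_adj.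
Qed.

Lemma exchange_regX N p : I (x ^+ N * p) -> I p.
Proof.
by elim: N => [|N IH]; rewrite ?expr0 ?mul1r // exprS -mulrA => /exchange_reg.
Qed.

(** Some power of [x] is [a * h] modulo [I]. As this product is regular, so is
    [h], and [z |-> phi (a * z)] is the dualizing functional for [I + (h)]. *)
Section Divisor.
Context {e : nat} {h : S} {k0 : nat}.
Hypotheses (e0 : (0 < e)%N) (hh : Hd e h) (hk : adj I h (x ^+ k0)).

Let cofactor : exists2 a, Hd k0 a & I (x ^+ (k0 + e) - a * h).
Proof.
(* A power of x of degree at least e, so that the cofactor a has degree k0. *)
have [a ha] : adj I h (x ^+ (k0 + e)) by rewrite addnC exprD; apply: idM => //; apply: adj_ideal.
exists (hc k0 a); first exact: Hd_hc.
have := hI.2 (k0 + e)%N _ ha.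
rewrite raddfB /= (hc_id (HdxN _)) mulrC (hcM _ _ hh) [h * _]mulrC.
by congr (I (_ - hc _ _ * _)); lia.
Qed.

Lemma exchange_reg_divisor p : I (h * p) -> I p.
Proof.
have [a _ ha] := cofactor => hp; apply: (@exchange_regX (k0 + e)).
apply: (idBl iI (q := a * h * p)); last by rewrite -mulrA; apply: idM.
by rewrite -mulrBl; apply: idMr.
Qed.

Lemma exchange_frob : frob (adj I h) (s + e%:Z - 1).
Proof.
have [a hka ha] := cofactor.
have [|phi [lin deg ann n1]] := hF (N := k0 + e); first by rewrite addn_gt0 e0 orbT.
exists (fun z => phi (a * z)); split.
- by move=> c u v; rewrite mulrDr -scalerAr lin.
- move=> k p hp ne; apply: deg (HdM hka hp) _.
  by apply: contraNneq ne => ?; apply/eqP; lia.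
- move=> p; split=> [[u hu] q|hp].
    rewrite mulrA; apply: (ann _).1; exists u.
    apply: (idBl iI (q := - (u * (x ^+ (k0 + e) - a * h)))); last by apply/idN/idM.
    by rewrite (_ : _ - _ = a * (p - u * h)); [apply: idM|ring].
  have [u hu] : A (k0 + e) (a * p) by apply/ann => q; rewrite -mulrA.
  exists u; apply: (@exchange_regX (k0 + e)).
  apply: (idBl iI (q := a * h * (p - u * h))); first by rewrite -mulrBl; apply: idMr.
  rewrite (_ : a * h * _ = h * (a * p - u * x ^+ (k0 + e) + u * (x ^+ (k0 + e) - a * h))).
    by apply: idM => //; apply: idD => //; apply: idM.
  ring.
- move=> [u hu]; apply: n1; apply: sub_adj => //.
  have := hI.2 0 _ hu; rewrite raddfB /= (hc_id (@Hd1 _ _)) mulrC (hcM _ _ hh).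
  by rewrite [hc (0 - _) _]hc_neg ?mulr0 ?subr0 //; lia.
Qed.

End Divisor.
End Exchange.
End Frobenius.

(** * Radicals, substitutions and monomial ideals *)

Section Radical.
Context {A : comNzRingType}.
Implicit Types (I X : set A).

Definition radical_of I : set A := [set p | exists k : nat, I (p ^+ k)].

Lemma rad_sub I : I `<=` radical_of I.
Proof. by move=> p hp; exists 1%N; rewrite expr1. Qed.

Lemma rad_ideal I : is_ideal I -> is_ideal (radical_of I).
Proof.
move=> hI; split=> [|p q [k hk] [l hl]|a p [k hk]].
- by exists 1%N; rewrite expr1; apply: id0.
- exists (k + l)%N; rewrite exprDn; apply: id_sum => // i _.
  rewrite -mulr_natr; apply: idMr => //.
  have [le|lt] := leqP k (k + l - i).
    by rewrite -(subnK le) exprD; apply: idMr => //; apply: idM.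
  have le : (l <= i)%N by lia.
  by rewrite -(subnK le) exprD mulrA; apply: idM.
- by exists k; rewrite exprMn; apply: idM.
Qed.

Lemma rad_le I I' : I `<=` radical_of I' -> radical_of I `<=` radical_of I'.
Proof. by move=> s p [k /s [l hl]]; exists (k * l)%N; rewrite exprM. Qed.

End Radical.

Section Subst.
Context {K : fieldType} {n r : nat}.
Local Notation S := {mpoly K[n]}.
Implicit Types (y : 'I_r -> S) (F : {mpoly K[r]}).

Definition subst y F : S := mmap (@mpolyC n K) y F.

HB.instance Definition _ y := GRing.RMorphism.copy (subst y) (mmap (@mpolyC n K) y).

Lemma substX y i : subst y 'X_i = y i.
Proof. by rewrite /subst mmapX mmap1U. Qed.

Lemma substC y c : subst y c%:MP = c%:MP.
Proof. by rewrite /subst mmapC. Qed.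

Lemma substZ y c F : subst y (c *: F) = c *: subst y F.
Proof. by rewrite -mul_mpolyC rmorphM /= substC mul_mpolyC. Qed.

Lemma subst_mon y m : subst y 'X_[m] = \prod_(i < r) y i ^+ m i.
Proof. by rewrite /subst mmapX. Qed.

Lemma substE y F : subst y F = \sum_(m <- msupp F) F@_m *: \prod_(i < r) y i ^+ m i.
Proof.
rewrite {1}[F]mpolyE raddf_sum /=; apply: eq_bigr => m _.
by rewrite substZ subst_mon.
Qed.

Lemma Hd_prod y (e : nat) (m : 'X_{1..r}) : (forall i, Hd e (y i)) ->
  Hd (e * mdeg m)%N (\prod_(i < r) y i ^+ m i).
Proof.
move=> hy; rewrite mdegE big_distrr /=.
apply: (big_rec2 (fun (k : nat) p => Hd k p)) => [|i k p _ h]; first exact: Hd1.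
by rewrite PoszD; apply: HdM => //; rewrite PoszM; apply: HdXn.
Qed.

Lemma subst_Hd y (e k : nat) F : (forall i, Hd e (y i)) -> Hd k F -> Hd (e * k)%N (subst y F).
Proof.
move=> hy /HdP hF; rewrite substE big_seq.
apply: subsp_sum => [|m]; first exact: subsp_Hd.
rewrite mcoeff_msupp => /hF [<-]; apply: subspZ; first exact: subsp_Hd.
exact: Hd_prod.
Qed.

Lemma subst_cong (I : set S) y y' F : is_ideal I -> (forall i, I (y i - y' i)) ->
  I (subst y F - subst y' F).
Proof.
move=> hI h.
have cl (p q p' q' : S) : I (p - p') -> I (q - q') -> I (p * q - p' * q').
  move=> h1 h2; rewrite (_ : _ - _ = (p - p') * q + p' * (q - q')); last by ring.
  by apply: idD => //; [apply: idMr|apply: idM].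
rewrite !substE -sumrB; apply: id_sum => // m _.
rewrite -scalerBr -mul_mpolyC; apply: idM => //.
apply: (big_ind2 (fun p q => I (p - q))) => [|*|i _].
- by rewrite subrr; apply: id0.
- exact: cl.
- elim: (m i) => [|j IH]; first by rewrite subrr; apply: id0.
  by rewrite !exprS; apply: cl.
Qed.

(** On the line spanned by [c], a form of degree [k] is its value at [c] times
    the [k]-th power of the parameter. *)
Lemma subst_line (c : 'I_r -> K) (b : S) (k : nat) F : Hd k F ->
  subst (fun i => c i *: b) F = F.@[c] *: b ^+ k.
Proof.
move=> /HdP hF; rewrite substE mevalE scaler_suml big_seq [RHS]big_seq.
apply: eq_bigr => m; rewrite mcoeff_msupp => /hF [<-].
rewrite -scalerA; congr (_ *: _).
rewrite (eq_bigr (fun i => c i ^+ m i *: b ^+ m i)) => [|i _]; last exact: exprZn.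
by rewrite scaler_prod prodrXr mdegE.
Qed.

Lemma meval_subst (v : 'I_n -> K) y F : (subst y F).@[v] = F.@[fun i => (y i).@[v]].
Proof.
rewrite substE [RHS]mevalE (raddf_sum (meval v)); apply: eq_bigr => m _.
rewrite /= mevalZ rmorph_prod; congr (_ * _); apply: eq_bigr => i _.
by rewrite rmorphXn.
Qed.

End Subst.

Lemma subst_subst {K : fieldType} {n r s : nat} (y : 'I_r -> {mpoly K[n]})
    (z : 'I_s -> {mpoly K[r]}) F : subst y (subst z F) = subst (fun i => subst y (z i)) F.
Proof.
rewrite [subst z F]substE [RHS]substE (raddf_sum (subst y)); apply: eq_bigr => m _.
rewrite /= substZ rmorph_prod; congr (_ *: _); apply: eq_bigr => i _.
by rewrite rmorphXn.
Qed.

Lemma subst_id {K : fieldType} {n : nat} (F : {mpoly K[n]}) : subst (fun i => 'X_i) F = F.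
Proof.
rewrite substE [RHS]mpolyE; apply: eq_bigr => m _.
by rewrite -mpolyXE_id.
Qed.

Section Primary.
Context {K : fieldType} {n : nat}.
Local Notation S := {mpoly K[n]}.
Implicit Types (p q g : S) (I : set S).

(** In terms of zeros: [I] has no zero but the origin. *)
Definition primary I : Prop := forall i : 'I_n, radical_of I 'X_i.

Lemma primary_le I I' : I `<=` radical_of I' -> primary I -> primary I'.
Proof. by move=> s h i; apply: (rad_le s). Qed.

Lemma primary_rad I k p : is_ideal I -> primary I -> Hd k p -> 0 < k -> radical_of I p.
Proof.
move=> hI hP /HdP hp k0; have hR := rad_ideal hI.
rewrite [p]mpolyE big_seq; apply: id_sum => // m; rewrite mcoeff_msupp => /hp hm.
rewrite -mul_mpolyC; apply: idM => //; rewrite mpolyXE_id.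
have /existsP [i hi] : [exists i, m i != 0%N].
  apply: contraLR k0; rewrite negb_exists -hm mdegE => /forallP h.
  by rewrite big1 // => i _; apply/eqP; rewrite -[_ == _]negbK.
rewrite (bigD1 i) //=; apply: idMr => //.
by rewrite -(prednK (n := m i)) ?lt0n // exprS; apply: idMr.
Qed.

(** A monomial of large degree has an exponent at least [k i] for some [i]. *)
Lemma primary_deg I : is_ideal I -> primary I ->
  exists k0 : nat, forall k p, Hd k p -> k0%:Z <= k -> I p.
Proof.
move=> hI /choice [k hk].
exists (\sum_(i < n) k i).+1 => l p /HdP hp lk.
rewrite [p]mpolyE big_seq; apply: id_sum => // m; rewrite mcoeff_msupp => /hp hm.
rewrite -mul_mpolyC; apply: idM => //; rewrite mpolyXE_id.
have /existsP [i hi] : [exists i, (k i <= m i)%N].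
  apply: contraLR lk; rewrite negb_exists -hm mdegE => /forallP h.
  rewrite lez_nat -ltnNge ltnS; apply: leq_sum => i _.
  by have := h i; rewrite -ltnNge => /ltnW.
rewrite (bigD1 i) //=; apply: idMr => //.
by rewrite -(subnK hi) exprD; apply: idM.
Qed.

Lemma gen_adj (A : comNzRingType) (X : set A) (g : A) : gen (X `|` [set g]) = adj (gen X) g.
Proof.
rewrite eqEsubset; split.
  apply: gen_sub; first exact/adj_ideal/gen_ideal.
  by move=> p [/sub_gen|->]; [apply/sub_adj|apply/mem_adj/gen_ideal].
apply: adj_sub; first exact: gen_ideal.
  by apply: gen_sub; [apply: gen_ideal|move=> p hp; apply: sub_gen; left].
by apply: sub_gen; right.
Qed.

(** For [g] regular modulo [I] the colon ideal in [hilb_exact] is [I]. *)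
Lemma hilb_reg I (e : nat) g k : hom_ideal I -> Hd e g -> (forall p, I (g * p) -> I p) ->
  hilb I k = (hilb (adj I g) k + hilb I (k - e%:Z))%N.
Proof.
move=> hI hg reg; rewrite (hilb_exact _ hI hg); congr (_ + _)%N.
apply: hilb_eq; [exact/id_subsp/hI.1|exact/id_subsp/colon_ideal/hI.1|].
by move=> p _; split=> [h|/reg//]; apply: idM => //; apply: hI.1.
Qed.

End Primary.

Section Monomial.
Context {K : fieldType} {n : nat}.
Local Notation S := {mpoly K[n]}.

Lemma mcoeff_mulX (p : S) m k : (p * 'X_[m])@_k = if (m <= k)%MM then p@_(k - m)%MM else 0.
Proof.
case: ifP => [le|nle]; first by rewrite -{1}(submK le) addmC mcoeffMX.
rewrite [p]mpolyE mulr_suml (raddf_sum (mcoeff k)) big1 // => m' _ /=.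
rewrite -scalerAl -mpolyXD mcoeffZ mcoeffX; case: eqP => [e|_]; last by rewrite mulr0.
by move: nle; rewrite -e lem_addl.
Qed.

Definition monomial_ideal (N : 'I_n -> nat) : set S := gen (range (fun i => 'X_i ^+ N i)).

(** The dualizing functional is the coefficient of the monomial with exponents
    [(N i).-1], the last one outside the ideal. *)
Lemma frob_monomial (N : 'I_n -> nat) : (forall i, 0 < N i)%N ->
  frob (monomial_ideal N) (\sum_(i < n) (N i).-1)%N.
Proof.
move=> N0; pose m0 := [multinom (N i).-1 | i < n].
have iA := @gen_ideal _ (range (fun i => 'X_i ^+ N i : S)).
have ann p : monomial_ideal N p <-> forall q, (p * q)@_m0 = 0.
  split=> [hp|h].
    suff: [set p : S | forall q, (p * q)@_m0 = 0] p by [].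
    apply: hp.
      split=> [q|p1 p2 h1 h2 q|a p1 h1 q]; rewrite ?mul0r ?mcoeff0 //.
        by rewrite mulrDl mcoeffD h1 h2 addr0.
      by rewrite [a * p1]mulrC -mulrA; apply: h1.
    move=> _ [i _ <-] q; rewrite mulrC mpolyXn mcoeff_mulX; case: ifP => //.
    move=> /mnm_lepP /(_ i); rewrite mulmnE mnm1E eqxx mul1n mnmE.
    by case: (N i) (N0 i) => // j _; rewrite ltnn.
  rewrite [p]mpolyE big_seq; apply: (id_sum iA) => m; rewrite mcoeff_msupp => hm.
  rewrite -mul_mpolyC; apply: (idM iA).
  have nle : ~~ (m <= m0)%MM.
    apply: contraNN hm => le; apply/eqP; have := h 'X_[m0 - m].
    rewrite mcoeff_mulX lem_subr; congr (_ = _); congr mcoeff.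
    by apply/mnmP => i; rewrite !mnmBE subKn //; apply/mnm_lepP.
  have /existsP [i hi] : [exists i, (m i >= N i)%N].
    apply: contraNT nle; rewrite negb_exists => /forallP h'; apply/mnm_lepP => i.
    by rewrite mnmE; have := h' i; have := N0 i; lia.
  rewrite mpolyXE_id (bigD1 i) //=; apply: (idMr iA).
  by rewrite -(subnK hi) exprD; apply: (idM iA); apply: sub_gen; exists i.
exists (mcoeff m0); split=> //.
- by move=> a p q; rewrite mcoeffD mcoeffZ.
- move=> k p /HdP hp; apply: contraNeq => /hp <-.
  by rewrite mdegE; apply/eqP; congr Posz; apply: eq_bigr => i _; rewrite mnmE.
- move/ann => /(_ 'X_[m0]); rewrite mul1r mcoeffX eqxx => /eqP.
  by rewrite oner_eq0.
Qed.

End Monomial.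

(** * Linear changes of coordinates and powers of a geometric sum *)

Lemma preim_ideal (A B : comNzRingType) (f : {rmorphism A -> B}) (I : set B) :
  is_ideal I -> is_ideal [set p | I (f p)].
Proof.
move=> hI; split=> [|p q hp hq|a p hp] /=.
- by rewrite rmorph0; apply: id0.
- by rewrite rmorphD; apply: idD.
- by rewrite rmorphM; apply: idM.
Qed.

Lemma eval_ideal (K : fieldType) n (v : 'I_n -> K) : is_ideal [set p : {mpoly K[n]} | p.@[v] = 0].
Proof.
split=> [|p q hp hq|a p hp] /=; first by rewrite meval0.
  by rewrite mevalD hp hq addr0.
by rewrite mevalM hp mulr0.
Qed.

Section LinearForms.
Context {K : fieldType} {n : nat}.
Local Notation S := {mpoly K[n]}.

Definition lform (A : 'M[K]_n) (i : 'I_n) : S := \sum_j A i j *: 'X_j.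

Lemma lform_Hd A i : Hd 1 (lform A i).
Proof.
apply: subsp_sum => [|j _]; first exact: subsp_Hd.
by apply: subspZ; [exact: subsp_Hd|exact: HdXi].
Qed.

Lemma Hd1_lform (p : S) : Hd 1 p -> p = \sum_j p@_U_(j) *: 'X_j.
Proof.
move=> /HdP hp; apply/mpolyP => m; rewrite (raddf_sum (mcoeff m)) /=.
have [/mdeg1P [i /eqP ->]|ne] := boolP (mdeg m == 1%N).
  rewrite (bigD1 i) //= mcoeffZ mcoeffX eqxx mulr1 big1 ?addr0 // => j ne.
  by rewrite mcoeffZ mcoeffX eq_mnm1 (negbTE ne) mulr0.
rewrite big1 => [|j _].
  by apply/eqP; apply: contraNT ne => /hp [->].
by rewrite mcoeffZ mcoeffX; case: eqP => [e|_]; [move: ne; rewrite -e mdeg1|rewrite mulr0].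
Qed.

Lemma subst_lform A B i : subst (lform B) (lform A i) = lform (A *m B) i.
Proof.
rewrite [lform A i]/lform (raddf_sum (subst (lform B))) /=.
under eq_bigr do rewrite substZ substX.
have := lincomb_mulmx (fun j => 'X_j : S) B (row i A).
rewrite -row_mul => h; transitivity (\sum_i0 row i (A *m B) ord0 i0 *: 'X_i0 : S).
  by rewrite -h; apply: eq_bigr => j _; rewrite mxE.
by apply: eq_bigr => j _; rewrite mxE.
Qed.

Lemma lform1 i : lform 1%:M i = 'X_i.
Proof.
rewrite /lform (bigD1 i) //= mxE eqxx scale1r big1 ?addr0 // => j ne.
by rewrite mxE eq_sym (negbTE ne) scale0r.
Qed.

Lemma subst_Hd1 r (y : 'I_r -> S) (k : int) F : (forall i, Hd 1 (y i)) -> Hd k F -> Hd k (subst y F).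
Proof.
case: k => k hy hF; last by rewrite (@Hd_neg _ _ (Negz k) _ isT hF) rmorph0; apply: Hd0.
by have := subst_Hd (e := 1) hy hF; rewrite mul1n.
Qed.

Lemma subst_inv A B p : A *m B = 1%:M -> subst (lform B) (subst (lform A) p) = p.
Proof.
move=> AB; rewrite subst_subst -[RHS]subst_id; congr (subst _ _).
by apply/funext => i; rewrite subst_lform AB lform1.
Qed.

(** A vector in the kernel of [A] is a common zero of the linear forms, hence
    of all coordinates. *)
Lemma primary_unit A : primary (gen (range (lform A))) -> A \in unitmx.
Proof.
move=> hP; rewrite -unitmx_tr -row_free_unit -kermx_eq0; apply: contraT.
case/rowV0Pn => v /sub_kermxP vA; case/rV0Pn => i /negP; case; apply/eqP.
have [k hk] := hP i.
have : ('X_i ^+ k : S).@[v ord0] = 0.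
  apply: (hk [set p | p.@[v ord0] = 0]); first exact: eval_ideal.
  move=> _ [j _ <-] /=; rewrite /lform (raddf_sum (meval (v ord0))) /=.
  transitivity ((v *m A^T) ord0 j); last by rewrite vA mxE.
  by rewrite mxE; apply: eq_bigr => l _; rewrite mevalZ mevalXU mxE mulrC.
by rewrite rmorphXn /= mevalXU => /eqP; rewrite expf_eq0 => /andP [_ /eqP].
Qed.

(** The monomial case transported by the change of coordinates that maps the
    forms [l i] to the variables. *)
Lemma frob_lform (l : 'I_n -> S) (N : 'I_n -> nat) :
  (forall i, Hd 1 (l i)) -> primary (gen (range l)) -> (forall i, 0 < N i)%N ->
  frob (gen (range (fun i => l i ^+ N i))) (\sum_(i < n) (N i).-1)%N.
Proof.
move=> hl hP N0; pose A := \matrix_(i, j) (l i)@_U_(j).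
have lE : l = lform A.
  apply/funext => i; rewrite [LHS]Hd1_lform // /lform.
  by apply: eq_bigr => j _; rewrite mxE.
rewrite {}lE in hP *; have uA := primary_unit hP.
have [phi [lin deg ann n1]] := frob_monomial (K := K) N0.
pose B := invmx A.
have AB : A *m B = 1%:M by apply: mulmxV.
have BA : B *m A = 1%:M by apply: mulVmx.
set I := gen _.
have IP p : I p <-> monomial_ideal N (subst (lform B) p).
  split=> hp.
    apply: (hp [set p | monomial_ideal N (subst (lform B) p)]).
      exact/preim_ideal/gen_ideal.
    move=> _ [i _ <-] /=; rewrite rmorphXn /= subst_lform AB lform1.
    by apply: sub_gen; exists i.
  rewrite -(subst_inv p BA).
  apply: (hp [set p | I (subst (lform A) p)]); first exact/preim_ideal/gen_ideal.
  move=> _ [i _ <-] /=; rewrite rmorphXn /= substX.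
  by apply: sub_gen; exists i.
exists (phi \o subst (lform B)); split=> /=.
- by move=> a p q; rewrite /= raddfD /= substZ lin.
- by move=> k p hp; apply: deg; apply: subst_Hd1 => // i; apply: lform_Hd.
- move=> p; split=> [/IP/ann h q|h]; first by rewrite /= rmorphM.
  apply/IP/ann => q; have := h (subst (lform A) q).
  by rewrite /= rmorphM /= subst_inv.
- by move/IP; rewrite rmorph1.
Qed.

End LinearForms.

Section Coefficients.

(** Coefficients indexed by the integers, to match the degrees of [hilb]. *)
Definition icoef (p : {poly int}) (k : int) : int := if k is Posz m then p`_m else 0.

Definition geom (e : nat) : {poly int} := \sum_(a < e) 'X^a.

Lemma icoefB p q k : icoef (p - q) k = icoef p k - icoef q k.
Proof. by case: k => k; rewrite /= ?subrr // coefB. Qed.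

Lemma icoef_neg p k : k < 0 -> icoef p k = 0. Proof. by case: k. Qed.

Lemma icoefXn p a k : icoef ('X^a * p) k = icoef p (k - a%:Z).
Proof.
case: k => k; last by rewrite [RHS]icoef_neg //; lia.
rewrite /= coefXnM; case: ltnP => h; first by rewrite [RHS]icoef_neg //; lia.
by rewrite subzn.
Qed.

Lemma geomE e : ('X - 1) * geom e = 'X^e - 1.
Proof. by rewrite /geom -subrX1. Qed.

Lemma icoef_geom e p k :
  icoef (geom e * p) k - icoef (geom e * p) (k - 1) = icoef p k - icoef p (k - e%:Z).
Proof.
rewrite -(icoefXn _ 1) -icoefB -(icoefXn p e) -icoefB; congr (icoef _ _).
rewrite expr1 (_ : _ - _ = - ((('X - 1) * geom e) * p)); last by ring.
by rewrite geomE; ring.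
Qed.

Lemma icoef_sum (I : Type) (r : seq I) (F : I -> {poly int}) k :
  icoef (\sum_(i <- r) F i) k = \sum_(i <- r) icoef (F i) k.
Proof. by case: k => k /=; [rewrite coef_sum|rewrite big1]. Qed.

(** Reversing the order of summation in each factor. *)
Lemma icoef_geomX_sym e i k : (0 < e)%N ->
  icoef (geom e ^+ i) k = icoef (geom e ^+ i) ((i * e.-1)%N%:Z - k).
Proof.
move=> e0; elim: i k => [|i IH] k.
  rewrite expr0 mul0n sub0r; case: k => [[|k]|k] //=; by rewrite ?coef1.
rewrite exprS /geom mulr_suml !icoef_sum (reindex_inj rev_ord_inj) /=.
apply: eq_bigr => a _; rewrite !icoefXn IH; congr (icoef _ _).
by have := ltn_ord a; lia.
Qed.

(** Replaces the division by [1 - t] of Hilbert series. *)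
Lemma first_difference_inj (u v : int -> int) :
  (forall k, k < 0 -> u k = 0) -> (forall k, k < 0 -> v k = 0) ->
  (forall k, u k - u (k - 1) = v k - v (k - 1)) -> u =1 v.
Proof.
move=> u0 v0 h k; case: k => k; last by rewrite u0 // v0.
have hS (j : nat) : u j%:Z = v j%:Z.
  elim: j => [|j IH].
    by have := h 0; rewrite (u0 (0 - 1)) // (v0 (0 - 1)) // !subr0.
  have := h j.+1; rewrite (_ : j.+1%:Z - 1 = j%:Z); last by lia.
  by rewrite IH => /addIr.
exact: hS.
Qed.

(** [t^d - t = (t - 1) t (1 + t + ... + t^(d-2))]. *)
Lemma gammaE n d k : (0 < d)%N -> gamma n d k = icoef (geom d.-1 ^+ n) (k - n%:Z).
Proof.
move=> d0.
have dE : 'X^d - 'X = ('X - 1) * ('X * geom d.-1) :> {poly int}.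
  rewrite mulrCA geomE mulrBr mulr1 -exprS prednK //.
have e : (('X - 1) * ('X * geom d.-1)) ^+ n %/ ('X - 1) ^+ n = 'X^n * geom d.-1 ^+ n :> {poly int}.
  rewrite exprMn [X in _ * X]exprMn Pdiv.IdomainMonic.mulKp //.
  by apply: monic_exp; rewrite -polyC1 monicXsubC.
by case: k => k; rewrite /gamma ?dE ?e -icoefXn.
Qed.

End Coefficients.

(** * Complete intersections by exchange of parameters *)

Section Mixed.
Context {K : fieldType} {n : nat}.
Local Notation S := {mpoly K[n]}.
Context (h l : nat -> S) (e : nat).
Implicit Types N : nat -> nat.

(** The first [i] of the [n] generators are forms [h j], the others are powers
    of linear forms [l j]. Going from [i] to [i.+1] exchanges one generator, and
    [mixed' N i] is what the two ideals have in common. *)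
Definition mixed N i : set S :=
  gen [set (if (j < i)%N then h j else l j ^+ N j) | j in [set j | (j < n)%N]].

Definition mixed' N i : set S :=
  gen [set (if (j < i)%N then h j else l j ^+ N j) | j in [set j | (j < n)%N && (j != i)]].

Lemma mixedE N i : (i < n)%N -> mixed N i = adj (mixed' N i) (l i ^+ N i).
Proof.
move=> lt; rewrite -gen_adj; congr gen; rewrite eqEsubset; split.
  move=> _ [j /= jn <-]; have [->|ne] := eqVneq j i; first by right; rewrite ltnn.
  by left; exists j => //=; rewrite jn.
move=> _ [[j /= /andP [jn _] <-]|->]; first by exists j.
by exists i => //; rewrite ltnn.
Qed.

Lemma mixedSE N i : (i < n)%N -> mixed N i.+1 = adj (mixed' N i) (h i).
Proof.
move=> lt; rewrite -gen_adj; congr gen; rewrite eqEsubset; split.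
  move=> _ [j /= jn <-]; have [->|ne] := eqVneq j i; first by right; rewrite ltnSn.
  by left; exists j => /=; rewrite ?jn // ltnS [(j <= i)%N]leq_eqVlt (negbTE ne).
move=> _ [[j /= /andP [jn ne] <-]|->]; last by exists i => //; rewrite ltnSn.
by exists j => //; rewrite ltnS leq_eqVlt (negbTE ne).
Qed.

Definition upd N i (M : nat) : nat -> nat := fun j => if j == i then M else N j.

Lemma mixed'_upd N i M : mixed' (upd N i M) i = mixed' N i.
Proof.
congr gen; rewrite eqEsubset; split=> _ [j /= jn <-]; exists j => //=.
  by rewrite /upd; case/andP: jn => _ /negbTE ->.
by rewrite /upd; case/andP: jn => _ /negbTE ->.
Qed.

Hypotheses (hh : forall j, (j < n)%N -> Hd e (h j)) (hl : forall j, (j < n)%N -> Hd 1 (l j))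
  (e0 : (0 < e)%N) (hP : forall i, (i < n)%N -> primary (mixed (fun=> 1%N) i)).

Lemma hom_mixed' N i : hom_ideal (mixed' N i).
Proof.
apply: hom_gen => _ [j /= /andP [jn _] <-]; case: ifP => _; first by exists e; apply: hh.
by exists (N j); have := HdXn (N j) (hl jn); rewrite mul1r.
Qed.

Lemma hom_mixed N i : hom_ideal (mixed N i).
Proof.
apply: hom_gen => _ [j /= jn <-]; case: ifP => _; first by exists e; apply: hh.
by exists (N j); have := HdXn (N j) (hl jn); rewrite mul1r.
Qed.

Lemma primary_mixed N i : (i < n)%N -> primary (mixed N i).
Proof.
move=> /hP; apply: primary_le; apply: gen_sub; first exact/rad_ideal/gen_ideal.
move=> _ [j /= jn <-]; case: ifP => ji.
  by apply: rad_sub; apply: sub_gen; exists j; rewrite /= ?ji.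
by exists (N j); apply: sub_gen; exists j; rewrite /= ?ji // expr1.
Qed.

Lemma mixed_nilpotent N i : (i.+1 < n)%N -> exists k0, adj (mixed' N i) (h i) (l i ^+ k0).
Proof.
move=> lt; have := primary_rad (gen_ideal _) (primary_mixed N lt) (hl (ltnW lt)) isT.
by rewrite -/(mixed N i.+1) mixedSE // ltnW.
Qed.

Let degree N i : int := (i * e.-1 + \sum_(i <= j < n) (N j).-1)%N.
Let degree' N i : int := (i * e.-1 + \sum_(i.+1 <= j < n) (N j).-1)%N.

Lemma mixed'_frob N i : (i < n)%N -> (forall j, 0 < N j)%N ->
  (forall N', (forall j, 0 < N' j)%N -> frob (mixed N' i) (degree N' i)) ->
  forall M, (0 < M)%N -> frob (adj (mixed' N i) (l i ^+ M)) (degree' N i + M%:Z - 1).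
Proof.
move=> lt N0 hF M M0; have N0' j : (0 < upd N i M j)%N by rewrite /upd; case: ifP.
have := hF _ N0'; rewrite mixedE // mixed'_upd {1}/upd eqxx /degree big_ltn //.
rewrite {1}/upd eqxx (eq_big_nat _ _ (F2 := fun j => (N j).-1)) => [|j /andP [ij _]].
  by congr frob; rewrite /degree'; lia.
by rewrite /upd gtn_eqF.
Qed.

(** Induction on [i] from the monomial case: the exponent of [l i] is arbitrary
    in the induction hypothesis, which is what [exchange_frob] asks for. *)
Theorem mixed_frob i : (i < n)%N -> forall N, (forall j, 0 < N j)%N ->
  frob (mixed N i) (degree N i).
Proof.
elim: i => [|i IH] lt N N0.
  rewrite /degree mul0n add0n big_mkord.
  have mE N' : mixed N' 0 = gen (range (fun i : 'I_n => l i ^+ N' i)).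
    congr gen; rewrite eqEsubset; split; last by move=> _ [i _ <-]; exists i => //=.
    by move=> _ [j /= jn <-]; exists (Ordinal jn).
  have hl' (i : 'I_n) : Hd 1 (l i) by apply: hl.
  have hP' : primary (gen (range (fun i : 'I_n => l i))).
    rewrite -(_ : (fun i : 'I_n => l i ^+ 1) = fun i : 'I_n => l i); last first.
      by apply/funext => i; rewrite expr1.
    by rewrite -(mE (fun=> 1%N)); apply: hP.
  rewrite mE; exact: (frob_lform hl' hP' (fun i => N0 i)).
have lt' := ltnW lt; rewrite mixedSE //.
have [k0 hk] := mixed_nilpotent N lt.
have hF := mixed'_frob lt' N0 (IH lt').
have := exchange_frob (hom_mixed' N i) (hl lt') hF e0 (hh lt') hk.
by congr frob; rewrite /degree /degree' mulSn; lia.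
Qed.

Let one : nat -> nat := fun=> 1%N.

Lemma mixed'_reg i p : (i < n)%N -> mixed' one i (l i * p) -> mixed' one i p.
Proof.
move=> lt; apply: exchange_reg (hom_mixed' one i) (hl lt) _ _.
by apply: mixed'_frob => // N N0; apply: mixed_frob.
Qed.

Lemma mixed'_reg_next i p : (i.+1 < n)%N -> mixed' one i (h i * p) -> mixed' one i p.
Proof.
move=> lt; have lt' := ltnW lt; have [k0 hk] := mixed_nilpotent one lt.
apply: (exchange_reg_divisor (hom_mixed' one i) (hl lt') _ e0 (hh lt') hk).
by apply: mixed'_frob => // N N0; apply: mixed_frob.
Qed.

Lemma hilb_1 (I : set S) : is_ideal I -> ~ I 1 -> hilb I 0 = 1%N.
Proof.
move=> hI n1; apply: (@dim_quotE _ _ _ _ _ (fun=> 1)); first exact: id_subsp.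
split=> [_|u hu|c]; first exact: Hd1.
  exists (fun=> u@_0%MM); rewrite big_ord1.
  rewrite (_ : u - _ = 0); first exact: id0.
  apply/eqP; rewrite subr_eq0; apply/eqP/mpolyP => m.
  rewrite mcoeffZ mcoeff1; have [->|ne] := eqVneq m 0%MM; first by rewrite mulr1.
  rewrite mulr0; apply/eqP; apply: contraNT ne => /((HdP _ _).1 hu) [].
  by rewrite -mdeg_eq0 => ->.
rewrite big_ord1 => h1 i; rewrite ord1; apply/eqP; apply: contraT => c0.
case: n1; rewrite -[1]scale1r -(mulVf c0) -scalerA -mul_mpolyC.
exact: idM.
Qed.

(** Both generators [l i] and [h i] are regular modulo [mixed' N i], so that
    the exchange multiplies the Hilbert series by [(1 - t^e) / (1 - t)]. *)
Theorem mixed_hilb i k : (i < n)%N -> (hilb (mixed one i) k)%:Z = icoef (geom e ^+ i) k.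
Proof.
elim: i k => [|i IH] k lt.
  have hF := mixed_frob lt (N := one) (fun=> isT).
  have hI := (hom_mixed one 0).1.
  rewrite /degree /one mul0n big1 // in hF.
  case: k => [[|k]|k]; rewrite expr0 /=.
  - by rewrite coef1 hilb_1 //; case: hF => phi [].
  - rewrite coef1 (hilb_frob _ hI hF) hilb_neg //; exact: id_subsp.
  - by rewrite hilb_neg //; exact: id_subsp.
have lt' := ltnW lt.
have R1 k' : hilb (mixed' one i) k' = (hilb (mixed one i) k' + hilb (mixed' one i) (k' - 1))%N.
  rewrite mixedE // expr1.
  by apply: (hilb_reg (e := 1) _ (hom_mixed' one i) (hl lt')) => p; apply: mixed'_reg.
have R2 k' : hilb (mixed' one i) k' = (hilb (mixed one i.+1) k' + hilb (mixed' one i) (k' - e%:Z))%N.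
  rewrite mixedSE //.
  by apply: (hilb_reg _ (hom_mixed' one i) (hh lt')) => p; apply: mixed'_reg_next.
move: k; apply: first_difference_inj => [k k0|k k0|k].
- by rewrite hilb_neg //; apply/id_subsp/gen_ideal.
- exact: icoef_neg.
- rewrite exprS icoef_geom -!IH //.
  have := R1 k; have := R1 (k - e%:Z); have := R2 k; have := R2 (k - 1).
  rewrite (_ : k - e%:Z - 1 = k - 1 - e%:Z); last by ring.
  lia.
Qed.

End Mixed.

(** The ideal [I] of the first [m] forms in [m.+1] variables, all of degree [e]:
    a one-dimensional complete intersection with parameter [l m]. *)
Section Curve.
Context {K : fieldType} {m : nat}.
Local Notation S := {mpoly K[m.+1]}.
Context (h l : nat -> S) (e : nat).
Hypotheses (hh : forall j, (j < m.+1)%N -> Hd e (h j)) (hl : forall j, (j < m.+1)%N -> Hd 1 (l j))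
  (e0 : (0 < e)%N) (hP : forall i, (i < m.+1)%N -> primary (mixed h l (fun=> 1%N) i)).

Local Notation I := (gen [set h j | j in [set j | (j < m)%N]]).

Let mixed'I : mixed' h l (fun=> 1%N) m = I.
Proof.
congr gen; rewrite eqEsubset; split.
  move=> _ [j /= /andP [jm ne] <-]; have lt : (j < m)%N by lia.
  by exists j => //; rewrite lt.
by move=> _ [j /= jm <-]; exists j => /=; [lia|rewrite jm].
Qed.

Lemma hom_curve : hom_ideal I.
Proof. by rewrite -mixed'I; exact: (hom_mixed' hh hl). Qed.

Theorem curve_frob N : (0 < N)%N -> frob (adj I (l m ^+ N)) ((m * e.-1)%N%:Z + N%:Z - 1).
Proof.
move=> N0; rewrite -mixed'I.
have := mixed'_frob (N := fun=> 1%N) e0 (ltnSn m) (fun=> isT)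
  (fun N' h' => mixed_frob hh hl e0 hP (ltnSn m) h') N0.
by congr frob; rewrite big_geq ?addn0.
Qed.

(** The Hilbert series of [I] is [(1 - t^e)^m / (1 - t)^(m+1)]. *)
Theorem curve_hilb k :
  (hilb I k)%:Z - (hilb I (k - e%:Z))%:Z = icoef (geom e ^+ m.+1) k.
Proof.
have R1 k' : hilb I k' = (hilb (mixed h l (fun=> 1%N) m) k' + hilb I (k' - 1))%N.
  rewrite mixedE // mixed'I expr1.
  apply: (hilb_reg (e := 1) _ hom_curve (hl (ltnSn m))) => p.
  by rewrite -mixed'I; apply: (mixed'_reg hh hl e0 hP).
move: k; apply: first_difference_inj => [k k0|k k0|k].
- have sI := id_subsp hom_curve.1; rewrite !hilb_neg ?subrr //; lia.
- exact: icoef_neg.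
- rewrite exprS icoef_geom -!(mixed_hilb hh hl e0 hP) //.
  have := R1 k; have := R1 (k - e%:Z).
  rewrite (_ : k - e%:Z - 1 = k - 1 - e%:Z); last by ring.
  lia.
Qed.

End Curve.

(** * Growth of Hilbert functions and algebraic dependence *)

Section Growth.
Context {K : fieldType} {n : nat}.
Local Notation S := {mpoly K[n]}.
Implicit Types (I : set S) (p q g : S).

Definition adjs I (s : seq S) : set S := foldl (@adj S) I s.

Lemma adjs_ideal I s : is_ideal I -> is_ideal (adjs I s).
Proof. by elim: s I => //= g s IH I hI; apply/IH/adj_ideal. Qed.

Lemma sub_adjs I s : is_ideal I -> I `<=` adjs I s.
Proof.
elim: s I => [|g s IH] I hI p hp //=; apply: IH; first exact: adj_ideal.
exact: sub_adj.
Qed.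

Lemma mem_adjs I s g : is_ideal I -> g \in s -> adjs I s g.
Proof.
elim: s I => //= g' s IH I hI; rewrite inE => /predU1P [->|gs].
  by apply: sub_adjs; [exact: adj_ideal|exact: mem_adj].
by apply: IH gs; exact: adj_ideal.
Qed.

(** The dimension of [S / I] is at most [a]. Sums up to degree [D] are used
    because then the bound starts at [a = 0]. *)
Definition growth_le I (a : nat) : Prop :=
  exists C : nat, forall D : nat, (\sum_(0 <= k < D.+1) hilb I k <= C * D.+1 ^ a)%N.

Lemma sum_nat_le (F : nat -> nat) a b : (a <= b)%N ->
  (\sum_(0 <= k < a) F k <= \sum_(0 <= k < b) F k)%N.
Proof. by move=> ab; rewrite [leqRHS](big_cat_nat (n := a)) //= leq_addr. Qed.

(** Adding one form [g] to [I] replaces the Hilbert function by a bound for its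
    first difference, since [(I : g)] contains [I]; so the order of growth drops
    by at most one with each form. *)
Lemma growth_primary I s : hom_ideal I ->
  (forall g, g \in s -> exists2 e : nat, (0 < e)%N & Hd e g) ->
  primary (adjs I s) -> growth_le I (size s).
Proof.
elim: s I => [|g s IH] I hI hs hP.
  have [k0 hk] := primary_deg hI.1 hP.
  exists (\sum_(0 <= k < k0) hilb I k)%N => D; rewrite expn0 muln1.
  have [le|lt] := leqP D.+1 k0; first exact: sum_nat_le.
  rewrite (big_cat_nat (n := k0)) //=; last exact: ltnW.
  rewrite -[leqRHS]addn0 leq_add2l leqn0 big_nat big1 // => k.
  move=> /andP [kk _]; apply: hilb_eq0; first exact/id_subsp/hI.1.
  by move=> p hp; apply: hk hp _; rewrite lez_nat.
have [e e0 hg] := hs g (mem_head _ _).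
have hA := hom_adj hI hg.
have [C hC] : growth_le (adj I g) (size s).
  by apply: IH => // g' hg'; apply: hs; rewrite inE hg' orbT.
have le1 (k : nat) : (hilb I k <= \sum_(0 <= j < k.+1) hilb (adj I g) j)%N.
  elim/ltn_ind: k => k IHk; rewrite big_nat_recr //= (hilb_exact _ hI hg) addnC leq_add2r.
  have [lt|ge] := ltnP k e.
    by rewrite hilb_neg //; [exact/id_subsp/colon_ideal/hI.1|lia].
  apply: (@leq_trans (hilb I (k - e)%N)).
    rewrite -subzn //; apply: hilb_le; [exact/id_subsp/hI.1|exact/id_subsp/colon_ideal/hI.1|].
    by move=> p _ hp; apply: idM => //; exact: hI.1.
  by apply: (leq_trans (IHk _ _)); [lia|apply: sum_nat_le; lia].
exists C => D; rewrite /= expnS mulnCA.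
apply: (@leq_trans (\sum_(0 <= k < D.+1) C * D.+1 ^ size s)%N).
  rewrite big_nat [leqRHS]big_nat; apply: leq_sum => k kD.
  apply: (leq_trans (le1 k)); apply: leq_trans (hC D); apply: sum_nat_le; lia.
by rewrite big_const_nat iter_addn addn0 subn0 mulnC.
Qed.

(** There are [u.+1 ^ r] monomials in [y] with exponents at most [u], more than
    [S / I] has room for in the degrees that they occupy; so in some degree they
    are linearly dependent. *)
Lemma algebraic_relation I (a r : nat) (y : 'I_r -> S) (e : nat) : is_ideal I ->
  growth_le I a -> (a < r)%N -> (0 < e)%N -> (forall i, Hd e (y i)) ->
  exists (k : nat) (F : {mpoly K[r]}), [/\ Hd k F, F != 0 & I (subst y F)].
Proof.
move=> hI [C hC] ar e0 hy.
(* Large enough for u.+1 to beat the constant in the growth bound of degree e * r * u. *)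
pose u := (C * (e * r).+1 ^ a)%N.
pose A : finType := {ffun 'I_r -> 'I_u.+1}.
pose dg (al : A) : nat := (\sum_i al i)%N.
pose mon (al : A) : 'X_{1..r} := [multinom (al i : nat) | i < r].
have dgE al : mdeg (mon al) = dg al.
  by rewrite mdegE; apply: eq_bigr => i _; rewrite mnmE.
have dgle al : (dg al <= r * u)%N.
  have : (dg al <= \sum_(i < r) u)%N by apply: leq_sum => i _; rewrite -ltnS.
  by rewrite sum_nat_const card_ord.
have [k lt] : exists k : nat, (hilb I (e * k)%N < #|[pred al | dg al == k]|)%N.
  apply: contrapT => h.
  have h' (k : nat) : (#|[pred al | dg al == k]| <= hilb I (e * k)%N)%N.
    by rewrite leqNgt; apply/negP => lt; apply: h; exists k.
  have : (#|A| <= \sum_(0 <= k < (r * u).+1) hilb I (e * k)%N)%N.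
    apply: (@leq_trans (\sum_(0 <= k < (r * u).+1) #|[pred al | dg al == k]|)).
      rewrite -sum1_card big_mkord.
      rewrite (partition_big (fun al => Ordinal (dgle al : dg al < (r * u).+1)%N) xpredT) //=.
      by apply: leq_sum => k _; rewrite -sum1_card; apply: eq_leq; apply: eq_bigl => al; rewrite inE -val_eqE.
    by apply: leq_sum => k _.
  rewrite card_ffun !card_ord leqNgt => /negP; apply.
  have le2 (b : nat) : (\sum_(0 <= k < b.+1) hilb I (e * k)%N <= \sum_(0 <= k < (e * b).+1) hilb I k)%N.
    elim: b => [|b IH]; first by rewrite muln0 !big_nat1 muln0.
    rewrite big_nat_recr //= [leqRHS]big_nat_recr //= leq_add2r.
    by apply: (leq_trans IH); apply: sum_nat_le; rewrite mulnS; lia.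
  apply: (leq_ltn_trans (le2 _)); apply: (leq_ltn_trans (hC _)).
  apply: (@leq_ltn_trans (C * ((e * r).+1 * u.+1) ^ a)).
    rewrite leq_mul2l; apply/orP; right.
    have [->|a0] := posnP a; first by rewrite !expn0.
    by rewrite leq_exp2r //; nia.
  rewrite expnMn mulnA -/u.
  apply: (@leq_trans (u.+1 ^ a.+1)); last by rewrite leq_pexp2l.
  by rewrite expnS ltn_pmul2r // expn_gt0.
pose B := [pred al : A | dg al == k].
pose v (i : 'I_#|B|) : A := enum_val i.
have hv i : dg (v i) = k by have := enum_valP i; rewrite inE => /eqP.
have sI := id_subsp hI.
have [b [b1 b2 b3]] := fin_quotP sI (fin_Hd (e * k)%N sI).
have hyv i : Hd (e * k)%N (\prod_j y j ^+ mon (v i) j).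
  by have := Hd_prod (mon (v i)) hy; rewrite dgE hv.
have [x [i0 xi0] hx] := dependent_mod sI (fun i => b2 _ (hyv i)) lt.
exists k, (\sum_i x i *: 'X_[mon (v i)]); split.
- apply: subsp_sum => [|i _]; first exact: subsp_Hd.
  by apply: subspZ; [exact: subsp_Hd|rewrite -(hv i) -dgE; exact: HdX].
- apply/eqP => F0; move: xi0; have /eqP := congr1 (mcoeff (mon (v i0))) F0.
  rewrite (raddf_sum (mcoeff _)) mcoeff0 (bigD1 i0) //= mcoeffZ mcoeffX eqxx mulr1.
  rewrite big1 ?addr0 => [/eqP -> /eqP //|i ne].
  rewrite mcoeffZ mcoeffX; case: eqP => [E|_]; last by rewrite mulr0.
  case/eqP: ne; apply: enum_val_inj; apply/ffunP => j; apply/val_inj.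
  by have := congr1 (fun m : 'X_{1..r} => m j) E; rewrite !mnmE.
- rewrite (raddf_sum (subst y)) /=.
  by under eq_bigr do rewrite substZ subst_mon.
Qed.

End Growth.

(** * Points outside a hypersurface and Noether's normalization step *)

Section Nonroot.
Context {K : numFieldType}.

Lemma poly_nonroot (q : {poly K}) : q != 0 -> exists t, q.[t] != 0.
Proof.
move=> q0; apply: contrapT => h.
have allr : all (root q) [seq i%:R | i <- iota 0 (size q)].
  apply/allP => t _; apply/eqP/eqP; apply: contrapT => /negP ht; apply: h.
  by exists t.
have := max_poly_roots q0 allr; rewrite map_inj_uniq ?iota_uniq => [|i j].
  by rewrite size_map size_iota ltnn => /(_ isT).
by move/eqP; rewrite eqr_nat => /eqP.
Qed.

Context {r : nat}.
Implicit Types F : {mpoly K[r]}.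

(** The coefficient of one monomial in the other variables is a nonzero
    univariate polynomial in the variable [i]. *)
Lemma partial_eval_neq0 F (i : 'I_r) : F != 0 ->
  exists t : K, subst (fun j => if j == i then t%:MP else 'X_j) F != 0.
Proof.
move=> F0; pose y t (j : 'I_r) : {mpoly K[r]} := if j == i then t%:MP else 'X_j.
pose off (m : 'X_{1..r}) := [multinom (if j == i then 0%N else m j) | j < r].
have yE t (m : 'X_{1..r}) : \prod_j y t j ^+ m j = t ^+ m i *: 'X_[off m].
  rewrite (bigD1 i) //= {1}/y eqxx -(rmorphXn (@mpolyC r K)) /= mul_mpolyC; congr (_ *: _).
  rewrite mpolyXE_id [RHS](bigD1 i) //= mnmE eqxx expr0 mul1r.
  by apply: eq_bigr => j /negbTE ne; rewrite mnmE /y ne.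
have [m0 hm0] : exists m0, m0 \in msupp F.
  move: F0; rewrite -msupp_eq0; case: (msupp F) => // m s _.
  by exists m; rewrite mem_head.
pose q : {poly K} := \sum_(m <- msupp F | off m == off m0) F@_m *: 'X^(m i).
have off_inj m : off m == off m0 -> m i = m0 i -> m = m0.
  move=> /eqP e ei; apply/mnmP => j; have [->//|ne] := eqVneq j i.
  by have := congr1 (fun m : 'X_{1..r} => m j) e; rewrite !mnmE (negbTE ne).
have q0 : q != 0.
  apply/eqP => /(congr1 (fun p : {poly K} => p`_(m0 i))); rewrite coef0 coef_sum.
  rewrite big_mkcond (bigD1_seq m0) ?msupp_uniq //= eqxx.
  rewrite coefZ coefXn eqxx mulr1 big1 ?addr0 => [/eqP|m ne].
    by apply/negP; rewrite -mcoeff_msupp.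
  case: ifP => // e; rewrite coefZ coefXn; case: eqP => [ei|_]; last by rewrite mulr0.
  by move: ne; rewrite (off_inj m e (esym ei)) eqxx.
have [t ht] := poly_nonroot q0; exists t.
have E : (subst (y t) F)@_(off m0) = q.[t].
  rewrite substE (raddf_sum (mcoeff _)) /= /q horner_sum [RHS]big_mkcond.
  apply: eq_bigr => m _; rewrite yE mcoeffZ mcoeffZ mcoeffX.
  by case: ifP => _; [rewrite hornerZ hornerXn mulr1|rewrite !mulr0].
by apply: contraNneq ht => e; rewrite -E -[subst (y t) F]/(subst _ F) e mcoeff0.
Qed.

Lemma mpoly_nonroot F : F != 0 -> exists c : 'I_r -> K, F.@[c] != 0.
Proof.
move=> F0.
have [v hv] : exists v : 'I_r -> K,
    subst (fun j => if j \in enum 'I_r then (v j)%:MP else 'X_j) F != 0.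
  elim: (enum 'I_r) => [|i s [v hv]].
    exists (fun=> 0); under [X in subst X _]funext do rewrite in_nil.
    by rewrite subst_id.
  have [is_|nis] := boolP (i \in s).
    exists v; rewrite (_ : (fun j => _) = fun j => if j \in s then (v j)%:MP else 'X_j) //.
    by apply/funext => j; rewrite inE; case: eqVneq => [->|//]; rewrite is_.
  have [t ht] := partial_eval_neq0 i hv.
  exists (fun j => if j == i then t else v j).
  rewrite subst_subst in ht.
  rewrite (_ : (fun j => _) = fun j =>
    subst (fun j => if j == i then t%:MP else 'X_j) (if j \in s then (v j)%:MP else 'X_j)) //.
  apply/funext => j; rewrite inE; have [->|ne] := eqVneq j i.
    by rewrite (negbTE nis) substX eqxx.
  by case: ifP => _; rewrite ?substC //= substX (negbTE ne).
exists v; apply: contraNneq hv => e.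
have -> : (fun j => if j \in enum 'I_r then (v j)%:MP else 'X_j) = (fun j => (v j)%:MP_[r]).
  by apply/funext => j; rewrite mem_enum.
suff -> : subst (fun j => (v j)%:MP_[r]) F = F.@[v]%:MP by rewrite e mpolyC0.
rewrite substE mevalE (raddf_sum (@mpolyC r K)); apply: eq_bigr => m _ /=.
rewrite mpolyCM mul_mpolyC rmorph_prod; congr (_ *: _); apply: eq_bigr => j _.
by rewrite rmorphXn.
Qed.

End Nonroot.

Section Noether.
Context {K : numFieldType} {n : nat}.
Local Notation S := {mpoly K[n]}.
Implicit Types (I : set S).

Lemma gen_subl I X : I `<=` gen (I `|` X).
Proof. by move=> p hp; apply: sub_gen; left. Qed.

Lemma gen_subr (A : comNzRingType) (I X : set A) : X `<=` gen (I `|` X).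
Proof. by move=> p hp; apply: sub_gen; right. Qed.

(** Choose [c] with [F(c) <> 0]. Modulo the [r] combinations of the [y i] that vanish
    at [c], all the [y i] lie on the line through [c], where the relation says
    that a power of the parameter is in [I]. *)
Lemma noether_step I (r : nat) (y : 'I_r.+1 -> S) (k : nat) (F : {mpoly K[r.+1]}) :
  primary (gen (I `|` range y)) -> Hd k F -> F != 0 -> gen I (subst y F) ->
  exists c : 'I_r -> K,
    primary (gen (I `|` range (fun i => y (lift ord0 i) - c i *: y ord0))).
Proof.
move=> hP hF F0 hy.
(* The factor 'X_ord0 makes the coordinate by which one divides nonzero. *)
have [c hc] : exists c : 'I_r.+1 -> K, (F * 'X_ord0).@[c] != 0.
  apply: mpoly_nonroot; rewrite mulf_neq0 //; apply/eqP => /(congr1 (mcoeff U_(ord0))).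
  by rewrite mcoeffX eqxx mcoeff0 => /eqP; rewrite oner_eq0.
move: hc; rewrite mevalM mevalXU mulf_eq0 negb_or => /andP [Fc c0].
pose a i := c (lift ord0 i) / c ord0; exists a.
pose X := range (fun i => y (lift ord0 i) - a i *: y ord0); rewrite -/X.
pose I' := gen (I `|` X); have hI' : is_ideal I' by apply: gen_ideal.
pose b := (c ord0)^-1 *: y ord0.
have yb i : I' (y i - c i *: b).
  have [j ->|->] := unliftP ord0 i; last by rewrite scalerA mulfV // scale1r subrr; apply: id0.
  by rewrite scalerA; apply: gen_subr; exists j.
have rb : radical_of I' b.
  exists k; have := subst_cong F hI' yb; rewrite (subst_line _ _ hF) => h.
  have : I' (F.@[c] *: b ^+ k).
    rewrite -[F.@[c] *: b ^+ k]opprK; apply: (idN hI').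
    apply: (idBl hI' (q := - subst y F)).
      by rewrite opprK addrC.
    apply: (idN hI'); apply: hy => // p hp; exact: gen_subl.
  move=> /(idM hI' (F.@[c]^-1)%:MP); rewrite mul_mpolyC scalerA mulVf // scale1r.
  by [].
apply: primary_le hP; have hR := rad_ideal hI'; apply: gen_sub => // p [hp|[i _ <-]].
  by apply: rad_sub; apply: gen_subl.
apply: (idBl hR (q := c i *: b)); first by apply: rad_sub.
by rewrite -mul_mpolyC; apply: idM.
Qed.

End Noether.

(** * Choosing parameters *)

Section ExchangeLinear.
Context {K : numFieldType} {n : nat}.
Local Notation S := {mpoly K[n]}.
Implicit Types (I : set S).

Lemma primary_variables I : primary (gen (I `|` range (fun i : 'I_n => 'X_i))).
Proof. by move=> i; apply: rad_sub; apply: gen_subr; exists i. Qed.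

Lemma noether_step_lin I (r : nat) (y : 'I_r.+1 -> S) (k e : nat) (F : {mpoly K[r.+1]}) :
  (forall i, Hd e (y i)) ->
  primary (gen (I `|` range y)) -> Hd k F -> F != 0 -> gen I (subst y F) ->
  exists y' : 'I_r -> S, [/\ forall i, Hd e (y' i),
    primary (gen (I `|` range y')) & gen (range y) = adj (gen (range y')) (y ord0)].
Proof.
move=> hy hP hF F0 hr; have [c hc] := noether_step hP hF F0 hr.
exists (fun i => y (lift ord0 i) - c i *: y ord0); split=> //.
  move=> i; apply: subspB => //; first exact: subsp_Hd.
  by apply: subspZ => //; exact: subsp_Hd.
have hG := gen_ideal (range y).
set G := gen (range (fun i => _ - _)); have hG' : is_ideal G by apply: gen_ideal.
have hA := adj_ideal hG' (y ord0).
rewrite eqEsubset; split.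
  apply: gen_sub => // _ [i _ <-]; have [j ->|->] := unliftP ord0 i; last exact: mem_adj.
  exists (c j)%:MP; rewrite mul_mpolyC; apply: sub_gen; by exists j.
apply: adj_sub => //; last by apply: sub_gen; exists ord0.
apply: gen_sub => // _ [i _ <-]; apply: (idB hG); first by apply: sub_gen; exists (lift ord0 i).
by rewrite -mul_mpolyC; apply: (idM hG); apply: sub_gen; exists ord0.
Qed.

(** Starting from all the variables, remove one linear form at a time as long
    as two remain. *)
Lemma linear_parameter I (r : nat) (y : 'I_r -> S) : is_ideal I ->
  (forall r' (z : 'I_r'.+2 -> S), (forall i, Hd 1 (z i)) -> primary (gen (I `|` range z)) ->
    exists (k : nat) (F : {mpoly K[r'.+2]}), [/\ Hd k F, F != 0 & I (subst z F)]) ->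
  (forall i, Hd 1 (y i)) -> primary (gen (I `|` range y)) ->
  exists2 l, Hd 1 l & primary (adj I l).
Proof.
move=> hI hrel; elim: r y => [|[|r] IH] y hy hP.
- exists 0; first exact: Hd0.
  apply: primary_le hP; apply: gen_sub; first exact/rad_ideal/adj_ideal.
  by move=> p [hp|[[]]] //; apply: rad_sub; apply: sub_adj.
- exists (y ord0) => //.
  apply: primary_le hP; apply: gen_sub; first exact/rad_ideal/adj_ideal.
  move=> p [hp|[i _ <-]]; first by apply: rad_sub; apply: sub_adj.
  by rewrite (ord1 i); apply: rad_sub; apply: mem_adj.
- have [k [F [hF F0 hr]]] := hrel r y hy hP.
  have [y' [hy' hP' _]] := noether_step_lin hy hP hF F0 (sub_gen hr).
  exact: IH hy' hP'.
Qed.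

(** If one form [g] cuts [S / I] down to finite length, then so does a linear
    form: the existence of [g] bounds the growth of [S / I], hence any two linear
    forms satisfy a relation. *)
Lemma exchange_linear I g (e : nat) : hom_ideal I -> Hd e g -> (0 < e)%N ->
  primary (adj I g) -> exists2 l, Hd 1 l & primary (adj I l).
Proof.
move=> hI hg e0 hP.
have hG : growth_le I 1.
  by apply: (@growth_primary _ _ _ [:: g]) => // g'; rewrite inE => /eqP ->; exists e.
apply: (linear_parameter (y := fun i : 'I_n => 'X_i)) => //; first exact: hI.1.
- by move=> r z hz _; apply: (@algebraic_relation K n I 1 r.+2 z 1 hI.1 hG).
- exact: HdXi.
- exact: primary_variables.
Qed.

End ExchangeLinear.

Section Chain.
Context {K : numFieldType} {m : nat}.
Local Notation n := m.+1.
Local Notation S := {mpoly K[n]}.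

(** The forms [h i] are replaced by linear forms one by one, from the last to the
    first. *)
Lemma mixed_chain (h : nat -> S) (e : nat) (l0 : S) : (0 < e)%N ->
  (forall j, (j < n)%N -> Hd e (h j)) -> Hd 1 l0 ->
  primary (adj (gen [set h j | j in [set j | (j < m)%N]]) l0) ->
  exists l : nat -> S, [/\ l m = l0, forall j, (j < n)%N -> Hd 1 (l j) &
    forall i, (i < n)%N -> primary (mixed h l (fun=> 1%N) i)].
Proof.
move=> e0 hh hl0 hP.
suff main t : (t <= m)%N -> exists l : nat -> S, [/\ l m = l0,
    forall j, (j < n)%N -> Hd 1 (l j) &
    forall i, (m - t <= i < n)%N -> primary (mixed h l (fun=> 1%N) i)].
  have [l [h1 h2 h3]] := main m (leqnn m); exists l; split=> // i lt.
  by apply: h3; rewrite subnn.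
elim: t => [|t IH] le.
  exists (fun=> l0); split=> // i; rewrite subn0 => /andP [mi im].
  have -> : i = m by apply/eqP; rewrite eqn_leq mi andbT.
  apply: primary_le hP; apply: adj_sub; first exact/rad_ideal/gen_ideal.
    apply: gen_sub; first exact/rad_ideal/gen_ideal.
    move=> _ [j /= jm <-]; apply: rad_sub; apply: sub_gen; exists j => /=.
      exact: ltnW.
    by rewrite jm.
  by apply: rad_sub; apply: sub_gen; exists m => //=; rewrite ltnn.
have [l [h1 h2 h3]] := IH (ltnW le).
pose i := (m - t.+1)%N; have iE : (m - t)%N = i.+1 by rewrite /i; lia.
have i1n : (i.+1 < n)%N by rewrite /i; lia.
have in' := ltnW i1n.
have hP1 : primary (mixed h l (fun=> 1%N) i.+1) by apply: h3; rewrite iE leqnn.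
rewrite mixedSE // in hP1.
have [l1 hl1 hP2] := exchange_linear (hom_mixed' hh h2 _ i) (hh i in') e0 hP1.
pose l' j := if j == i then l1 else l j; exists l'; split.
- by rewrite /l' gtn_eqF //; rewrite /i; lia.
- by move=> j jn; rewrite /l'; case: ifP => // _; apply: h2.
move=> j /andP []; rewrite -/i leq_eqVlt => /predU1P [<-|ij] jn.
  rewrite mixedE // /l' eqxx expr1.
  move: hP2; congr primary; congr adj; congr gen; rewrite eqEsubset; split=> _ [a /= ha <-];
    exists a => //=; by case/andP: ha => _ /negbTE ->.
have := h3 j; rewrite iE ij jn => /(_ isT); congr primary; congr gen.
rewrite eqEsubset; split=> _ [a /= ha <-]; exists a => //=; case: ifP => // aj;
  rewrite /l' (_ : (a == i) = false) //; apply/negP => /eqP ai; by move: aj; rewrite ai ij.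
Qed.

(** The quotient by [l0] is a polynomial ring in [m] variables, so the [m.+1]
    forms [f j] satisfy a relation there, and one normalization step makes [m]
    combinations of them sufficient. *)
Lemma general_forms (f : 'I_n -> S) (e : nat) (l0 : S) : (0 < e)%N ->
  (forall j, Hd e (f j)) -> Hd 1 l0 -> l0 != 0 ->
  primary (adj (gen (range f)) l0) ->
  exists h : nat -> S, [/\ forall j, (j < n)%N -> Hd e (h j),
    gen (range f) = adj (gen [set h j | j in [set j | (j < m)%N]]) (h m) &
    primary (adj (gen [set h j | j in [set j | (j < m)%N]]) l0)].
Proof.
move=> e0 hf hl l0n hP; pose I : set S := gen [set l0].
have hI : hom_ideal I by apply: hom_gen => _ ->; exists 1.
have [i0 hi0] : exists i, l0@_U_(i) != 0.
  apply: contrapT => h; move: l0n; rewrite (Hd1_lform hl) big1 ?eqxx // => j _.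
  have [->|nz] := eqVneq l0@_U_(j) 0; first by rewrite scale0r.
  by case: h; exists j.
pose s : seq S := [seq 'X_(lift i0 j) | j <- enum 'I_m].
have hg : growth_le I (size s).
  apply: growth_primary => // [g /mapP [j _ ->]|i]; first by exists 1%N => //; exact: HdXi.
  have hA := adjs_ideal s hI.1; apply: rad_sub.
  have hX j : adjs I s 'X_(lift i0 j).
    by apply: (mem_adjs hI.1); apply/mapP; exists j; rewrite ?mem_enum.
  have [j ->|->] := unliftP i0 i; first exact: hX.
  have : adjs I s l0 by apply: sub_adjs; [exact: hI.1|apply: sub_gen].
  rewrite (Hd1_lform hl) (bigD1 i0) //= => h.
  rewrite -['X_i0]scale1r -(mulVf hi0) -scalerA -mul_mpolyC; apply: (idM hA).
  move: h; apply: contraPP => h1 h2; apply: h1.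
  rewrite -[X in adjs I s X](addrK (\sum_(i | i != i0) l0@_U_(i) *: 'X_i)).
  apply: (idB hA) => //; apply: (id_sum hA) => a; case: (unliftP i0 a) => [b -> _|->]; last by rewrite eqxx.
  by rewrite -mul_mpolyC; apply: (idM hA).
rewrite size_map size_enum_ord in hg.
have [k [F [hF F0 hr]]] := algebraic_relation hI.1 hg (ltnSn m) e0 hf.
have hP' : primary (gen (I `|` range f)).
  apply: primary_le hP; have hR := rad_ideal (gen_ideal (I `|` range f)).
  apply: adj_sub => //.
    by apply: gen_sub => // p hp; apply: rad_sub; apply: gen_subr.
  by apply: rad_sub; apply: gen_subl; apply: sub_gen.
have [y' [hy' hP2 eqJ]] := noether_step_lin hf hP' hF F0 (sub_gen hr).
pose h j := if insub j is Some i then y' i else f ord0.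
have hE : [set h j | j in [set j | (j < m)%N]] = range y'.
  rewrite eqEsubset; split=> [_ [j /= jm <-]|_ [i _ <-]].
    by rewrite /h insubT; exists (Ordinal jm).
  by exists i => //=; rewrite /h valK.
exists h; split.
- by move=> j _; rewrite /h; case: insub.
- by rewrite hE eqJ /h insubF ?ltnn.
- rewrite hE; apply: primary_le hP2; have hA := adj_ideal (gen_ideal (range y')) l0.
  apply: gen_sub; first exact: rad_ideal.
  move=> p [hp|hp]; apply: rad_sub; first by apply: hp => // _ ->; apply: mem_adj; apply: gen_ideal.
  by apply: sub_adj; exact: sub_gen.
Qed.

End Chain.

(** * The homogeneous Nullstellensatz *)

Section BinaryForm.
Context {K : closedFieldType} {A : comAlgType K}.
Implicit Types (x l : A) (q : {poly K}).

(** The binary form of degree [k] whose dehomogenization is [q]. *)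
Definition binary (k : nat) q x l : A := \sum_(j < k.+1) q`_j *: (x ^+ j * l ^+ (k - j)).

Lemma binary_mulXsub k q t x l : (size q <= k.+1)%N ->
  binary k.+1 (('X - t%:P) * q) x l = (x - t *: l) * binary k q x l.
Proof.
move=> sq; rewrite [RHS]mulrBl /binary.
under eq_bigr do rewrite mulrBl coefB coefXM coefCM scalerBl.
rewrite sumrB; congr (_ - _).
  rewrite big_ord_recl /= scale0r add0r mulr_sumr; apply: eq_bigr => j _.
  by rewrite subSS exprS -mulrA scalerAr.
rewrite big_ord_recr /= (_ : q`_k.+1 = 0) ?mulr0 ?scale0r ?addr0; last exact: nth_default.
rewrite mulr_sumr; apply: eq_bigr => j _.
have jk : (j <= k)%N by rewrite -ltnS.
rewrite (subSn jk) exprS -[RHS]scalerAl -[in RHS]scalerAr scalerA.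
by rewrite (mulrCA l).
Qed.

Lemma binary_prod (s : seq K) k x l : (size s <= k)%N ->
  binary k (\prod_(t <- s) ('X - t%:P)) x l = \prod_(t <- s) (x - t *: l) * l ^+ (k - size s).
Proof.
elim: s k => [|t s IH] [|k] //= sk; rewrite ?big_nil ?big_cons.
- by rewrite /binary big_ord1 coef1 scale1r !expr0 mulr1.
- rewrite /binary big_ord_recl coef1 scale1r expr0 subn0 big1 ?addr0 // => j _.
  by rewrite coef1 scale0r.
- by rewrite binary_mulXsub ?IH ?mulrA // size_prod_XsubC.
Qed.

Lemma binary_split k q x l : q != 0 -> (size q <= k.+1)%N ->
  exists (s : seq K) (a : nat) (c : K),
    c != 0 /\ binary k q x l = c *: (\prod_(t <- s) (x - t *: l) * l ^+ a).
Proof.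
move=> q0 sq; have [s qE] := closed_field_poly_normal q.
exists s, (k - size s)%N, (lead_coef q); split; first by rewrite lead_coef_eq0.
have ss : (size s <= k)%N.
  by move: sq; rewrite qE size_scale ?lead_coef_eq0 // size_prod_XsubC.
rewrite -binary_prod // {1}qE /binary scaler_sumr; apply: eq_bigr => j _.
by rewrite coefZ scalerA.
Qed.

End BinaryForm.

Section Nullstellensatz.
Context {K : numClosedFieldType} {n : nat}.
Local Notation S := {mpoly K[n]}.
Implicit Types (I J : set S) (x l L : S).

(** Otherwise each [L ^+ k] is a multiple of [x - t *: L] modulo [I], and the
    product of these congruences over [s] puts a power of [L] into [I]. *)
Lemma null_step I x L (s : seq K) (a : nat) : is_ideal I -> ~ radical_of I L ->
  I (\prod_(t <- s) (x - t *: L) * L ^+ a) -> exists t, ~ radical_of (adj I (x - t *: L)) L.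
Proof.
move=> hI nL hs; apply: contrapT => h.
have {}h t : radical_of (adj I (x - t *: L)) L.
  by apply: contrapT => h'; apply: h; exists t.
suff main (r : seq K) g : I (\prod_(t <- r) (x - t *: L) * g) -> exists k : nat, I (L ^+ k * g).
  by have [k] := main s _ hs; rewrite -exprD => hk; apply: nL; exists (k + a)%N.
elim: r g => [|t r IH] g; first by rewrite big_nil => hg; exists 0%N.
rewrite big_cons [_ * \prod_(_ <- _) _]mulrC -mulrA [_ * g]mulrC => /IH [k hk].
have [k' [b hb]] := h t; exists (k' + k)%N; rewrite exprD.
rewrite (_ : _ * g = (L ^+ k' - b * (x - t *: L)) * (L ^+ k * g)
  + b * (L ^+ k * (g * (x - t *: L)))); last by ring.
by apply: idD => //; [apply: idMr|apply: idM].
Qed.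

(** Applied with [L] a linear form it produces projective points, and with
    [L = 1] affine ones. *)
Lemma null_point I L : is_ideal I -> ~ radical_of I L ->
  (forall i : 'I_n, exists (s : seq K) (a : nat), I (\prod_(t <- s) ('X_i - t *: L) * L ^+ a)) ->
  exists (I' : set S) (v : 'rV[K]_n), [/\ is_ideal I', I `<=` I', ~ radical_of I' L &
    forall i, I' ('X_i - v ord0 i *: L)].
Proof.
move=> hI nL hs.
suff [I' [h1 h2 h3 h4]] : exists I' : set S, [/\ is_ideal I', I `<=` I', ~ radical_of I' L &
    forall i, i \in enum 'I_n -> exists t, I' ('X_i - t *: L)].
  have /choice [v hv] : forall i, exists t, I' ('X_i - t *: L) by move=> i; apply: h4; rewrite mem_enum.
  by exists I', (\row_i v i); split=> // i; rewrite mxE.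
elim: (enum 'I_n) => [|i r [I' [h1 h2 h3 h4]]]; first by exists I; split.
have [s [a hsa]] := hs i.
have [t ht] := null_step h1 h3 (h2 _ hsa).
exists (adj I' ('X_i - t *: L)); split=> //; first exact: adj_ideal.
  by move=> p /h2 hp; apply: sub_adj.
move=> j; rewrite inE => /predU1P [->|/h4 [t' ht']]; first by exists t; apply: mem_adj.
by exists t'; apply: sub_adj.
Qed.

(** [x] and [l] satisfy a homogeneous relation modulo [J], and a binary form
    splits into linear factors. *)
Lemma split_relation J x l : is_ideal J -> growth_le J 1 -> Hd 1 x -> Hd 1 l ->
  exists (s : seq K) (a : nat), J (\prod_(t <- s) (x - t *: l) * l ^+ a).
Proof.
move=> hJ hg hx hl; pose y (i : 'I_2) := if i == ord0 then x else l.
have hy i : Hd 1 (y i) by rewrite /y; case: ifP.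
have [k [F [/HdP hF F0 hr]]] := @algebraic_relation K n J 1 2 y 1 hJ hg isT isT hy.
pose mj (j : nat) := [multinom (if i == ord0 then j else k - j)%N | i < 2].
have mE (m : 'X_{1..2}) : mdeg m = k -> m = mj (m ord0) /\ (m ord0 < k.+1)%N.
  rewrite mdegE big_ord_recl big_ord1 => e; split; last by rewrite -e ltnS leq_addr.
  apply/mnmP => i; rewrite mnmE; case: eqP => [->//|].
  have [i' ->|->//] := unliftP ord0 i => _; rewrite (ord1 i') -e addKn.
  by [].
pose q : {poly K} := \poly_(j < k.+1) F@_(mj j).
have FE : F = \sum_(j < k.+1) F@_(mj j) *: 'X_[mj j].
  apply/mpolyP => m; rewrite (raddf_sum (mcoeff m)) /=.
  have [/eqP ek|ne] := boolP (mdeg m == k).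
    have [em lt] := mE m ek.
    rewrite (bigD1 (Ordinal lt)) //= -em mcoeffZ mcoeffX eqxx mulr1 big1 ?addr0 // => j nj.
    rewrite mcoeffZ mcoeffX; case: eqP => [e|_]; last by rewrite mulr0.
    by case/eqP: nj; apply/val_inj; rewrite /= -e mnmE.
  have F0m : F@_m = 0 by apply/eqP; apply: contraNT ne => /hF [->].
  rewrite F0m big1 // => j _; rewrite mcoeffZ mcoeffX; case: eqP => [e|_]; last by rewrite mulr0.
  by rewrite e F0m mul0r.
have q0 : q != 0.
  apply: contraNneq F0 => q0; rewrite FE big1 // => j _.
  have := congr1 (fun p : {poly K} => p`_j) q0; rewrite coef_poly ltn_ord coef0 => ->.
  by rewrite scale0r.
have [s [a [c [c0 hb]]]] := binary_split (A := S) x l q0 (size_poly _ _).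
exists s, a; have : J (binary k q x l).
  rewrite (_ : binary k q x l = subst y F) // [in RHS]FE (raddf_sum (subst y)) /=.
  apply: eq_bigr => j _; rewrite coef_poly ltn_ord substZ subst_mon; congr (_ *: _).
  by rewrite big_ord_recl big_ord1 !mnmE /y.
rewrite hb => /(idM hJ (c^-1)%:MP).
by rewrite mul_mpolyC scalerA mulVf // scale1r.
Qed.

Theorem hom_nullstellensatz J I l : hom_ideal J -> growth_le J 1 -> Hd 1 l ->
  primary (adj J l) -> hom_ideal I -> J `<=` I ->
  (forall v, zeros I v -> v = 0) -> primary I.
Proof.
move=> hJ hg hl hP hI JI hV.
have [hr|nr] := pselect (radical_of I l).
  apply: primary_le hP; apply: adj_sub => //; first exact/rad_ideal/hI.1.
  by move=> p /JI; apply: rad_sub.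
have hs (i : 'I_n) : exists (s : seq K) (a : nat), I (\prod_(t <- s) ('X_i - t *: l) * l ^+ a).
  by have [s [a h]] := split_relation hJ.1 hg (HdXi i) hl; exists s, a; apply: JI.
have [I' [v [h1 h2 h3 h4]]] := null_point hI.1 nr hs.
have key (k : nat) p : Hd k p -> I' p -> p.@[v ord0] = 0.
  move=> hp Ip; apply/eqP; apply: contraPT h3 => nz /=; apply; exists k.
  have := subst_cong p h1 h4; rewrite subst_id (subst_line _ _ hp) => h.
  have : I' (p.@[v ord0] *: l ^+ k).
    by rewrite -[X in I' X](subKr p); apply: idB.
  by move=> /(idM h1 (p.@[v ord0]^-1)%:MP); rewrite mul_mpolyC scalerA mulVf // scale1r.
have v0 : v = 0.
  apply: hV => p hp; rewrite (hc_partition (leqnn (msize p))) (raddf_sum (meval (v ord0))).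
  rewrite big1 // => j _ /=; apply: (key j); first exact: Hd_hc.
  by apply: h2; apply: hI.2.
case: h3; exists 1%N; have := subst_cong l h1 h4; rewrite subst_id expr1.
rewrite (subst_line _ _ (k := 1) hl) v0 (_ : l.@[_] = 0) ?scale0r ?subr0 //.
rewrite (Hd1_lform hl) (raddf_sum (meval _)) big1 // => j _ /=.
by rewrite mevalZ mevalXU mxE mulr0.
Qed.

End Nullstellensatz.

(** * Projections of affine cones *)

(** [zeros J] is a cone, and the linear forms [y] have no common zero on it but
    the origin: they define a finite projection to the affine space of
    dimension [r]. *)
Section Projection.
Context {K : numClosedFieldType} {n r : nat}.
Local Notation S := {mpoly K[n]}.
Context {J : set S} {y : 'I_r -> S}.
Hypotheses (hJ : hom_ideal J) (hy : forall i, Hd 1 (y i)) (hP : primary (gen (J `|` range y))).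
Implicit Types (I : set S).

Lemma gen_family (I : set S) (b : 'I_r -> S) p : is_ideal I -> gen (I `|` range b) p ->
  exists a : 'I_r -> S, I (p - \sum_i a i * b i).
Proof.
move=> hI hp; apply: (hp [set p | exists a : 'I_r -> S, I (p - \sum_i a i * b i)]); last first.
  move=> q [hq|[i _ <-]].
    by exists (fun=> 0); rewrite big1 ?subr0 // => i _; rewrite mul0r.
  exists (fun j => (j == i)%:R); rewrite (bigD1 i) //= eqxx mul1r big1 ?addr0 ?subrr; first exact: id0.
  by move=> j /negbTE ->; rewrite mul0r.
split=> [|q1 q2 [a1 h1] [a2 h2]|c q [a h]].
- by exists (fun=> 0); rewrite big1 ?subr0; [exact: id0|move=> i _; rewrite mul0r].
- exists (fun i => a1 i + a2 i); under eq_bigr do rewrite mulrDl.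
  by rewrite big_split opprD addrACA; apply: idD.
- exists (fun i => c * a i); under eq_bigr do rewrite -mulrA.
  by rewrite -mulr_sumr -mulrBr; apply: idM.
Qed.

(** Modulo [J], the ring is a finite module over the polynomials in [y]. *)
Lemma module_span : exists N : nat, forall p, exists G : 'X_{1..n < N.+1} -> {mpoly K[r]},
  J (p - \sum_m subst y (G m) * 'X_[m]).
Proof.
have [N hN] := primary_deg (gen_ideal _) hP; exists N.
pose W : set S := [set p | exists G : 'X_{1..n < N.+1} -> {mpoly K[r]},
  J (p - \sum_m subst y (G m) * 'X_[m])].
have iJ := hJ.1.
have W0 : W 0.
  exists (fun=> 0); rewrite big1 ?subr0; first exact: id0.
  by move=> m _; rewrite rmorph0 mul0r.
have WD p q : W p -> W q -> W (p + q).
  move=> [G h1] [H h2]; exists (fun m => G m + H m).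
  rewrite (eq_bigr (fun m => subst y (G m) * 'X_[m] + subst y (H m) * 'X_[m])) => [|m _].
    rewrite big_split /=; move: (\sum_m _) (\sum_m _) h1 h2 => a b h1 h2.
    by rewrite opprD addrACA; apply: (idD iJ).
  by rewrite rmorphD mulrDl.
have WZ (F : {mpoly K[r]}) p : W p -> W (subst y F * p).
  move=> [G h]; exists (fun m => F * G m).
  under eq_bigr do rewrite rmorphM -mulrA.
  by rewrite -mulr_sumr -mulrBr; apply: idM.
have WJ p : J p -> W p.
  move=> hp; exists (fun=> 0); rewrite big1 ?subr0 // => m _.
  by rewrite rmorph0 mul0r.
have WX (m : 'X_{1..n < N.+1}) : W 'X_[m].
  exists (fun m' => (m' == m)%:R); rewrite (bigD1 m) //= eqxx rmorph1 mul1r big1 ?addr0 ?subrr.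
    exact: id0.
  by move=> m' /negbTE ->; rewrite rmorph0 mul0r.
have Wsum (T : Type) (s : seq T) (F : T -> S) : (forall i, W (F i)) -> W (\sum_(i <- s) F i).
  by move=> h; elim/big_ind: _.
have WH (k : nat) p : Hd k p -> W p.
  elim/ltn_ind: k p => k IH p hp; have [lt|ge] := ltnP k N.+1.
    rewrite (mpolywE (k := N.+1) (p := p)); last first.
      rewrite msizeE; apply/bigmax_leqP_seq => m; rewrite mcoeff_msupp => /((HdP _ _).1 hp) [->].
      by rewrite ltnS -ltnS.
    by apply: Wsum => m; rewrite -mul_mpolyC -(substC y); apply: WZ; apply: WX.
  have [a ha] := gen_family iJ (hN _ _ hp (ltnW ge)).
  have := hJ.2 k _ ha; rewrite raddfB /= (hc_id hp) => h.
  rewrite -[p](subrK (hc k (\sum_i a i * y i))); apply: WD; first exact: WJ.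
  rewrite (raddf_sum (hc k)); apply: Wsum => i.
  rewrite /= mulrC (hcM _ _ (hy i)) -(substX y); apply: WZ.
  have -> : k%:Z - 1 = k.-1 by lia.
  by apply: (IH k.-1); [lia|exact: Hd_hc].
move=> p; rewrite (hc_partition (leqnn (msize p))); apply: Wsum => j.
by apply: (WH j); exact: Hd_hc.
Qed.

Lemma finite_zero I (c : 'I_r -> K) : is_ideal I -> J `<=` I ->
  (forall i, I (y i - (c i)%:MP)) -> ~ I 1 -> exists v, zeros I v.
Proof.
move=> hI JI hc n1; have [N span] := module_span; pose T : finType := 'X_{1..n < N.+1}.
have sI := id_subsp hI.
pose X (j : 'I_#|T|) : S := 'X_[(enum_val j : 'X_{1..n < N.+1})].
have spanK p : exists a : 'I_#|T| -> K, I (p - \sum_j a j *: X j).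
  have [G hG] := span p; exists (fun j => (G (enum_val j)).@[c]).
  rewrite -(subrKA (\sum_m subst y (G m) * 'X_[m])); apply: idD => //; first exact: JI.
  rewrite [X in _ - X](_ : _ = \sum_(m : T) (G m).@[c] *: 'X_[m]); last first.
    by rewrite [RHS](reindex (@enum_val _ predT)) //; apply: onW_bij; apply: enum_val_bij.
  rewrite -sumrB; apply: id_sum => // m _; rewrite -mul_mpolyC -mulrBl; apply: idMr => //.
  have := subst_cong (G m) hI hc; congr (I (_ - _)).
  rewrite substE mevalE (raddf_sum (@mpolyC n K)); apply: eq_bigr => m' _ /=.
  rewrite mpolyCM mul_mpolyC rmorph_prod; congr (_ *: _); apply: eq_bigr => j _.
  by rewrite rmorphXn.
have hs (i : 'I_n) : exists (s : seq K) (a : nat), I (\prod_(t <- s) ('X_i - t *: 1) * 1 ^+ a).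
  have [x [j0 xj0] hx] := dependent_mod sI (fun j : 'I_#|T|.+1 => spanK ('X_i ^+ j)) (ltnSn _).
  pose q : {poly K} := \poly_(j < #|T|.+1) (if insub j is Some j' then x j' else 0).
  have q0 : q != 0.
    apply: contraNneq xj0 => q0; have := congr1 (fun p : {poly K} => p`_j0) q0.
    by rewrite coef_poly ltn_ord valK coef0 => ->.
  have [s [a [e [e0 he]]]] := binary_split (A := S) 'X_i 1 q0 (size_poly _ _).
  exists s, a; have : I (binary #|T| q 'X_i 1).
    move: hx; congr I; apply: eq_bigr => j _.
    by rewrite expr1n mulr1 coef_poly ltn_ord valK.
  rewrite he => /(idM hI (e^-1)%:MP).
  by rewrite mul_mpolyC scalerA mulVf // scale1r.
have nr : ~ radical_of I 1 by move=> [k]; rewrite expr1n.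
have [I' [v [h1 h2 h3 h4]]] := null_point hI nr hs.
exists v => p /h2 hp; apply/eqP; apply: contraPT h3 => nz /=; apply; exists 1%N; rewrite expr1.
have h4' i : I' ('X_i - (v ord0 i)%:MP) by have := h4 i; rewrite -mul_mpolyC mulr1.
have := subst_cong p h1 h4'; rewrite subst_id.
have -> : subst (fun i => (v ord0 i)%:MP) p = (p.@[v ord0])%:MP_[n].
  rewrite substE mevalE (raddf_sum (@mpolyC n K)); apply: eq_bigr => m' _ /=.
  rewrite mpolyCM mul_mpolyC rmorph_prod; congr (_ *: _); apply: eq_bigr => j _.
  by rewrite rmorphXn.
move=> h; have : I' (p.@[v ord0])%:MP by rewrite -[X in I' X](subKr p); apply: idB.
by move=> /(idM h1 (p.@[v ord0]^-1)%:MP); rewrite -mpolyCM mulVf // mpolyC1.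
Qed.

(** The projection of a closed subset of the cone is closed. If the fibre over
    [c] is empty, then 1 is a combination of the [y i - c i] modulo [I]; multiplying
    module generators by it gives a matrix [P] with coefficients in the
    polynomials in [y], vanishing at [c], and the determinant of [1 - P] is the
    equation sought. *)
Lemma projection_closed I (c : 'I_r -> K) : is_ideal I -> J `<=` I ->
  ~ (exists2 v, zeros I v & forall i, (y i).@[v ord0] = c i) ->
  exists2 F : {mpoly K[r]}, I (subst y F) & F.@[c] != 0.
Proof.
move=> hI JI nv; pose I' := gen (I `|` range (fun i => y i - (c i)%:MP)).
have I1 : I' 1.
  apply: contrapT => n1; apply: nv.
  have JI' : J `<=` I' by move=> p /JI; apply: gen_subl.
  have [v hv] := finite_zero (gen_ideal _) JI' (fun i => gen_subr (imageT _ i)) n1.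
  exists v => [p hp|i]; first by apply: hv; apply: gen_subl.
  have := hv _ (gen_subr (imageT (fun i => y i - (c i)%:MP) i)).
  by rewrite mevalB mevalC => /eqP; rewrite subr_eq0 => /eqP.
have [s hs] := gen_family hI I1.
have [N span] := module_span; pose T : finType := 'X_{1..n < N.+1}.
pose w (a : 'I_#|T|) : 'X_{1..n < N.+1} := enum_val a.
have /choice [G hG] (z : 'I_#|T| * 'I_r) :
    exists G : 'X_{1..n < N.+1} -> {mpoly K[r]},
      J ('X_[w z.1] * s z.2 - \sum_m subst y (G m) * 'X_[m]) by apply: span.
pose P : 'M[{mpoly K[r]}]_#|T| := \matrix_(a, b) \sum_i ('X_i - (c i)%:MP) * G (a, i) (w b).
pose A := 1%:M - P.
have hX a : I ('X_[w a] - \sum_b subst y (P a b) * 'X_[w b]).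
  have -> : \sum_b subst y (P a b) * 'X_[w b] =
     \sum_i (y i - (c i)%:MP) * (\sum_m subst y (G (a, i) m) * 'X_[m]).
    under eq_bigr => b _ do rewrite mxE (raddf_sum (subst y)) mulr_suml /=.
    rewrite exchange_big; apply: eq_bigr => i _ /=.
    rewrite mulr_sumr [RHS](reindex (@enum_val _ predT)) /=; last by apply: onW_bij; apply: enum_val_bij.
    by apply: eq_bigr => b _; rewrite rmorphM rmorphB /= substX substC mulrA.
  rewrite -[X in X - _]mulr1 -(subrKA ('X_[w a] * \sum_i s i * (y i - (c i)%:MP))).
  apply: idD => //; first by rewrite -mulrBr; apply: idM.
  rewrite mulr_sumr -sumrB; apply: id_sum => // i _.
  rewrite mulrA [_ * (y i - _)]mulrC -mulrBr; apply: idM => //.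
  exact/JI/(hG (a, i)).
pose Ay := map_mx (subst y) A.
have hA a : I (\sum_b Ay a b * 'X_[w b]).
  have := hX a; congr I; rewrite -[X in X - _]mul1r.
  under [RHS]eq_bigr do rewrite !mxE rmorphB mulrBl /=.
  rewrite sumrB; congr (_ - _); last by apply: eq_bigr => b _; rewrite mxE.
  rewrite (bigD1 a) //= eqxx rmorph1 big1 ?addr0 // => b ne.
  by rewrite eq_sym (negbTE ne) rmorph0 mul0r.
have hdet a : I (\det Ay * 'X_[w a]).
  have : I (\sum_b (\adj Ay) a b * (\sum_d Ay b d * 'X_[w d])).
    by apply: id_sum => // b _; apply: idM.
  congr I; under eq_bigr do rewrite mulr_sumr.
  rewrite exchange_big /=.
  transitivity (\sum_d (\adj Ay *m Ay) a d * 'X_[w d]).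
    by apply: eq_bigr => d _; rewrite mxE mulr_suml; apply: eq_bigr => b _; rewrite mulrA.
  rewrite mul_adj_mx (bigD1 a) //= mxE eqxx mulr1n big1 ?addr0 // => d ne.
  by rewrite mxE eq_sym (negbTE ne) mulr0n mul0r.
exists (\det A).
  have lt0 : (mdeg (0%MM : 'X_{1..n}) < N.+1)%N by rewrite mdeg0.
  have := hdet (enum_rank (BMultinom lt0 : T)).
  by rewrite /w enum_rankK mpolyX0 mulr1 /Ay det_map_mx.
rewrite -det_map_mx (_ : map_mx _ A = 1%:M) ?det1 ?oner_neq0 //.
apply/matrixP => a b; rewrite !mxE rmorphB /= (raddf_sum (meval c)) big1 ?subr0 => [|i _].
  by case: eqP => _; rewrite ?meval1 ?meval0.
by rewrite /= mevalM mevalB mevalXU mevalC subrr mul0r.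
Qed.

End Projection.

(** * Krull dimension *)

Section Maximal.
Context {A : comNzRingType}.

(** Zorn's lemma. *)
Lemma maximal_avoiding (I M : set A) : is_ideal I -> (forall p, I p -> ~ M p) ->
  exists P : set A, [/\ is_ideal P, I `<=` P, forall p, P p -> ~ M p &
    forall a, ~ P a -> exists2 p, adj P a p & M p].
Proof.
move=> hI hM.
pose T := {P : set A | [/\ is_ideal P, I `<=` P & forall p, P p -> ~ M p]}.
pose t0 : T := exist _ I (And3 hI (fun _ => id) hM).
pose R (P Q : T) := `[< sval P `<=` sval Q >].
have [|||P maxP] := @ZL_preorder T t0 R.
- by move=> P; apply/asboolP.
- by move=> P Q W /asboolP h1 /asboolP h2; apply/asboolP => p /h1 /h2.
- move=> C totC; have [[P0 CP0]|nC] := pselect (exists P, C P); last first.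
    by exists t0 => s Cs; case: nC; exists s.
  pose U : set A := [set p | exists2 P, C P & sval P p].
  have hU : [/\ is_ideal U, I `<=` U & forall p, U p -> ~ M p].
    split.
    - split=> [|p q [P CP hp] [Q CQ hq]|a p [P CP hp]].
      + by exists P0 => //; case: (svalP P0) => h _ _; apply: id0.
      + have [/asboolP h|/asboolP h] := totC _ _ CP CQ.
          by exists Q => //; case: (svalP Q) => hQ _ _; apply: idD => //; apply: h.
        by exists P => //; case: (svalP P) => hP _ _; apply: idD => //; apply: h.
      + by exists P => //; case: (svalP P) => hP _ _; apply: idM.
    - by move=> p hp; exists P0 => //; case: (svalP P0) => _ h _; apply: h.
    - by move=> p [P CP hp]; case: (svalP P) => _ _ h; apply: h.
  exists (exist _ U hU) => P CP; apply/asboolP => p hp; by exists P.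
- case: (svalP P) => h1 h2 h3; exists (sval P); split=> // a na.
  apply: contrapT => hn; apply: na.
  have hA : [/\ is_ideal (adj (sval P) a), I `<=` adj (sval P) a &
      forall p, adj (sval P) a p -> ~ M p].
    split; [exact: adj_ideal|by move=> p /h2 hp; apply: sub_adj|].
    by move=> p hp Mp; apply: hn; exists p.
  have /maxP /asboolP : R P (exist _ _ hA) by apply/asboolP => p; apply: sub_adj.
  by apply; apply: mem_adj.
Qed.

End Maximal.

Section Dimension.
Context {K : numClosedFieldType} {n r : nat}.
Local Notation S := {mpoly K[n]}.
Context {J : set S} {y : 'I_r -> S}.
Hypotheses (hJ : hom_ideal J) (hy : forall i, Hd 1 (y i)) (hP : primary (gen (J `|` range y))).

Definition covers (I : set S) (C : set ('I_r -> K)) : Prop :=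
  forall c, C c -> exists2 v, zeros I v & forall i, (y i).@[v ord0] = c i.

Definition irreducible_set (C : set ('I_r -> K)) : Prop :=
  forall F G : {mpoly K[r]}, (exists2 c, C c & F.@[c] != 0) -> (exists2 c, C c & G.@[c] != 0) ->
    exists2 c, C c & F.@[c] * G.@[c] != 0.

Lemma zeros_closed (I : set S) : zariski_closed (zeros I).
Proof. by exists I. Qed.

(** An ideal [P] maximal among those that contain no polynomial in [y] with a
    nonzero value on [C]. Its zeros still project onto [C] because projections are
    closed, and they form an irreducible set because functions that do not
    vanish identically there divide polynomials in [y] modulo [P]. *)
Lemma irreducible_cover (I : set S) (C : set ('I_r -> K)) : is_ideal I -> J `<=` I ->
  irreducible_set C -> C !=set0 ->
  (forall F, I (subst y F) -> forall c, C c -> F.@[c] = 0) ->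
  exists P : set S, [/\ is_ideal P, I `<=` P, covers P C & irreducible_closed (zeros P)].
Proof.
move=> hI JI irr C0 cov.
pose M : set S := [set subst y F | F in [set F | exists2 c, C c & F.@[c] != 0]].
have hM p : I p -> ~ M p.
  move=> hp [F [c Cc /eqP nz] e]; apply: nz; apply: (cov F _ c Cc); by rewrite e.
have [P [h1 h2 h3 h4]] := maximal_avoiding hI hM.
have covP : covers P C.
  move=> c Cc; apply: contrapT => nv.
  have [F hF nF] := projection_closed hJ hy hP h1 (fun p hp => h2 p (JI p hp)) nv.
  by apply: (h3 _ hF); exists F => //; exists c.
exists P; split=> //; split; first exact: zeros_closed.
  by case: C0 => c /covP [v hv _]; exists v.
move=> _ _ [IA ->] [IB ->] sub; apply: contrapT => /not_orP [nA nB].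
have esc (X : set S) : ~ zeros P `<=` zeros X -> exists2 a, X a & ~ P a.
  move=> nX; apply: contrapT => h; apply: nX => v hv a Xa.
  by apply: contrapT => nz; apply: h; exists a => // /hv.
have [a Aa na] := esc _ nA; have [b Bb nb] := esc _ nB.
have [p1 [u hu] [F hF eF]] := h4 a na; have [p2 [w hw] [G hG eG]] := h4 b nb.
have [c Cc] := irr F G hF hG; have [v hv vc] := covP c Cc.
have ev (H : {mpoly K[r]}) : (subst y H).@[v ord0] = H.@[c].
  by rewrite meval_subst; apply: meval_eq.
have := hv _ hu; rewrite -eF mevalB mevalM ev => /eqP; rewrite subr_eq0 => /eqP ->.
have := hv _ hw; rewrite -eG mevalB mevalM ev => /eqP; rewrite subr_eq0 => /eqP ->.
by case: (sub v hv) => h; rewrite ?(h _ Aa) ?(h _ Bb) ?mulr0 ?mul0r eqxx.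
Qed.

End Dimension.

Section Surface.
Context {K : numClosedFieldType} {n r : nat}.
Local Notation S := {mpoly K[n]}.
Context {J : set S} {y : 'I_r.+2 -> S}.
Hypotheses (hJ : hom_ideal J) (hy : forall i, Hd 1 (y i)) (hP : primary (gen (J `|` range y))).

Let pt (a b : K) : 'I_r.+2 -> K := fun i => if i == ord0 then a else b.

Lemma irreducible_all : irreducible_set (setT : set ('I_r.+2 -> K)).
Proof.
move=> F G [c _ hF] [c' _ hG].
have F0 : F != 0 by apply: contraNneq hF => ->; rewrite meval0.
have G0 : G != 0 by apply: contraNneq hG => ->; rewrite meval0.
have [d hd] := mpoly_nonroot (mulf_neq0 F0 G0).
by exists d => //; rewrite -mevalM.
Qed.

Lemma irreducible_hyperplane :
  irreducible_set [set c : 'I_r.+2 -> K | c ord0 = 0].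
Proof.
pose z (i : 'I_r.+2) : {mpoly K[r.+2]} := if i == ord0 then 0 else 'X_i.
have zE (H : {mpoly K[r.+2]}) c : (subst z H).@[c] = H.@[fun i => if i == ord0 then 0 else c i].
  rewrite meval_subst; apply: meval_eq => i; rewrite /z; case: ifP => _.
    by rewrite meval0.
  by rewrite mevalXU.
have z0 (H : {mpoly K[r.+2]}) c : c ord0 = 0 -> (subst z H).@[c] = H.@[c].
  by move=> c0; rewrite zE; apply: meval_eq => i; case: eqP => // ->.
move=> F G [c c0 hF] [c' c0' hG].
have [||d _] := irreducible_all (F := subst z F) (G := subst z G).
- by exists c => //; rewrite z0.
- by exists c' => //; rewrite z0.
rewrite !zE => hd; by exists (fun i => if i == ord0 then 0 else d i).
Qed.

(** If [r.+2] linear forms are independent modulo [J] then the cone projects onto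
    an affine space of dimension at least two; irreducible sets above the whole
    space, a hyperplane and the origin form a chain of length two. *)
Lemma surface_dim : (forall F, J (subst y F) -> F = 0) -> ~ dim_le (zeros J) 1.
Proof.
move=> norel.
have van0 F : J (subst y F) -> forall c, [set: 'I_r.+2 -> K] c -> F.@[c] = 0.
  by move=> /norel -> c _; rewrite meval0.
have ne0 : [set: 'I_r.+2 -> K] !=set0 by exists (fun=> 0).
have [P0 [i0 J0 cov0 irr0]] :=
  irreducible_cover hJ hy hP hJ.1 (fun _ => id) irreducible_all ne0 van0.
have i1 := adj_ideal i0 (y ord0).
pose C1 := [set c : 'I_r.+2 -> K | c ord0 = 0].
have ne1 : C1 !=set0 by exists (fun=> 0).
have J1 : J `<=` adj P0 (y ord0) by move=> p /J0 hp; apply: sub_adj.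
have van1 F : adj P0 (y ord0) (subst y F) -> forall c, C1 c -> F.@[c] = 0.
  move=> [a hF] c c0; have [v hv vc] := cov0 c I.
  have := hv _ hF; rewrite mevalB mevalM vc c0 mulr0 subr0 meval_subst.
  by rewrite (meval_eq _ vc).
have [P1 [i1' P01 cov1 irr1]] :=
  irreducible_cover hJ hy hP i1 J1 irreducible_hyperplane ne1 van1.
have [v0 hv0 vc0] := cov1 (fun=> 0) erefl.
pose Z0 : set 'rV[K]_n := [set v0].
have Z0E : Z0 = zeros (range (fun i : 'I_n => 'X_i - (v0 ord0 i)%:MP)).
  rewrite eqEsubset; split=> [_ -> _ [i _ <-]|v hv] /=.
    by rewrite mevalB mevalXU mevalC subrr.
  apply/rowP => i; have := hv _ (imageT (fun i => 'X_i - (v0 ord0 i)%:MP) i).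
  by rewrite mevalB mevalXU mevalC => /eqP; rewrite subr_eq0 => /eqP.
have irrZ : irreducible_closed Z0.
  split; [by rewrite Z0E; exact: zeros_closed|by exists v0|].
  by move=> A B _ _ sub; case: (sub v0 erefl) => h; [left|right] => _ ->.
pose Z (i : nat) := if i is 0%N then Z0 else if i is 1%N then zeros P1 else zeros P0.
have P01' : P0 `<=` P1 by move=> p hp; apply: P01; apply: sub_adj.
have s10 : zeros P1 `<=` zeros P0 by move=> v hv p /P01' /hv.
have s0J : zeros P0 `<=` zeros J by move=> v hv p /J0 /hv.
move=> hd; suff : (2 <= 1)%N by [].
apply: (hd 2%N Z).
  case=> [|[|[|i]]] //= _; split=> //.
    by move=> _ ->; apply/s0J/s10.
  by move=> v /s10 /s0J.
case=> [|[|i]] //= _.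
  rewrite properEneq; split; last by move=> _ ->.
  apply/eqP => e; have [v hv vc] := cov1 (pt 0 1) erefl.
  have vE : v = v0 by have : Z0 v by rewrite e.
  have := vc (lift ord0 ord0); rewrite vE vc0 /pt /= => /eqP.
  by rewrite eq_sym oner_eq0.
rewrite properEneq; split=> //.
  apply/eqP => e; have [v hv vc] := cov0 (pt 1 0) I.
  have : zeros P1 v by rewrite e.
  have hy1 : P1 (y ord0) by apply: P01; apply: mem_adj; exact: i0.
  move=> /(_ _ hy1); rewrite vc /pt eqxx => /eqP.
  by rewrite oner_eq0.
Qed.

End Surface.

Section LinearParameter.
Context {K : numClosedFieldType} {n : nat}.
Local Notation S := {mpoly K[n]}.

Lemma hc_subst r (z : 'I_r -> S) (k : int) (F : {mpoly K[r]}) : (forall i, Hd 1 (z i)) ->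
  subst z (hc k F) = hc k (subst z F).
Proof.
move=> hz; pose N := msize F.
have EF : hc k (subst z F) = \sum_(j < N) hc k (subst z (hc j F)).
  by rewrite {1}(hc_partition (leqnn N)) (raddf_sum (subst z)) (raddf_sum (hc k)).
rewrite EF (eq_bigr (fun j : 'I_N => subst z (hc k (hc j F)))) => [|j _].
  by rewrite -(raddf_sum (subst z)) -(raddf_sum (hc k)) -(hc_partition (leqnn N)).
rewrite hc_hc; case: eqP => [->|/eqP ne].
  by rewrite hc_id //; apply: subst_Hd1 => //; exact: Hd_hc.
by rewrite rmorph0 (hc_ne (subst_Hd1 hz (@Hd_hc _ _ j F))) // eq_sym.
Qed.

(** By [surface_dim], the normalization of [S / J] stops with at most one linear
    form. The form is made nonzero because [general_forms] eliminates a variable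
    with it. *)
Theorem exists_parameter (J : set S) : (0 < n)%N -> hom_ideal J -> dim_le (zeros J) 1 ->
  exists l, [/\ Hd 1 l, l != 0 & primary (adj J l)].
Proof.
move=> n0 hJ hdim.
have [|l hl hP] := linear_parameter hJ.1 _ (fun i => HdXi i) (primary_variables J).
  move=> r z hz hP; apply: contrapT => h; apply: (surface_dim hJ hz hP _ hdim) => F hF.
  apply/eqP; apply: contraT => F0; exfalso; apply: h.
  have [k hk] : exists k : nat, hc k F != 0.
    apply: contrapT => h; move: F0; rewrite (hc_partition (leqnn (msize F))) big1 ?eqxx // => j _.
    by apply/eqP; apply: contrapT => /negP nz; apply: h; exists (j : nat).
  exists k, (hc k F); split=> //; first exact: Hd_hc.
  by rewrite (hc_subst _ _ hz); apply: hJ.2.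
have [l0|nl] := eqVneq l 0; last by exists l.
exists 'X_(Ordinal n0); split; first exact: HdXi.
  apply/eqP => /(congr1 (mcoeff U_(Ordinal n0))).
  by rewrite mcoeffX eqxx mcoeff0 => /eqP; rewrite oner_eq0.
apply: primary_le hP => p [a]; rewrite l0 mulr0 subr0 => hp.
by apply: rad_sub; apply: sub_adj.
Qed.

End LinearParameter.

(** * Euler's relation, the chain rule and affine charts *)

Section Calculus.
Context {K : fieldType} {n : nat}.
Local Notation S := {mpoly K[n]}.

Lemma meval_scale (e : nat) (p : S) (c : K) (v : 'I_n -> K) : Hd e p ->
  p.@[fun j => c * v j] = c ^+ e * p.@[v].
Proof.
move=> /HdP hp; rewrite !mevalE mulr_sumr big_seq [RHS]big_seq.
apply: eq_bigr => m; rewrite mcoeff_msupp => /hp [<-]; rewrite mulrCA; congr (_ * _).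
rewrite (eq_bigr (fun i => c ^+ m i * v i ^+ m i)) => [|i _]; last by rewrite exprMn.
by rewrite big_split /= prodrXr mdegE.
Qed.

Lemma euler (d : nat) (f : S) : Hd d f -> \sum_i 'X_i * f^`M(i) = d%:R *: f.
Proof.
move=> /HdP hf.
rewrite [X in _ *: X]mpolyE scaler_sumr.
under eq_bigr => i _ do rewrite [X in mderiv i X]mpolyE (raddf_sum (mderiv i)) mulr_sumr.
rewrite exchange_big big_seq [RHS]big_seq /=; apply: eq_bigr => m.
rewrite mcoeff_msupp => /hf [hm].
rewrite (eq_bigr (fun i => (m i)%:R *: (f@_m *: 'X_[m]))) => [|i _].
  by rewrite -scaler_suml -natr_sum -mdegE hm.
rewrite mderivZ mderivX.
have [->|mi] := eqVneq (m i) 0%N; first by rewrite mulr0n !scale0r scaler0 mulr0.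
rewrite -!scalerAr -mpolyXD addmC submK ?lep1mP //.
by rewrite !scalerA mulrC.
Qed.

Lemma mderiv_Hd (d : nat) (f : S) i : Hd d f -> Hd d.-1 f^`M(i).
Proof.
move=> /HdP hf; apply/HdP => m; rewrite mcoeff_deriv => nz.
have /hf [<-] : f@_(m + U_(i)) != 0 by apply: contraNneq nz => ->; rewrite mul0rn.
by rewrite mdegD mdeg1 addn1.
Qed.

Lemma mderiv_subst r (y : 'I_n -> {mpoly K[r]}) (F : S) (j : 'I_r) :
  (subst y F)^`M(j) = \sum_k subst y F^`M(k) * (y k)^`M(j).
Proof.
pose P (G : S) := (subst y G)^`M(j) = \sum_k subst y G^`M(k) * (y k)^`M(j).
have PM G H : P G -> P H -> P (G * H).
  rewrite /P => h1 h2; rewrite rmorphM /= mderivM h1 h2 mulr_suml mulr_sumr -big_split /=.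
  apply: eq_bigr => k _; rewrite mderivM rmorphD !rmorphM /=; ring.
have PC c : P c%:MP.
  by rewrite /P substC mderivC big1 // => k _; rewrite mderivC rmorph0 mul0r.
have PX i : P 'X_i.
  rewrite /P substX (bigD1 i) //= big1 => [|k ne].
    by rewrite mderivX mnm1E eqxx scale1r (_ : U_(i) - U_(i) = 0)%MM ?mpolyX0 ?rmorph1 ?mul1r ?addr0 //;
      apply/mnmP => k; rewrite mnmBE subnn mnm0E.
  by rewrite mderivX mnm1E eq_sym (negbTE ne) scale0r rmorph0 mul0r.
have P0 : P 0 by rewrite -mpolyC0; apply: PC.
have PD G H : P G -> P H -> P (G + H).
  rewrite /P => h1 h2; rewrite rmorphD /= mderivD h1 h2 -big_split /=.
  by apply: eq_bigr => k _; rewrite mderivD rmorphD mulrDl.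
have P1 : P 1 by rewrite -mpolyC1; apply: PC.
suff PF : P F by [].
rewrite [F]mpolyE; apply: (big_ind P P0 PD) => m _.
rewrite -mul_mpolyC; apply: (PM _ _ (PC _)); rewrite mpolyXE_id.
apply: (big_ind P P1 PM) => k _; elim: (m k) => [|a IH]; first by rewrite expr0.
by rewrite exprS; apply: PM (PX k) IH.
Qed.

End Calculus.

Section Chart.
Context {K : numFieldType} {n : nat}.
Local Notation S := {mpoly K[n]}.
Context (i : 'I_n).
Implicit Types p q : S.
Local Notation T := {mpoly K[n.-1]}.

Let chart (j : 'I_n) : T := if unlift i j is Some l then 'X_l else 1.

Lemma dehomogE p : dehomog i p = subst chart p.
Proof.
rewrite /dehomog /comp_mpoly /subst; congr mmap.
by apply/funext => j; rewrite tnth_mktuple.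
Qed.

Lemma dehomogM p q : dehomog i (p * q) = dehomog i p * dehomog i q.
Proof. by rewrite !dehomogE rmorphM. Qed.

Lemma dehomogD p q : dehomog i (p + q) = dehomog i p + dehomog i q.
Proof. by rewrite !dehomogE rmorphD. Qed.

Lemma dehomogB p q : dehomog i (p - q) = dehomog i p - dehomog i q.
Proof. by rewrite !dehomogE rmorphB. Qed.

Lemma dehomogZ c p : dehomog i (c *: p) = c *: dehomog i p.
Proof. by rewrite !dehomogE substZ. Qed.

Lemma dehomog0 : dehomog i (0 : S) = 0.
Proof. by rewrite dehomogE rmorph0. Qed.

Lemma dehomogX : dehomog i ('X_i : S) = 1.
Proof. by rewrite dehomogE substX /chart unlift_none. Qed.

Lemma dehomogXn a p : dehomog i ('X_i ^+ a * p) = dehomog i p.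
Proof. by rewrite dehomogM dehomogE rmorphXn /= -dehomogE dehomogX expr1n mul1r. Qed.

Lemma dehomog_deriv p l : (dehomog i p)^`M(l) = dehomog i p^`M(lift i l).
Proof.
rewrite !dehomogE mderiv_subst (bigD1 (lift i l)) //= big1 ?addr0 => [|j ne].
  rewrite {2}/chart liftK mderivX mnm1E eqxx scale1r (_ : U_(l) - U_(l) = 0)%MM ?mpolyX0 ?mulr1 //.
  by apply/mnmP => k; rewrite mnmBE subnn mnm0E.
rewrite /chart; case: unliftP ne => [k ->|_] ne; last first.
  by rewrite -mpolyC1 mderivC mulr0.
rewrite mderivX mnm1E (_ : (k == l) = false) ?scale0r ?mulr0 //.
by apply/negbTE; apply: contraNneq ne => ->.
Qed.

(** Dehomogenization is the evaluation at the representative of [v] with [i]-th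
    coordinate 1. *)
Lemma dehomog_eval (e : nat) p (v : 'rV[K]_n) : v ord0 i != 0 -> Hd e p ->
  (dehomog i p).@[chart_coord i v ord0] = (v ord0 i)^-1 ^+ e * p.@[v ord0].
Proof.
move=> vi hp; rewrite -(meval_scale _ _ hp) dehomogE meval_subst; apply: meval_eq => j.
rewrite /chart; have [l ->|->] := unliftP i j; last by rewrite meval1 mulVf.
by rewrite mevalXU mxE mulrC.
Qed.

Lemma dehomog_eq0 (e : nat) p : Hd e p -> dehomog i p = 0 -> p = 0.
Proof.
move=> hp p0; apply/eqP; apply: contraT => nz.
have nzX : 'X_i * p != 0.
  rewrite mulf_neq0 //; apply/eqP => /(congr1 (mcoeff U_(i))).
  by rewrite mcoeffX eqxx mcoeff0 => /eqP; rewrite oner_eq0.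
have [c] := mpoly_nonroot nzX; rewrite mevalM mevalXU mulf_eq0 negb_or => /andP [ci pc].
pose v : 'rV[K]_n := \row_j c j.
have vi : v ord0 i != 0 by rewrite mxE.
have := dehomog_eval vi hp; rewrite p0 meval0 => /esym/eqP.
rewrite mulf_eq0 expf_eq0 invr_eq0 (negbTE vi) andbF /= (_ : p.@[_] = p.@[c]) ?(negbTE pc) //.
by apply: meval_eq => j; rewrite mxE.
Qed.

(** Two forms with the same dehomogenization agree up to powers of the
    coordinate that is set to 1. *)
Lemma dehomog_inj (a b : nat) p q : Hd a p -> Hd b q -> dehomog i p = dehomog i q ->
  'X_i ^+ b * p = 'X_i ^+ a * q.
Proof.
move=> hp hq e; apply/eqP; rewrite -subr_eq0; apply/eqP.
apply: (@dehomog_eq0 (a + b)); last by rewrite dehomogB !dehomogXn e subrr.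
have hX (c : nat) : Hd c ('X_i ^+ c : S) by have := HdXn c (@HdXi K n i); rewrite mul1r.
apply: subspB; first exact: subsp_Hd.
  by rewrite addnC PoszD; apply: HdM.
by rewrite PoszD; apply: HdM.
Qed.

Lemma homogenize (P : T) (D : nat) : (msize P <= D)%N -> exists2 p, Hd D p & dehomog i p = P.
Proof.
move=> hD; pose up (l : 'I_n.-1) : S := 'X_(lift i l).
have hup l : Hd 1 (up l) by apply: HdXi.
exists (\sum_(m <- msupp P) P@_m *: ('X_i ^+ (D - mdeg m) * subst up 'X_[m])).
  rewrite big_seq; apply: subsp_sum => [|m hm]; first exact: subsp_Hd.
  apply: subspZ; first exact: subsp_Hd.
  have le : (mdeg m <= D)%N by apply: leq_trans hD; apply: ltnW; apply: msize_mdeg_lt.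
  rewrite -(subnK le) PoszD addnK; apply: HdM.
    by have := HdXn (D - mdeg m) (@HdXi K n i); rewrite mul1r.
  by apply: subst_Hd1 => //; exact: HdX.
rewrite dehomogE (raddf_sum (subst chart)) [RHS]mpolyE; apply: eq_bigr => m _.
rewrite /= substZ; congr (_ *: _); rewrite -dehomogE dehomogXn dehomogE subst_subst.
rewrite -[RHS]subst_id; congr subst; apply/funext => l.
by rewrite /up substX /chart liftK.
Qed.

End Chart.

(** * Tjurina numbers as values of Hilbert functions *)

Section Localization.
Context {K : numFieldType} {n : nat}.
Local Notation S := {mpoly K[n]}.
Context {J : set S} (hJ : hom_ideal J).
Implicit Types (p q u l : S) (v w : 'rV[K]_n).

(** The forms whose germ at the point [v] lies in [J]; denominators are
    homogeneous, which makes this ideal homogeneous. *)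
Definition localized v : set S :=
  [set p | exists (e : nat) (u : S), [/\ Hd e u, u.@[v ord0] != 0 & J (u * p)]].

Lemma localized_ideal v : is_ideal (localized v).
Proof.
have iJ := hJ.1; split=> [|p q [e1 [u1 [h1 n1 k1]]] [e2 [u2 [h2 n2 k2]]]|a p [e [u [h nz k]]]].
- exists 0%N, 1; split; [exact: Hd1|by rewrite meval1 oner_neq0|].
  by rewrite mulr0; apply: id0.
- exists (e1 + e2)%N, (u1 * u2); split; first by rewrite PoszD; apply: HdM.
    by rewrite mevalM mulf_neq0.
  rewrite mulrDr; apply: idD => //; last by rewrite -mulrA; apply: idM.
  by rewrite mulrAC; apply: idMr.
- by exists e, u; split=> //; rewrite mulrCA; apply: idM.
Qed.

Lemma hom_localized v : hom_ideal (localized v).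
Proof.
split=> [|k p [e [u [h nz hk]]]]; first exact: localized_ideal.
exists e, u; split=> //.
by have := hJ.2 (k + e%:Z) _ hk; rewrite (hcM _ _ h) addrK.
Qed.

Lemma sub_localized v : J `<=` localized v.
Proof.
move=> p hp; exists 0%N, 1; split; [exact: Hd1|by rewrite meval1 oner_neq0|].
by rewrite mul1r.
Qed.

Lemma localized_cancel v (e : nat) u p : Hd e u -> u.@[v ord0] != 0 ->
  localized v (u * p) -> localized v p.
Proof.
move=> hu nu [e' [u' [h' n' k']]]; exists (e' + e)%N, (u' * u); split.
- by rewrite PoszD; apply: HdM.
- by rewrite mevalM mulf_neq0.
- by rewrite -mulrA.
Qed.

Lemma localized_proper v (e : nat) u : zeros J v -> Hd e u -> u.@[v ord0] != 0 -> ~ localized v u.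
Proof.
move=> hv hu nu [e' [u' [h' n' k']]]; have := hv _ k'; rewrite mevalM => /eqP.
by rewrite mulf_eq0 (negbTE nu) (negbTE n').
Qed.

Context {l : S} (hl : Hd 1 l) (hP : primary (adj J l)).

Lemma parameter_neq0 v : zeros J v -> v != 0 -> l.@[v ord0] != 0.
Proof.
move=> hv; apply: contraNneq => lv; apply/eqP/rowP => i; rewrite mxE.
have [k [a ha]] := hP i; have := hv _ ha.
rewrite mevalB mevalM lv mulr0 subr0 rmorphXn /= mevalXU => /eqP.
by rewrite expf_eq0 => /andP [_ /eqP].
Qed.

(** The form [l] does not vanish at [v], so it is regular modulo [localized v], and
    it generates everything in large degree. *)
Lemma hilb_localized_const : exists k0 : nat, forall v (k : nat), zeros J v -> v != 0 ->
  (k0 <= k)%N -> hilb (localized v) k = hilb (localized v) k0.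
Proof.
have [k0 hk0] := primary_deg (adj_ideal hJ.1 l) hP; exists k0 => v k hv vn.
elim: k => [|k IH]; first by rewrite leqn0 => /eqP ->.
rewrite leq_eqVlt => /predU1P [->//|le]; rewrite -(IH le).
have hL := hom_localized v.
rewrite (hilb_reg k.+1 hL (e := 1) hl) => [|p].
  rewrite hilb_eq0 ?add0n; first by congr hilb; lia.
    exact/id_subsp/adj_ideal/hL.1.
  move=> p hp; have : adj J l p by apply: hk0 hp _; lia.
  by apply: adj_sub; [exact/adj_ideal/hL.1|
    by move=> q hq; apply: sub_adj; apply: sub_localized|exact/mem_adj/hL.1].
exact: (localized_cancel (e := 1) hl (parameter_neq0 hv vn)).
Qed.

(** Multiplication by [l] is surjective on [S / J] in large degree; so the
    dimensions decrease, hence become constant, and then it is bijective. *)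
Lemma hilb_stable : exists k0 : nat, forall k : nat, (k0 <= k)%N ->
  hilb J k = hilb J k0 /\ forall p, Hd k p -> J (l * p) -> J p.
Proof.
have [k1 hk1] := primary_deg (adj_ideal hJ.1 l) hP.
have sJ := id_subsp hJ.1; have sC := id_subsp (colon_ideal l hJ.1).
have JC : J `<=` colon J l by move=> p hp; apply: (idM hJ.1).
have E (k : nat) : (k1 <= k)%N -> hilb J k.+1 = hilb (colon J l) k.
  move=> le; rewrite (hilb_exact _ hJ hl) hilb_eq0 ?add0n; first by congr hilb; lia.
    exact/id_subsp/adj_ideal/hJ.1.
  by move=> p hp; apply: hk1 hp _; lia.
have dec (k : nat) : (k1 <= k)%N -> (hilb J k.+1 <= hilb J k)%N.
  by move=> le; rewrite E //; apply: hilb_le => // p _; apply: JC.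
pose P c := `[< exists2 k : nat, (k1 <= k)%N & hilb J k = c >].
have [|c /asboolP [k0 le0 <-] cmin] := ex_minnP (P := P).
  by exists (hilb J k1); apply/asboolP; exists k1.
have st (k : nat) : (k0 <= k)%N -> hilb J k = hilb J k0.
  move=> le; apply/eqP; rewrite eqn_leq; apply/andP; split; last first.
    by apply: cmin; apply/asboolP; exists k => //; exact: leq_trans le0 le.
  elim: k le => [|k IH]; first by rewrite leqn0 => /eqP ->.
  rewrite leq_eqVlt => /predU1P [->//|le]; apply: leq_trans (IH le).
  by apply: dec; exact: leq_trans le0 le.
exists k0 => k le; split; first exact: st.
move=> p hp; apply: (hilb_sub_eq sJ sC JC) hp.
by rewrite -E ?(leq_trans le0) // !st // ltnW.
Qed.

End Localization.

Arguments localized {K n} J v.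

Local Notation "p %:F" := (FracField.tofrac p) : ring_scope.

Section LocalRing.
Context {K : fieldType} {m : nat}.
Local Notation T := {mpoly K[m]}.
Local Notation F := {fraction T}.
Implicit Types (a : 'rV[K]_m) (P Q : T) (X : set F).

Lemma local_ringM a x y : local_ring a x -> local_ring a y -> local_ring a (x * y).
Proof.
move=> [p [q [nq ->]]] [p' [q' [nq' ->]]]; exists (p * p'), (q * q'); split.
  by rewrite mevalM mulf_neq0.
by rewrite !tofracM invfM mulrACA.
Qed.

Lemma local_ring_poly a P : local_ring a P%:F.
Proof.
by exists P, 1; rewrite meval1 oner_neq0 tofrac1 divr1.
Qed.

Lemma local_ring_inv a Q : Q.@[a ord0] != 0 -> local_ring a (Q%:F)^-1.
Proof. by move=> nQ; exists 1, Q; rewrite tofrac1 mul1r. Qed.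

Lemma tofrac_neq0 a Q : Q.@[a ord0] != 0 -> Q%:F != 0.
Proof. by move=> nQ; rewrite tofrac_eq0; apply: contraNneq nQ => ->; rewrite meval0. Qed.

Lemma local_ideal_gen a X x : X x -> ideal (local_ring a) X x.
Proof.
move=> Xx; exists [:: (1, x)]; last by rewrite big_seq1 mul1r.
by move=> p; rewrite inE => /eqP -> /=; rewrite -tofrac1; split=> //; exact: local_ring_poly.
Qed.

Lemma local_idealD a X x y :
  ideal (local_ring a) X x -> ideal (local_ring a) X y -> ideal (local_ring a) X (x + y).
Proof.
move=> [s hs ->] [t ht ->]; exists (s ++ t); last by rewrite big_cat.
by move=> p; rewrite mem_cat => /orP [/hs|/ht].
Qed.

Lemma local_idealM a X x y : local_ring a x ->
  ideal (local_ring a) X y -> ideal (local_ring a) X (x * y).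
Proof.
move=> hx [s hs ->]; exists [seq (x * p.1, p.2) | p <- s].
  by move=> _ /mapP [p /hs [h1 h2] ->] /=; split=> //; apply: local_ringM.
by rewrite big_map mulr_sumr; apply: eq_bigr => p _; rewrite mulrA.
Qed.

Lemma local_ideal0 a X : ideal (local_ring a) X 0.
Proof. by exists [::]; rewrite ?big_nil. Qed.

Lemma local_ideal_poly a X : is_ideal [set P : T | ideal (local_ring a) X P%:F].
Proof.
split=> [|P Q hP hQ|P Q hQ] /=; first by rewrite tofrac0; apply: local_ideal0.
  by rewrite tofracD; apply: local_idealD.
by rewrite tofracM; apply: local_idealM => //; exact: local_ring_poly.
Qed.

Lemma subsp_local_ideal a X : subsp (ideal (local_ring a) X).
Proof.
split=> [|c x y hx hy]; first exact: local_ideal0.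
apply: local_idealD => //; apply: (@local_idealM a X (c%:MP)%:F x) => //.
exact: local_ring_poly.
Qed.

End LocalRing.

Section Tjurina.
Context {K : numFieldType} {n d : nat} {f : {mpoly K[n]}}.
Local Notation S := {mpoly K[n]}.
Hypotheses (hf : Hd d f) (d0 : (0 < d)%N).
Local Notation J := (gen (range (fun i : 'I_n => f^`M(i)))).

Lemma hom_jacobian : hom_ideal J.
Proof. by apply: hom_gen => _ [i _ <-]; exists (d.-1 : int); apply: (mderiv_Hd _ hf). Qed.

Lemma zeros_gen (X : set S) : zeros (gen X) = zeros X.
Proof.
rewrite eqEsubset; split=> v hv p hp; first by apply: (hv p); exact: sub_gen.
by apply: (hp [set p | p.@[v ord0] = 0]) => //; exact: eval_ideal.
Qed.

(** Euler's relation, in characteristic zero. *)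
Lemma jacobian_f : J f.
Proof.
have dn0 : d%:R != 0 :> K by rewrite pnatr_eq0 -lt0n.
move=> I iI sI; rewrite -[f]scale1r -(mulVf dn0) -scalerA -(euler hf) -mul_mpolyC.
apply: (idM iI); apply: (id_sum iI) => i _; apply: (idM iI).
by apply: sI; exists i.
Qed.

Section Point.
Context {v : 'rV[K]_n} {i : 'I_n} (hv : zeros J v) (vi : v ord0 i != 0).
Local Notation h := (dehomog i f).
Local Notation a := (chart_coord i v).
Local Notation X := ((h%:F |` range (fun j => (h^`M(j))%:F)) : set {fraction {mpoly K[n.-1]}}).
Local Notation Ia := (ideal (local_ring a) X).

Let eval_neq0 (e : nat) u : Hd e u -> u.@[v ord0] != 0 -> (dehomog i u).@[a ord0] != 0.
Proof. by move=> hu nu; rewrite (dehomog_eval vi hu) mulf_neq0 // expf_neq0 // invr_neq0. Qed.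

Let dh_h : Ia h%:F. Proof. by apply: local_ideal_gen; left. Qed.

Let dh_deriv j : Ia (dehomog i f^`M(j))%:F.
Proof.
have lift_case l : Ia (dehomog i f^`M(lift i l))%:F.
  by apply: local_ideal_gen; right; exists l => //; rewrite dehomog_deriv.
have [l ->|->] := unliftP i j; first exact: lift_case.
have := euler hf; rewrite (bigD1 i) //= => /(congr1 (dehomog i)).
rewrite dehomogD dehomogM dehomogX mul1r dehomogZ => /(canRL (addrK _)) ->.
have iI := @local_ideal_poly K _ a X.
apply: (idB iI (p := d%:R *: h)).
  by rewrite -mul_mpolyC; apply: (idM iI); exact: dh_h.
have -> : dehomog i (\sum_(k | k != i) 'X_k * f^`M(k)) =
    \sum_(k | k != i) dehomog i 'X_k * dehomog i f^`M(k).
  rewrite dehomogE (raddf_sum (subst _)) /=; apply: eq_bigr => k _.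
  by rewrite rmorphM !dehomogE.
apply: (id_sum iI) => k ne; apply: (idM iI).
by move: ne; have [l -> _|->] := unliftP i k; [exact: lift_case|rewrite eqxx].
Qed.

Let jacobian_dehomog p : J p -> Ia (dehomog i p)%:F.
Proof.
move=> hp; have iI := @local_ideal_poly K _ a X.
have := hp [set p | Ia (dehomog i p)%:F]; apply; last by move=> _ [j _ <-]; exact: dh_deriv.
split=> [|p1 p2 h1 h2|p1 p2 h2] /=.
- by rewrite dehomog0 tofrac0; exact: local_ideal0.
- by rewrite dehomogD; apply: (idD iI).
- by rewrite dehomogM; apply: (idM iI).
Qed.

Let localized_dehomog p : localized J v p -> Ia (dehomog i p)%:F.
Proof.
move=> [e [u [hu nu hk]]]; have nq := eval_neq0 hu nu.
have := local_idealM (local_ring_inv nq) (jacobian_dehomog hk).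
by rewrite dehomogM tofracM mulrA mulVf ?mul1r // (tofrac_neq0 nq).
Qed.

(** Denominators are cleared by homogeneous polynomials only, so that equalities
    in the chart can be lifted to the cone. *)
Let jacobian_fraction (x : {fraction {mpoly K[n.-1]}}) : Prop :=
  exists (e e' : nat) (u w : S), [/\ Hd e u, u.@[v ord0] != 0, Hd e' w, J w &
    (dehomog i u)%:F * x = (dehomog i w)%:F].

Let HdX (c : nat) : Hd c ('X_i ^+ c : S).
Proof. by have := HdXn c (@HdXi K n i); rewrite mul1r. Qed.

Let eval_X (c : nat) : ('X_i ^+ c : S).@[v ord0] != 0.
Proof. by rewrite rmorphXn /= mevalXU expf_neq0. Qed.

Let fraction_D x y : jacobian_fraction x -> jacobian_fraction y -> jacobian_fraction (x + y).
Proof.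
move=> [e1 [e1' [u1 [w1 [h1 n1 h1' j1 E1]]]]] [e2 [e2' [u2 [w2 [h2 n2 h2' j2 E2]]]]].
have iJ := hom_jacobian.1.
(* Powers of 'X_i, which become 1 in the chart, equalize the degrees of the two numerators. *)
exists (e1 + e2)%N, (e1 + e2' + (e2 + e1'))%N, (u1 * u2),
  ('X_i ^+ (e1 + e2') * (u2 * w1) + 'X_i ^+ (e2 + e1') * (u1 * w2)); split.
- by rewrite PoszD; apply: HdM.
- by rewrite mevalM mulf_neq0.
- apply: subspD; first exact: subsp_Hd.
    by rewrite PoszD; apply: HdM => //; rewrite PoszD; apply: HdM.
  by rewrite addnC PoszD; apply: HdM => //; rewrite PoszD; apply: HdM.
- by apply: (idD iJ); apply: (idM iJ); apply: (idM iJ).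
- rewrite dehomogD !dehomogXn !dehomogM tofracM tofracD !tofracM mulrDr -E1 -E2.
  by rewrite -!mulrA; congr (_ + _); rewrite mulrCA.
Qed.

Let fraction_gen c g : local_ring a c -> X g -> jacobian_fraction (c * g).
Proof.
move=> [P [Q [nQ ->]]] Xg; have iJ := hom_jacobian.1.
have [e0 [g0 [hg Jg <-]]] : exists (e0 : nat) (g0 : S), [/\ Hd e0 g0, J g0 & (dehomog i g0)%:F = g].
  case: Xg => [->|[j _ <-]]; first by exists d, f; split=> //; exact: jacobian_f.
  exists d.-1, f^`M(lift i j); split; [exact: mderiv_Hd|by apply: sub_gen; exists (lift i j)|].
  by rewrite dehomog_deriv.
have [u hu uE] := homogenize i (leqnn (msize Q)).
have [w hw wE] := homogenize i (leqnn (msize P)).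
exists (msize Q), (msize P + e0)%N, u, (w * g0); split=> //.
- by move: nQ; rewrite -uE (dehomog_eval vi hu) mulf_eq0 negb_or => /andP [].
- by rewrite PoszD; apply: HdM.
- exact: (idM iJ).
- rewrite uE dehomogM wE tofracM mulrA mulrCA mulfV ?mulr1 //.
  exact: (tofrac_neq0 nQ).
Qed.

Let fraction_ideal x : Ia x -> jacobian_fraction x.
Proof.
move=> [s hs ->]; elim: s hs => [|[c g] s IH] hs.
  rewrite big_nil; exists 0%N, 0%N, 1, 0; split; [exact: Hd1|by rewrite meval1 oner_neq0
    |exact: Hd0|exact: (id0 hom_jacobian.1)|by rewrite mulr0 dehomog0 tofrac0].
rewrite big_cons; apply: fraction_D.
  by have [h1 h2] := hs _ (mem_head _ _); apply: fraction_gen.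
by apply: IH => p hp; apply: hs; rewrite inE hp orbT.
Qed.

(** By Euler's relation, the equation and its derivatives in the chart generate
    the same ideal as the dehomogenized partial derivatives. *)
Lemma dehomog_ideal (k : nat) p : Hd k p -> Ia (dehomog i p)%:F <-> localized J v p.
Proof.
move=> hp; split; last exact: localized_dehomog.
move=> /fraction_ideal [e [e' [u [w [hu nu hw Jw]]]]].
rewrite -tofracM -dehomogM => /eqP; rewrite tofrac_eq => /eqP E.
have hup : Hd (e + k)%N (u * p) by rewrite PoszD; apply: HdM.
have := dehomog_inj hup hw E => E'.
exists (e' + e)%N, ('X_i ^+ e' * u); split.
- by rewrite PoszD; apply: HdM.
- by rewrite mevalM mulf_neq0 ?eval_X.
- by rewrite -mulrA E'; apply: (idM hom_jacobian.1).
Qed.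

(** Germs at [v] are represented by forms of degree [k]. A denominator [q] is
    inverted modulo the ideal because the multiplication by [q] is injective from
    degree [k] to degree [k + D], and the two dimensions agree. *)
Lemma tjurina_hilb (k : nat) :
  (forall D : nat, hilb (localized J v) (k + D)%N = hilb (localized J v) k) ->
  tjurina h a = hilb (localized J v) k.
Proof.
move=> const; have hL := hom_localized hom_jacobian v.
apply: (@dim_quot_map _ _ _ _ _ _ _ (fun p : S => (dehomog i p)%:F)).
- by move=> c p q; rewrite dehomogD dehomogZ tofracD -mul_mpolyC tofracM.
- exact: subsp_Hd.
- exact/id_subsp/hL.1.
- exact: subsp_local_ideal.
- by move=> u _; exact: local_ring_poly.
- by move=> u; exact: dehomog_ideal.
- move=> _ [P [Q [nQ ->]]].
  pose D := maxn (msize P) (msize Q).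
  have [q hq qE] := homogenize i (leq_maxr _ _ : (msize Q <= D)%N).
  have [p hp pE] := homogenize i (leq_trans (leq_maxl _ _) (leq_addl _ _) : (msize P <= k + D)%N).
  have nq : q.@[v ord0] != 0.
    by move: nQ; rewrite -qE (dehomog_eval vi hq) mulf_eq0 negb_or => /andP [].
  have [w hw] : adj (localized J v) q p.
    apply: contrapT => np.
    have := hilb_gt0 (id_subsp (adj_ideal hL.1 q)) hp np.
    have := hilb_reg (k + D)%N hL hq (fun r => localized_cancel hq nq).
    rewrite PoszD addrK -PoszD const => /eqP.
    by rewrite -[X in X == _]add0n eqn_add2r => /eqP <-.
  exists (hc k w); first exact: Hd_hc.
  have hw' : localized J v (p - hc k w * q).
    have := hL.2 (k + D)%N _ hw; rewrite raddfB /= (hc_id hp) [w * q]mulrC (hcM _ _ hq).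
    by rewrite PoszD addrK [q * _]mulrC.
  have hr : Hd (k + D)%N (p - hc k w * q).
    apply: subspB => //; first exact: subsp_Hd.
    by rewrite PoszD; apply: HdM => //; exact: Hd_hc.
  have := local_idealM (local_ring_inv nQ) ((dehomog_ideal hr).2 hw').
  have nQF := tofrac_neq0 nQ.
  congr (ideal _ _ _); rewrite dehomogB dehomogM pE qE tofracB tofracM mulrBr mulrC.
  by rewrite [_^-1 * _]mulrC mulfK.
- exact/fin_Hd/id_subsp/hL.1.
Qed.

End Point.

Lemma tjurina_atE (v : 'rV[K]_n) (k : nat) : zeros J v -> v != 0 ->
  (forall D : nat, hilb (localized J v) (k + D)%N = hilb (localized J v) k) ->
  tjurina_at f v = hilb (localized J v) k.
Proof.
move=> hv vn hk; rewrite /tjurina_at; case: pickP => [i vi|h]; first exact: tjurina_hilb.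
case/eqP: vn; apply/rowP => i; rewrite mxE; apply/eqP.
by have := h i => /negbFE.
Qed.

End Tjurina.

(** * The total Tjurina number *)

Section Separation.
Context {K : numClosedFieldType} {n : nat}.
Local Notation S := {mpoly K[n]}.
Context {J : set S} {l : S} (hJ : hom_ideal J) (hl : Hd 1 l) (hP : primary (adj J l)).
Implicit Types (v w : 'rV[K]_n) (p : S).

Lemma growth_parameter : growth_le J 1.
Proof.
by apply: (@growth_primary _ _ _ [:: l]) => // g; rewrite inE => /eqP ->; exists 1%N.
Qed.

Definition point v : Prop := zeros J v /\ v != 0.

(** Split the relation between a coordinate and [l] into its factors that vanish
    at [v], which do not vanish at [w], and those that do not. *)
Lemma localized_separates v w : point v -> point w -> (forall c : K, w <> c *: v) ->
  exists2 p, localized J v p & p.@[w ord0] != 0.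
Proof.
move=> [hv vn] [hw wn] nc.
have lv := parameter_neq0 hP hv vn; have lw := parameter_neq0 hP hw wn.
have [i hi] : exists i, w ord0 i != v ord0 i / l.@[v ord0] * l.@[w ord0].
  apply: contrapT => h; apply: (nc (l.@[w ord0] / l.@[v ord0])).
  apply/rowP => i; rewrite mxE; apply/eqP; apply: contrapT => /negP hi; apply: h; exists i.
  by rewrite mulrAC [v ord0 i * _]mulrC mulrAC.
have [s [a hs]] := split_relation hJ.1 growth_parameter (HdXi i) hl.
pose al := v ord0 i / l.@[v ord0].
have hx t : Hd 1 ('X_i - t *: l).
  by apply: subspB; [exact: subsp_Hd|exact: HdXi|apply: subspZ => //; exact: subsp_Hd].
exists (\prod_(t <- s | t == al) ('X_i - t *: l)).
  move: hs; rewrite (bigID (pred1 al)) /= -mulrA mulrC => hs.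
  pose e := (\sum_(t <- s | t != al) 1 + a)%N.
  exists e, (\prod_(t <- s | t != al) ('X_i - t *: l) * l ^+ a); split=> //.
    rewrite PoszD; apply: HdM; last by have := HdXn a hl; rewrite mul1r.
    apply: (big_rec2 (fun (q : S) (k : nat) => Hd k q)); first exact: Hd1.
    by move=> t q k _ hq; rewrite PoszD; apply: HdM.
  rewrite mevalM rmorphXn mulf_neq0 ?expf_neq0 // rmorph_prod prodf_seq_neq0.
  apply/allP => t _; apply/implyP => ne; rewrite /= mevalB mevalXU mevalZ subr_eq0.
  by apply: contraNneq ne => e'; rewrite /al e' mulfK.
rewrite rmorph_prod prodf_seq_neq0; apply/allP => t _; apply/implyP => /eqP -> /=.
by rewrite mevalB mevalXU mevalZ subr_eq0.
Qed.

Lemma nullstellensatz I : hom_ideal I -> J `<=` I -> (forall v, point v -> zeros I v -> False) ->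
  primary I.
Proof.
move=> hI JI h; apply: (hom_nullstellensatz hJ growth_parameter hl hP hI JI) => v hv.
apply/eqP; apply: contraT => vn; exfalso; apply: (h v) => //; split=> // p /JI; exact: hv.
Qed.

Definition meet_localized (vs : seq 'rV[K]_n) : set S := [set p | forall v, v \in vs -> localized J v p].

Lemma hom_meet vs : hom_ideal (meet_localized vs).
Proof.
split=> [|k p hp v hv]; last by apply: (hom_localized hJ v).2; exact: hp.
split=> [v hv|p q hp hq v hv|a p hp v hv].
- exact: (id0 (localized_ideal hJ v)).
- by apply: (idD (localized_ideal hJ v)); [exact: hp|exact: hq].
- by apply: (idM (localized_ideal hJ v)); exact: hp.
Qed.

Fixpoint distinct_points (vs : seq 'rV[K]_n) : Prop :=
  if vs is v :: vs' then
    [/\ point v, forall w, w \in vs' -> forall c : K, c *: v <> w & distinct_points vs']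
  else True.

(** Chinese remainders in one degree. *)
Lemma hilb_meet2 (A B : set S) k : hom_ideal A -> hom_ideal B ->
  (forall p, Hd k p -> exists2 a, A a & B (p - a)) ->
  hilb (A `&` B) k = (hilb A k + hilb B k)%N.
Proof.
move=> hA hB hAB; have sA := id_subsp hA.1; have sB := id_subsp hB.1.
have sAB := subspI sA sB; have sH := @subsp_Hd K n k.
have sHA := subspI sH sA.
have h1 : Hd k `&` A `<=` Hd k by move=> p [].
have h2 : (A `&` B) `&` Hd k `<=` Hd k `&` A by move=> p [[? ?] ?].
rewrite /hilb (dim_quot_add sH sHA sAB h1 h2 (fin_Hd k sAB)); congr (_ + _)%N.
  by apply: hilb_eq => // p hp; split=> // -[].
apply/esym; apply: (@dim_quot_map _ _ _ _ _ _ _ id) => //.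
- by move=> u [_ Au]; split=> // -[].
- move=> u hu; have [a ha hb] := hAB u hu; exists (hc k a).
    by split; [exact: Hd_hc|exact: hA.2].
  by rewrite -{1}[u](hc_id hu) -raddfB; apply: hB.2.
- exact: (fin_quot_sub sAB sAB h1 _ (fin_Hd k sAB)).
Qed.

(** The ideal of one point plus that of the others has no zero but the
    origin, so it contains everything in large degree. *)
Lemma hilb_meet vs : distinct_points vs -> exists k0 : nat, forall k : nat, (k0 <= k)%N ->
  hilb (meet_localized vs) k = (\sum_(v <- vs) hilb (localized J v) k)%N.
Proof.
elim: vs => [_|v vs IH [pv nv dvs]].
  exists 0%N => k _; rewrite big_nil; apply: hilb_eq0 => [|p _ v //].
  by apply: id_subsp; exact: (hom_meet _).1.
have [k1 hk1] := IH dvs.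
have iV := localized_ideal hJ v; have iM := (hom_meet vs).1.
pose U : set S := gen (localized J v `|` meet_localized vs).
have hU : hom_ideal U.
  split=> [|k p hp]; first exact: gen_ideal.
  suff: [set q | forall k, U (hc k q)] p by apply.
  apply: hp; last first.
    move=> q [hq|hq] j; apply: sub_gen; [left|right].
      exact: (hom_localized hJ v).2.
    exact: (hom_meet vs).2.
  have iU : is_ideal U by exact: gen_ideal.
  split=> [j|q1 q2 h1 h2 j|a q h j] /=.
  - by rewrite raddf0; exact: (id0 iU).
  - by rewrite raddfD; apply: (idD iU); [exact: h1|exact: h2].
  - rewrite (hc_partition (leqnn (msize a))) mulr_suml (raddf_sum (hc j)) /=.
    apply: (id_sum iU) => b _; rewrite (hcM _ _ (@Hd_hc _ _ b a)).
    by apply: (idM iU); exact: h.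
have JU : J `<=` U by move=> p hp; apply: sub_gen; left; apply: sub_localized.
have vsP : forall w, w \in vs -> point w.
  elim: (vs) (dvs) => // w ws IHw [pw _ dws] w'; rewrite inE => /predU1P [->//|].
  exact: IHw.
have primU : primary U.
  apply: nullstellensatz => // w pw zw.
  have [[c wE]|nc] := pselect (exists c : K, w = c *: v); last first.
    have [p hp /eqP nz] := localized_separates pv pw (fun c e => nc (ex_intro _ c e)).
    by apply: nz; apply: zw; apply: sub_gen; left.
  have : exists2 p, meet_localized vs p & p.@[w ord0] != 0.
    elim: (vs) (vsP) (nv) => [|v' vs' IHv] vsP' nv'.
      by exists 1 => //; rewrite meval1 oner_neq0.
    have [||p hp np] := IHv.
    - by move=> x hx; apply: vsP'; rewrite inE hx orbT.
    - by move=> x hx; apply: nv'; rewrite inE hx orbT.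
    have pv' : point v' by apply: vsP'; rewrite mem_head.
    have nc c' : w <> c' *: v'.
      have c'0 : c' = 0 -> w <> c' *: v'.
        by move=> ->; rewrite scale0r; have [_ /eqP] := pw.
      have [/c'0//|nc' e] := eqVneq c' 0.
      apply: (nv' v' (mem_head _ _) (c'^-1 * c)).
      by rewrite -scalerA -wE e scalerA mulVf // scale1r.
    have [q hq nq] := localized_separates pv' pw nc.
    exists (p * q); last by rewrite mevalM mulf_neq0.
    move=> x; rewrite inE => /predU1P [->|hx].
      exact: (idM (localized_ideal hJ v')).
    by apply: (idMr (localized_ideal hJ x)); apply: hp.
  move=> [p hp /eqP]; apply; apply: zw; by apply: sub_gen; right.
have [k2 hk2] := primary_deg hU.1 primU.
exists (maxn k1 k2) => k; rewrite geq_max => /andP [le1 le2].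
rewrite big_cons -hk1 // -hilb_meet2; [|exact: hom_localized|exact: hom_meet|].
  congr hilb; rewrite eqEsubset; split=> p.
    by move=> hp; split=> [|w hw]; apply: hp; rewrite inE ?eqxx // hw orbT.
  by move=> [h1 h2] w; rewrite inE => /predU1P [->//|]; exact: h2.
move=> p hp; have := hk2 k p hp; rewrite lez_nat => /(_ le2).
move=> /(_ [set q | exists2 a, localized J v a & meet_localized vs (q - a)]); apply.
  split=> [|q1 q2 [a1 h1 k1'] [a2 h2 k2']|a q [b h1 h2]].
  - by exists 0; rewrite ?subr0; [exact: (id0 iV)|exact: (id0 iM)].
  - by exists (a1 + a2); [exact: (idD iV)|rewrite opprD addrACA; exact: (idD iM)].
  - by exists (a * b); [exact: (idM iV)|rewrite -mulrBr; exact: (idM iM)].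
move=> q [hq|hq]; first by exists q => //; rewrite subrr; exact: (id0 iM).
by exists 0; rewrite ?subr0 //; exact: (id0 iV).
Qed.

Lemma zeros_scale (c : K) v : zeros J v -> zeros J (c *: v).
Proof.
move=> hv p hp; rewrite (hc_partition (leqnn (msize p))) (raddf_sum (meval _)) big1 // => j _.
have E : (hc j p).@[(c *: v) ord0] = (hc j p).@[fun i => c * v ord0 i].
  by apply: meval_eq => i; rewrite mxE.
rewrite /= E (meval_scale _ _ (@Hd_hc _ _ _ _)) (hv (hc j p)) ?mulr0 //.
exact: hJ.2.
Qed.

Definition lines : set {vspace 'rV[K]_n} := [set <[v]>%VS | v in zeros J `\ 0].

Lemma line_scale (c : K) v : c != 0 -> <[c *: v]>%VS = <[v]>%VS.
Proof.
move=> c0; apply/eqP; rewrite eqEsubv; apply/andP; split; apply/subvP => x /vlineP [k ->].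
  by apply/vlineP; exists (k * c); rewrite scalerA.
by apply/vlineP; exists (k / c); rewrite scalerA mulfVK.
Qed.

Lemma lines_pick z : lines z -> point (vpick z) /\ <[vpick z]>%VS = z.
Proof.
move=> [v [hv /eqP vn] <-]; have /vlineP [c cE] := memv_pick <[v]>%VS.
have cv0 : vpick <[v]>%VS != 0.
  rewrite vpick0; apply: contraNneq vn => h; rewrite -memv0 -h; exact: memv_line.
have c0 : c != 0 by apply: contraNneq cv0; rewrite cE => ->; rewrite scale0r.
by rewrite cE line_scale //; split=> //; split; [exact: zeros_scale|rewrite -cE].
Qed.

Lemma distinct_lines (zs : seq {vspace 'rV[K]_n}) : uniq zs -> (forall z, z \in zs -> lines z) ->
  distinct_points [seq vpick z | z <- zs].
Proof.
elim: zs => //= z zs IH /andP [nz uz] hz.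
have [pz zE] := lines_pick (hz z (mem_head _ _)).
have hzs x : x \in zs -> lines x by move=> hx; apply: hz; rewrite inE hx orbT.
split=> // [_ /mapP [z' hz' ->] c e|]; last exact: IH.
have [[_ n'] zE'] := lines_pick (hzs z' hz').
have c0 : c != 0 by apply: contraNneq n' => c0; rewrite -e c0 scale0r.
by case/negP: nz; rewrite -zE -(line_scale _ c0) e zE'.
Qed.

Lemma meet_sub vs : J `<=` meet_localized vs.
Proof. by move=> p hp v _; exact: sub_localized. Qed.

Lemma distinct_point vs v : distinct_points vs -> v \in vs -> point v.
Proof.
elim: vs => // w vs IH [pw _ dvs]; rewrite inE => /predU1P [->//|].
exact: IH.
Qed.

(** Each point contributes at least 1, because [l ^+ k] does not vanish there. *)
Lemma size_distinct vs k0 : distinct_points vs -> (forall k : nat, (k0 <= k)%N -> hilb J k = hilb J k0) ->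
  (size vs <= hilb J k0)%N.
Proof.
move=> dvs st; have [k1 hk1] := hilb_meet dvs.
pose k := maxn k0 k1; have := hk1 k (leq_maxr _ _) => E.
rewrite -(st k (leq_maxl _ _)).
apply: leq_trans (_ : hilb (meet_localized vs) k <= _)%N; last first.
  by apply: hilb_le => [||p _]; [exact/id_subsp/hJ.1|exact/id_subsp/(hom_meet _).1|exact: meet_sub].
rewrite E -sum1_size big_seq [leqRHS]big_seq; apply: leq_sum => v hv.
have [zv nv] := distinct_point dvs hv.
have hlk : Hd k (l ^+ k) by have := HdXn k hl; rewrite mul1r.
apply: (hilb_gt0 (id_subsp (localized_ideal hJ v)) hlk).
apply: (localized_proper zv hlk); rewrite rmorphXn /=.
by apply: expf_neq0; apply: (parameter_neq0 hP zv nv).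
Qed.

Lemma finite_lines : finite_set lines.
Proof.
have [k0 hk0] := hilb_stable hJ hl hP.
apply: contrapT => /(infinite_set_fset (hilb J k0).+1) [B sB].
have dB : distinct_points [seq vpick z | z <- (B : seq _)].
  by apply: distinct_lines => [|z hz]; [exact: fset_uniq|exact: sB].
have := size_distinct dB (fun k le => (hk0 k le).1).
by rewrite size_map => h1 h2; have := leq_trans h2 h1; rewrite ltnn.
Qed.

(** For such [p] the ideal [(J : p)] has no zero, so it contains a power of [l],
    which can be cancelled in large degree. *)
Lemma meet_lines_sub vs : (forall v, point v -> exists2 c : K, c != 0 & c *: v \in vs) ->
  exists k0 : nat, forall (k : nat) p, (k0 <= k)%N -> Hd k p -> meet_localized vs p -> J p.
Proof.
move=> hvs; have [k0 hk0] := hilb_stable hJ hl hP.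
exists k0 => k p le hp mp.
have hC := hom_colon hJ hp.
have prC : primary (colon J p).
  apply: nullstellensatz => //.
    by move=> q hq; apply: (idM hJ.1).
  move=> v pv zv; have [c c0 cv] := hvs v pv; have [e [u [hu nu hk]]] := mp _ cv.
  have := zv u; rewrite /colon /= mulrC => /(_ hk) uv.
  move/eqP: nu; apply.
  have -> : u.@[(c *: v) ord0] = u.@[fun i => c * v ord0 i].
    by apply: meval_eq => i; rewrite mxE.
  by rewrite (meval_scale _ _ hu) uv mulr0.
have [N hN] := primary_rad hC.1 prC hl isT.
have {hN} : J (l ^+ N * p) by rewrite mulrC.
elim: N => [|N IH]; first by rewrite expr0 mul1r.
rewrite exprS -mulrA => h; apply: IH; apply: (hk0 (k + N)%N _).2 h; first by lia.
rewrite addnC PoszD; apply: HdM => //.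
by have := HdXn N hl; rewrite mul1r.
Qed.

Theorem hilb_lines : exists k0 : nat, forall k : nat, (k0 <= k)%N ->
  hilb J k = (\sum_(z <- fset_set lines) hilb (localized J (vpick z)) k)%N.
Proof.
pose vs := [seq vpick z | z <- (fset_set lines : seq _)].
have dvs : distinct_points vs.
  apply: distinct_lines => [|z]; first exact: fset_uniq.
  by rewrite (in_fset_set finite_lines) => /set_mem.
have [k1 hk1] := hilb_meet dvs.
have [|k2 hk2] := meet_lines_sub (vs := vs).
  move=> v [zv nv]; have Lv : lines <[v]>%VS by exists v => //; split=> //; apply/eqP.
  have [[_ n'] zE] := lines_pick Lv.
  have /vlineP [c cE] := memv_pick <[v]>%VS.
  exists c; first by apply: contraNneq n'; rewrite cE => ->; rewrite scale0r.
  by rewrite -cE; apply: map_f; rewrite (in_fset_set finite_lines); apply: mem_set.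
exists (maxn k1 k2) => k; rewrite geq_max => /andP [le1 le2].
have := hk1 k le1; rewrite big_map => <-.
apply: hilb_eq; [exact: id_subsp (hom_meet vs).1|exact: id_subsp hJ.1|].
by move=> p hp; split=> [|Jp]; [exact: (hk2 k)|exact: meet_sub].
Qed.

End Separation.

Section Tau.
Context {K : numClosedFieldType} {n d : nat} {f l : {mpoly K[n]}}.
Local Notation J := (gen (range (fun i : 'I_n => f^`M(i)))).
Hypotheses (hf : Hd d f) (d0 : (0 < d)%N) (hl : Hd 1 l) (hP : primary (adj J l)).

(** The total Tjurina number is the degree of the scheme defined by the partial
    derivatives in projective space. *)
Theorem hilb_tau : exists k0 : nat, forall k : nat, (k0 <= k)%N -> hilb J k = tau f.
Proof.
have hJ := hom_jacobian hf.
have SE : Sigma f = lines (J := J) by rewrite /Sigma /lines /sing zeros_gen.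
have [k1 hk1] := hilb_lines hJ hl hP.
have [k2 hk2] := hilb_localized_const hJ hl hP.
exists (maxn k1 k2) => k; rewrite geq_max => /andP [le1 le2].
rewrite hk1 // /tau SE fsbig_finite; last exact: finite_lines hJ hl hP.
rewrite /= big_seq [RHS]big_seq; apply: eq_bigr => z.
rewrite (in_fset_set (finite_lines hJ hl hP)) => /set_mem Lz.
have [[zv nv] _] := lines_pick hJ Lz.
apply/esym/(tjurina_atE hf d0 zv nv) => D.
by rewrite (hk2 _ (k + D)%N) ?(hk2 _ k) // (leq_trans le2) ?leq_addr.
Qed.

End Tau.

(** * Differential forms of top degree *)

Section TopForms.
Context {K : fieldType} {n : nat}.
Local Notation S := {mpoly K[n]}.
Local Notation dforms := {ffun {set 'I_n} -> {mpoly K[n]}}.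
Implicit Types (f : S) (w eta : dforms).

(** A top form is determined by its coefficient on the full set. *)
Definition topforms (V : set S) : set (dforms) :=
  Omega n `&` [set w | V (w [set: 'I_n]%SET)].

Lemma wedge_dform f eta (A : {set 'I_n}) : wedge (dform f) eta A =
  \sum_(i in A) shuffle_sign [set i]%SET (A :\ i)%SET * f^`M(i) * eta (A :\ i)%SET.
Proof.
rewrite ffunE.
under eq_bigr => B _ do rewrite ffunE mulr_sumr mulr_suml.
rewrite (exchange_big_dep xpredT) //= [RHS]big_mkcond; apply: eq_bigr => i _.
case: ifP => iA.
  have cond : ([set i]%SET \subset A) && ([set i]%SET == [set i]%SET) by rewrite finset.sub1set iA eqxx.
  rewrite (bigD1 [set i]%SET cond) /= big1 ?addr0 // => B.
  by move=> /andP [/andP [_ /eqP ->]]; rewrite eqxx.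
rewrite big1 // => B /andP [BA /eqP e]; move: BA.
by rewrite e finset.sub1set iA.
Qed.

Lemma Omega_top w : Omega n w <-> forall A : {set 'I_n}, A != [set: 'I_n]%SET -> w A = 0.
Proof.
split=> h A.
  move=> nA; apply/eqP; apply: contraNT nA => /h cA.
  by rewrite eqEcard finset.subsetT cardsT card_ord cA leqnn.
by move=> wA; have [->|/h e] := eqVneq A [set: 'I_n]%SET; rewrite ?cardsT ?card_ord // e eqxx in wA *.
Qed.

Let jac f : set S := gen (range (fun i : 'I_n => f^`M(i))).

Lemma M_relE f : M_rel f = topforms (jac f).
Proof.
have iJ : is_ideal (jac f) by exact: gen_ideal.
rewrite eqEsubset; split=> [_ [eta heta <-]|w [hw Jw]].
  split=> /=; last first.
    rewrite wedge_dform; apply: (id_sum iJ) => i _; apply: (idMr iJ); apply: (idM iJ).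
    by apply: sub_gen; exists i.
  apply/Omega_top => A nA; rewrite wedge_dform big1 // => i iA.
  have [->|/heta cA] := eqVneq (eta (A :\ i)%SET) 0; first by rewrite mulr0.
  case/eqP: nA; apply/eqP; rewrite eqEcard finset.subsetT cardsT card_ord /=.
  by rewrite (cardsD1 i) iA cA add1n leqSpred.
have [c hc] : exists c : 'I_n -> S, w [set: 'I_n]%SET = \sum_i c i * f^`M(i).
  have := Jw [set p | exists c : 'I_n -> S, p = \sum_i c i * f^`M(i)]; apply.
    split=> [|p q [a ->] [b ->]|p q [a ->]].
    - by exists (fun=> 0); rewrite big1 // => i _; rewrite mul0r.
    - exists (fun i => a i + b i); rewrite -big_split /=.
      by apply: eq_bigr => i _; rewrite mulrDl.
    - by exists (fun i => p * a i); rewrite mulr_sumr; apply: eq_bigr => i _; rewrite mulrA.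
  move=> _ [i _ <-]; exists (fun j => (j == i)%:R).
  rewrite (bigD1 i) //= eqxx mul1r big1 ?addr0 // => j /negbTE ->.
  by rewrite mul0r.
pose sg (i : 'I_n) : S := shuffle_sign [set i]%SET ([set: 'I_n] :\ i)%SET.
(* The signs of the wedge product are squared away. *)
pose eta : dforms := [ffun A => \sum_(i | A == ([set: 'I_n] :\ i)%SET) sg i * c i].
have etaE i : eta ([set: 'I_n] :\ i)%SET = sg i * c i.
  rewrite ffunE (bigD1 i) ?eqxx //= big1 ?addr0 // => j /andP [/eqP e ne].
  have := finset.in_setD1 i [set: 'I_n]%SET j; rewrite -e !inE eqxx eq_sym (negbTE ne).
  by [].
exists eta.
  move=> A; rewrite ffunE => nz.
  have [i /eqP ->|h] := pickP (fun i => A == ([set: 'I_n] :\ i)%SET).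
    by have := cardsD1 i [set: 'I_n]%SET; rewrite inE cardsT card_ord add1n => /(congr1 predn) /= <-.
  by move: nz; rewrite big_pred0 ?eqxx.
apply/ffunP => A; rewrite wedge_dform.
have [->|nA] := eqVneq A [set: 'I_n]%SET.
  rewrite hc big_mkcond; apply: eq_bigr => i _; rewrite inE etaE -/(sg i).
  have sg2 : sg i * sg i = 1 by rewrite /sg /shuffle_sign -expr2 sqrr_sign.
  rewrite (_ : _ * _ * _ = (sg i * sg i) * (c i * f^`M(i))); last by ring.
  by rewrite sg2 mul1r.
rewrite ((Omega_top w).1 hw A nA) big1 // => i iA.
rewrite ffunE big1 ?mulr0 // => j /eqP e.
have ij : i = j.
  apply/eqP; apply: contraT => ne; have := finset.in_setD1 i A i; rewrite e !inE eqxx ne.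
  by [].
by case/eqP: nA; rewrite -(finset.setD1K iA) e ij finset.setD1K ?inE.
Qed.

Lemma topforms_Omega_deg k : Omega_deg n k = topforms (@Hd K n (k - n%:Z)).
Proof.
rewrite eqEsubset; split=> w [hw hd]; split=> //.
  apply/HdP => m; rewrite -mcoeff_msupp => /hd; rewrite cardsT card_ord; lia.
move=> A m hm; have [E|nA] := eqVneq A [set: 'I_n]%SET; last first.
  by move: hm; rewrite ((Omega_top w).1 hw A nA) msupp0.
by move: hm; rewrite E cardsT card_ord mcoeff_msupp => /((HdP _ _).1 hd); lia.
Qed.

Lemma dim_topforms (V W : set S) : subsp V -> subsp W -> fin_quot V W ->
  dim_quot (topforms V) (topforms W) = dim_quot V W.
Proof.
move=> hV hW hfin.
pose phi (p : S) : dforms := [ffun A => if A == [set: 'I_n]%SET then p else 0].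
have phiO p : Omega n (phi p).
  by apply/Omega_top => A nA; rewrite ffunE (negbTE nA).
have sO : subsp (Omega n : set (dforms)).
  split=> [|a u v /Omega_top hu /Omega_top hv].
    by apply/Omega_top => A _; rewrite ffunE.
  by apply/Omega_top => A nA; rewrite !ffunE hu // hv // scaler0 addr0.
apply: (@dim_quot_map _ _ _ _ _ _ _ phi) => //.
- move=> a p q; apply/ffunP => A; rewrite !ffunE.
  by case: ifP => _ //; rewrite scaler0 addr0.
- split=> [|a u v [hu hu'] [hv hv']].
    by split; [case: sO|rewrite /= ffunE; case: hW].
  by split; [apply: sO.2|rewrite /= !ffunE; apply: hW.2].
- by move=> p hp; split=> //=; rewrite ffunE eqxx.
- by move=> p _; split=> [[_]|hp]; [rewrite /= ffunE eqxx|split=> //=; rewrite ffunE eqxx].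
- move=> w [hw hV']; exists (w [set: 'I_n]%SET) => //; split.
    by apply: (subspB sO).
  by rewrite /= !ffunE eqxx subrr; case: hW.
Qed.

End TopForms.

(** * Saturation and duality *)

Section Saturation.
Context {K : numFieldType} {n : nat}.
Local Notation S := {mpoly K[n]}.
Implicit Types (J : set S) (l p : S).

Definition saturation J l : set S := [set p | exists N : nat, J (l ^+ N * p)].

Lemma saturation_ideal J l : is_ideal J -> is_ideal (saturation J l).
Proof.
move=> hJ; split=> [|p q [a ha] [b hb]|a p [b hb]].
- by exists 0%N; rewrite mulr0; apply: id0.
- exists (a + b)%N; rewrite mulrDr; apply: idD => //.
    by rewrite exprD mulrAC; apply: idMr.
  by rewrite exprD -mulrA; apply: idM.
- by exists b; rewrite mulrCA; apply: idM.
Qed.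

Lemma sub_saturation J l : J `<=` saturation J l.
Proof. by move=> p hp; exists 0%N; rewrite expr0 mul1r. Qed.

Lemma ideal_setT (X : set S) p : X p -> ideal setT X p.
Proof.
move=> Xp; exists [:: (1, p)]; last by rewrite big_seq1 mul1r.
by move=> q; rewrite inE => /eqP ->.
Qed.

Lemma ideal_setT_sub (X I : set S) : is_ideal I -> X `<=` I -> ideal setT X `<=` I.
Proof.
move=> hI sX _ [s hs ->]; rewrite big_seq; apply: id_sum => // q /hs [_ /sX hq].
exact: idM.
Qed.

Definition order_ge (j : nat) : set S := [set p | forall k : int, k < j%:Z -> hc k p = 0].

Lemma order_ge_mul i j p q : order_ge i p -> order_ge j q -> order_ge (i + j)%N (p * q).
Proof.
move=> hp hq k kj; rewrite (hc_partition (leqnn (msize p))) mulr_suml (raddf_sum (hc k)).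
rewrite big1 // => b _ /=; rewrite (hcM _ _ (@Hd_hc _ _ b p)).
have [lt|ge] := ltP (b%:Z) i%:Z; first by rewrite hp ?mul0r.
by rewrite hq ?mulr0 //; lia.
Qed.

Lemma order_ge_ideal j : is_ideal (order_ge j).
Proof.
split=> [k _|p q hp hq k kj|a p hp]; first by rewrite raddf0.
  by rewrite raddfD /= hp // hq // addr0.
by apply: (@order_ge_mul 0 j) => // k k0; apply: hc_neg.
Qed.

Lemma ideal_exp_order j p : ideal_exp (@maxideal K n) j p -> order_ge j p.
Proof.
elim: j p => [|j IH] p; first by move=> _ k k0; apply: hc_neg.
apply: ideal_setT_sub; first exact: order_ge_ideal.
move=> _ [x hx [y hy <-]]; apply: (@order_ge_mul 1 j); last exact: IH.
move: hx; apply: ideal_setT_sub; first exact: order_ge_ideal.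
move=> _ [i _ <-] k k1; apply: (hc_ne (HdXi i)).
by apply: contraTneq k1 => <-.
Qed.

Lemma maxideal_Hd1 l : Hd 1 l -> @maxideal K n l.
Proof.
move=> hl; rewrite (Hd1_lform hl).
exists [seq ((l@_U_(i))%:MP, 'X_i) | i <- enum 'I_n].
  by move=> _ /mapP [i _ ->] /=; split=> //; exists i.
by rewrite big_map big_enum /=; apply: eq_bigr => i _; rewrite mul_mpolyC.
Qed.

Lemma ideal_exp_pow l j : Hd 1 l -> ideal_exp (@maxideal K n) j (l ^+ j).
Proof.
move=> hl; elim: j => [//|j IH]; apply: ideal_setT; exists l; first exact: maxideal_Hd1.
by exists (l ^+ j) => //; rewrite exprS.
Qed.

(** Large powers of the maximal ideal lie in [J + (l ^+ N)]. *)
Lemma saturationP J l p : hom_ideal J -> Hd 1 l -> primary (adj J l) ->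
  (exists j0 : nat, forall j, (j0 <= j)%N -> forall g, ideal_exp (@maxideal K n) j g -> J (g * p))
  <-> saturation J l p.
Proof.
move=> hJ hl hP; split=> [[j0 h]|[N hN]].
  by exists j0; apply: h (leqnn j0) _ _; apply: ideal_exp_pow.
have hA := adj_ideal hJ.1 (l ^+ N).
have prA : primary (adj J (l ^+ N)).
  apply: primary_le hP; apply: adj_sub; first exact: rad_ideal.
    by move=> q hq; apply: rad_sub; apply: sub_adj.
  by exists N; apply: mem_adj; exact: hJ.1.
have [k0 hk0] := primary_deg hA prA.
exists k0 => j le g /ideal_exp_order hg.
have [a ha] : adj J (l ^+ N) g.
  rewrite (hc_partition (leqnn (msize g))); apply: id_sum => // i _.
  have [lt|ge] := ltnP i j; first by rewrite hg ?ltz_nat //; apply: id0.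
  apply: (hk0 i); first exact: Hd_hc.
  by rewrite lez_nat (leq_trans le).
apply: (idBl hJ.1 (q := a * (l ^+ N * p))); last by apply: idM hN; exact: hJ.1.
by rewrite mulrA -mulrBl; apply: idMr ha; exact: hJ.1.
Qed.

End Saturation.

Section Duality.
Context {K : numClosedFieldType} {m : nat}.
Local Notation S := {mpoly K[m.+1]}.

Lemma adj_swap (I : set S) g h : is_ideal I -> adj (adj I g) h = adj (adj I h) g.
Proof.
move=> hI; rewrite eqEsubset; split=> p [a [b hb]]; exists b, a;
  by rewrite addrAC.
Qed.

Lemma hilb_adj_low (I : set S) l (N : nat) k : hom_ideal I -> Hd 1 l -> k < N%:Z ->
  hilb (adj I (l ^+ N)) k = hilb I k.
Proof.
move=> hI hl kN; apply: hilb_eq; [exact: id_subsp hI.1|exact: id_subsp (adj_ideal hI.1 _)|].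
move=> p hp; split=> [h|]; first exact: sub_adj.
exact: (adj_low hI hl hp kN).
Qed.

Lemma hilb_saturation (J : set S) l (k : int) (N k0 : nat) : hom_ideal J -> Hd 1 l ->
  (forall (j : nat) p, (k0 <= j)%N -> Hd j p -> J (l * p) -> J p) -> k0%:Z <= k + N%:Z ->
  hilb (saturation J l) k = hilb (colon J (l ^+ N)) k.
Proof.
move=> hJ hl st le; apply: hilb_eq.
- exact: id_subsp (colon_ideal _ hJ.1).
- exact: id_subsp (saturation_ideal _ hJ.1).
move=> p hp; split=> [h|[a ha]]; first by exists N.
have {}ha : J (l ^+ (a + N) * p) by rewrite exprD [l ^+ a * _]mulrC -mulrA; apply: (idM hJ.1).
case: k hp le => k hp le; last by rewrite (@Hd_neg _ _ (Negz k) p isT hp); apply: id0 (colon_ideal _ hJ.1).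
elim: a ha => [//|a IH] ha; apply: IH; apply: (st (a + N + k)%N); first by lia.
  by rewrite PoszD; apply: HdM => //; have := HdXn (a + N) hl; rewrite mul1r.
by rewrite mulrA -exprS.
Qed.

Lemma hilb_colon_frob (A : set S) s g (e : nat) j : is_ideal A -> frob A s -> Hd e g ->
  hilb (colon A g) j = hilb (colon A g) (s - e%:Z - j).
Proof.
move=> hA [phi [lin deg ann n1]] hg; have hC := colon_ideal g hA.
have [Ag|nAg] := pselect (A g).
  by rewrite !hilb_eq0 //; [exact: id_subsp hC|move=> p _; apply: idMr|exact: id_subsp hC|
    move=> p _; apply: idMr].
apply: hilb_frob => //; exists (fun p => phi (g * p)); split.
- by move=> a p q; rewrite mulrDr -scalerAr lin.
- move=> k p hp ne; apply: (deg _ _ (HdM hg hp)).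
  by apply: contraNneq ne => <-; apply/eqP; lia.
- move=> p; split=> [/ann h q|h]; first by rewrite mulrA.
  by apply/ann => q; rewrite -mulrA.
- by rewrite /colon /= mulr1.
Qed.

Context {h l : nat -> S} {e : nat}.
Hypotheses (hh : forall j, (j < m.+1)%N -> Hd e (h j)) (hl : forall j, (j < m.+1)%N -> Hd 1 (l j))
  (e0 : (0 < e)%N) (hP : forall i, (i < m.+1)%N -> primary (mixed h l (fun=> 1%N) i)).
Local Notation I := (gen [set h j | j in [set j | (j < m)%N]]).
Local Notation J := (adj I (h m)).
Local Notation x := (l m).
Local Notation s := ((m * e.-1)%N%:Z).

(** For [N] large, the Gorenstein algebra [S / (I + (x ^+ N))] of socle degree [sg] sees
    the kernel of [h m] on [S / I] in degree [j], and dually its cokernel in degree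
    [sg - j]. The latter is the part of degree [sg - j] of [S / (J + (x ^+ N))], which
    is [t] minus the dimension of the image of [x ^+ N] coming from degree
    [s - 1 - j], that is, of the saturated quotient in that degree. *)
Theorem duality (t k0 : nat) (j : int) :
  (forall k : nat, (k0 <= k)%N -> hilb J k = t) ->
  (forall (k : nat) p, (k0 <= k)%N -> Hd k p -> J (x * p) -> J p) ->
  (hilb (saturation J x) (s - 1 - j))%:Z =
    t%:Z - (hilb J (j + e%:Z))%:Z + ((hilb I (j + e%:Z))%:Z - (hilb I j)%:Z).
Proof.
move=> ht st; have hI := hom_curve hh hl e0; have hg := hh (ltnSn m); have hx := hl (ltnSn m).
have hJ := hom_adj hI hg.
(* N exceeds the degrees j and j + e, and sg - j is at least k0. *)
pose N := (`|j| + e + k0 + 1)%N.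
have N0 : (0 < N)%N by rewrite /N addn1.
have jN : j < N%:Z by rewrite /N; lia.
have jeN : j + e%:Z < N%:Z by rewrite /N; lia.
have hF := curve_frob hh hl e0 hP N0.
set sg := s + N%:Z - 1 in hF.
have hxN : Hd N (x ^+ N) by have := HdXn N hx; rewrite mul1r.
have hIN := hom_adj hI hxN.
have E1 := hilb_exact (j + e%:Z) hIN hg.
have E2 := hilb_exact (sg - j) hIN hg.
have E3 := hilb_frob j hIN.1 hF.
have E4 := hilb_colon_frob j hIN.1 hF hg.
have E5 := hilb_exact (sg - j) hJ hxN.
rewrite (hilb_adj_low hI hx jeN) addrK (adj_swap _ _ hI.1) (hilb_adj_low hJ hx jeN) in E1.
rewrite (adj_swap _ _ hI.1) in E2.
rewrite (hilb_adj_low hI hx jN) in E3.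
have sgN : sg - j - N%:Z = s - 1 - j by rewrite /sg; ring.
rewrite sgN in E5.
have big : k0%:Z <= s - 1 - j + N%:Z by rewrite /N; move: (m * e.-1)%N => c; lia.
rewrite (hilb_saturation (N := N) hJ hx st big).
have big' : k0%:Z <= sg - j by rewrite /sg; move: big; lia.
have sgj : sg - j = `|sg - j|%N by lia.
have E6 : hilb J (sg - j) = t by rewrite sgj; apply: ht; lia.
have e1 : sg - j - e%:Z = sg - e%:Z - j by ring.
rewrite e1 -E4 -E3 in E2; rewrite E6 in E5.
have arith (a b c u r v : nat) : b = (a + c)%N -> u = (r + c)%N -> t = (r + v)%N ->
  v%:Z = t%:Z - a%:Z + (b%:Z - u%:Z) by lia.
exact: arith E1 E2 E5.
Qed.

End Duality.

(** * The formulas *)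

Section Dimensions.
Context {K : numFieldType} {n : nat} {f l : {mpoly K[n]}}.
Local Notation J := (gen (range (fun i : 'I_n => f^`M(i)))).
Hypotheses (hJ : hom_ideal J) (hl : Hd 1 l) (hP : primary (adj J l)).

Lemma M'_formsE : M'_forms f = topforms (saturation J l).
Proof.
have E p : (exists j0 : nat, forall j, (j0 <= j)%N -> forall g,
    ideal_exp (@maxideal K n) j g -> J (g * p)) <-> saturation J l p by exact: saturationP.
rewrite eqEsubset; split=> w [hw hw']; split=> //.
  apply/E; case: hw' => j0 h; exists j0 => j le g hg.
  by have := h j le g hg; rewrite M_relE => -[_]; rewrite /= ffunE.
have [j0 h] := (E _).2 hw'; exists j0 => j le g hg; rewrite M_relE; split.
  by apply/Omega_top => A nA; rewrite ffunE ((Omega_top w).1 hw A nA) mulr0.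
by rewrite /= ffunE; apply: h hg.
Qed.

Lemma muE k : mu f k = hilb J (k - n%:Z).
Proof.
rewrite /mu topforms_Omega_deg M_relE dim_topforms //; first exact: subsp_Hd.
  exact: id_subsp hJ.1.
exact: fin_Hd (id_subsp hJ.1).
Qed.

Lemma mu''E k : mu'' f k = hilb (saturation J l) (k - n%:Z).
Proof.
have sS := id_subsp (saturation_ideal l hJ.1).
rewrite /mu'' topforms_Omega_deg M'_formsE dim_topforms //; first exact: subsp_Hd.
exact: fin_Hd sS.
Qed.

Lemma mu_split k : mu f k = (mu'' f k + mu' f k)%N.
Proof.
have sJ := id_subsp hJ.1; have sS := id_subsp (saturation_ideal l hJ.1).
have sH := @subsp_Hd K n (k - n%:Z); have sHS := subspI sH sS.
have h1 : Hd (k - n%:Z) `&` saturation J l `<=` Hd (k - n%:Z) by move=> p [].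
have h2 : J `&` Hd (k - n%:Z) `<=` Hd (k - n%:Z) `&` saturation J l.
  by move=> p [Jp hp]; split=> //; exact: sub_saturation.
rewrite muE mu''E /hilb (dim_quot_add sH sHS sJ h1 h2 (fin_Hd _ sJ)); congr (_ + _)%N.
  by apply: hilb_eq => // p hp; split=> // -[].
rewrite /mu' topforms_Omega_deg M'_formsE M_relE.
have -> : topforms (Hd (k - n%:Z)) `&` topforms (saturation J l) =
    topforms (Hd (k - n%:Z) `&` saturation J l).
  rewrite eqEsubset; split=> w; first by move=> [[o hw] [_ sw]].
  by move=> [o [hw sw]].
rewrite dim_topforms //.
exact: (fin_quot_sub sJ sJ h1 _ (fin_Hd _ sJ)).
Qed.

End Dimensions.

Section Main.
Context {K : numClosedFieldType} {m d : nat} {f : {mpoly K[m.+1]}}.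
Local Notation n := m.+1.
Local Notation J := (gen (range (fun i : 'I_n => f^`M(i)))).
Hypotheses (m0 : (0 < m)%N) (hf : Hd d f) (hdim : dim_le (sing f) 1).

Let hJ : hom_ideal J.
Proof. by apply: hom_gen => _ [i _ <-]; exists (d.-1 : int); apply: (mderiv_Hd _ hf). Qed.

(** If all derivatives vanish then the singular locus is the whole space, of
    dimension at least two; a nonzero linear form [l] has zeros there. *)
Lemma gradient_neq0 : exists i : 'I_n, f^`M(i) != 0.
Proof.
have hdimJ : dim_le (zeros J) 1 by rewrite zeros_gen.
have [l [hl nl hP]] := exists_parameter (ltn0Sn m) hJ hdimJ.
apply: contrapT => h; have allz v : zeros J v.
  rewrite zeros_gen => _ [i _ <-]; rewrite (_ : f^`M(i) = 0) ?meval0 //.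
  by apply/eqP; apply: contrapT => /negP nz; apply: h; exists i.
pose i1 : 'I_n := @Ordinal n 1 m0.
have i01 : i1 != ord0 by [].
pose a0 := l@_U_(ord0); pose a1 := l@_U_(i1).
pose v : 'rV[K]_n := if a0 == 0 then \row_j (j == ord0)%:R
  else \row_j (if j == ord0 then a1 else if j == i1 then - a0 else 0).
have lE (w : 'rV[K]_n) : l.@[w ord0] = \sum_j l@_U_(j) * w ord0 j.
  rewrite {1}(Hd1_lform hl) (raddf_sum (meval _)); apply: eq_bigr => j _.
  by rewrite /= mevalZ mevalXU.
have nv : v != 0.
  rewrite /v; have [_|nz] := eqVneq a0 0.
    by apply/eqP => /rowP /(_ ord0); rewrite !mxE eqxx => /eqP; rewrite pnatr_eq0.
  apply/eqP => /rowP /(_ i1); rewrite !mxE (negbTE i01) eqxx => /eqP.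
  by rewrite oppr_eq0 (negbTE nz).
have := parameter_neq0 hP (allz v) nv; rewrite lE (bigD1 ord0) //= (bigD1 i1) //= big1.
  rewrite /v; have [z|_] := eqVneq a0 0; rewrite !mxE ?eqxx ?(negbTE i01).
    by rewrite -/a0 z mul0r mulr0 !addr0 eqxx.
  by rewrite addr0 mulrN mulrC subrr eqxx.
move=> j /andP [j0 j1]; rewrite /v; have [_|_] := eqVneq a0 0; rewrite mxE (negbTE j0) ?(negbTE j1);
  by rewrite mulr0.
Qed.

Lemma degree_gt0 : (0 < d)%N.
Proof.
have [i nz] := gradient_neq0; rewrite lt0n; apply: contraNneq nz => d0.
apply/eqP/mpolyP => j; rewrite mcoeff0 mcoeff_deriv.
have [->|/((HdP _ _).1 hf)] := eqVneq f@_(j + U_(i)) 0; first by rewrite mul0rn.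
by rewrite d0 mdegD mdeg1 addn1.
Qed.

Lemma invariants_degree1 k : d = 1%N ->
  [/\ mu f k = 0%N, mu' f k = 0%N, mu'' f k = 0%N & tau f = 0%N].
Proof.
move=> d1; have [i nz] := gradient_neq0.
have h0 : Hd 0 f^`M(i) by have := mderiv_Hd i hf; rewrite d1.
have [c cE] : exists c : K, f^`M(i) = c%:MP.
  exists f^`M(i)@_0%MM; rewrite -[LHS](hc_id h0); apply/mpolyP => j.
  rewrite mcoeff_hc mcoeffC eqz_nat mdeg_eq0.
  by case: (eqVneq j 0%MM) => [->|_]; rewrite ?mulr1 ?mulr0.
have c0 : c != 0 by apply: contraNneq nz => c0; rewrite cE c0 mpolyC0.
have J1 : J 1.
  rewrite -mpolyC1 -(mulVf c0) mpolyCM -cE; apply: (idM hJ.1).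
  by apply: sub_gen; exists i.
have hx : Hd 1 ('X_ord0 : {mpoly K[n]}) by exact: HdXi.
have prim : primary (adj J 'X_ord0).
  by move=> j; apply: rad_sub; apply: sub_adj; apply: (id1 hJ.1).
have mu0 : mu f k = 0%N.
  by rewrite (muE hJ) hilb_eq0 // => [|p _]; [exact: id_subsp hJ.1|exact: (id1 hJ.1)].
have := mu_split hJ hx prim k; rewrite mu0 => /esym/eqP.
rewrite addn_eq0 => /andP [/eqP h1 /eqP h2]; split=> //.
rewrite /tau (_ : Sigma f = set0) ?fsbig_set0 //.
rewrite -subset0 => z [v [hv _] _].
have := hv f^`M(i) (imageT (fun i => f^`M(i)) i).
by rewrite cE mevalC => c00; rewrite c00 eqxx in c0.
Qed.

(** With [k - n = s - 1 - j] the degrees [n * d - k - n] and [j + e] agree, so that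
    [duality] reads as the formula for [mu''], up to the symmetry of [gamma]. *)
Theorem mu_formulas k :
  (mu' f k)%:Z = (mu f k)%:Z + (mu f ((n * d)%:Z - k))%:Z - gamma n d k - (tau f)%:Z
  /\ (mu'' f k)%:Z = (tau f)%:Z - (mu f ((n * d)%:Z - k))%:Z + gamma n d k.
Proof.
have d0 := degree_gt0.
(* For d = 1 the ideal J is the whole ring and all terms are zero. *)
have [d1|ne1] := eqVneq d 1%N.
  have [h1 h2 h3 ->] := invariants_degree1 k d1.
  have [h4 _ _ _] := invariants_degree1 ((n * d)%:Z - k) d1.
  rewrite h1 h2 h3 h4 gammaE // d1 /geom big_ord0 exprS mul0r.
  by case: (k - n%:Z) => j; rewrite /= ?coef0.
pose e := d.-1; have e0 : (0 < e)%N by rewrite /e; lia.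
have hdimJ : dim_le (zeros J) 1 by rewrite zeros_gen.
have [l0 [hl0 nl0 hP0]] := exists_parameter (ltn0Sn m) hJ hdimJ.
have hfi (j : 'I_n) : Hd e f^`M(j) by exact: mderiv_Hd.
have [h [hh JE hP1]] := general_forms e0 hfi hl0 nl0 hP0.
have [l [lm hl hP]] := mixed_chain e0 hh hl0 hP1.
have [k1 hk1] := hilb_tau hf d0 hl0 hP0.
have [k2 hk2] := hilb_stable hJ hl0 hP0.
pose j := (m * e.-1)%N%:Z - 1 - (k - n%:Z).
have D : (mu'' f k)%:Z = (tau f)%:Z - (mu f ((n * d)%:Z - k))%:Z + gamma n d k.
  have := @duality K m h l e hh hl e0 hP (tau f) (maxn k1 k2) j.
  rewrite -JE lm => D.
  rewrite (mu''E hJ hl0 hP0) (muE hJ) gammaE //.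
  have -> : k - n%:Z = (m * e.-1)%N%:Z - 1 - j by rewrite /j; ring.
  have -> : (n * d)%:Z - k - n%:Z = j + e%:Z.
    rewrite /j /e mulSn; case: (d) d0 ne1 => [//|[//|b]] _ _ /=.
    rewrite !PoszD !PoszM; lia.
  rewrite D; last 2 first.
  - by move=> i; rewrite geq_max => /andP [h1 _]; exact: hk1.
  - by move=> i p; rewrite geq_max => /andP [_ h2]; exact: (hk2 i h2).2.
  have C := curve_hilb hh hl e0 hP (j + e%:Z).
  rewrite addrK in C; rewrite C; congr (_ + _).
  rewrite [RHS]icoef_geomX_sym //; congr (icoef _ _).
  have arith (b e' : nat) (j' : int) : (0 < e')%N ->
    j' + e'%:Z = (e'.-1 + b)%N%:Z - (b%:Z - 1 - j').
    by case: e' => // e' _; rewrite PoszD intS /=; ring.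
  by rewrite mulSn; apply: arith.
split=> //.
by rewrite (mu_split hJ hl0 hP0 k) PoszD D; ring.
Qed.

End Main.

Theorem corollary3 (R : realType) (n d : nat) (f : {mpoly R[i][n]})
  (hn : (2 <= n)%N)
  (hf : f \is d.-homog)
  (hsing : dim_le (sing f) 1)
  (hvar : ~ polynomial_of_fewer_variables f)
  (k : int) :
  (mu' f k)%:Z = (mu f k)%:Z + (mu f ((n * d)%:Z - k))%:Z
                 - gamma n d k - (tau f)%:Z
  /\ (mu'' f k)%:Z = (tau f)%:Z - (mu f ((n * d)%:Z - k))%:Z + gamma n d k.
Proof.
case: n f hn hf hsing {hvar} => [//|m] f hn /Hd_homog hf hsing.
exact: (@mu_formulas (R[i] : numClosedFieldType) m d f hn hf hsing).
Qed.
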